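(* Let $a\ge0$ and let $(q,r)$ be $a$-admissible. There is $C(a,r)>0$ such that for every $F\in\mathbb S^+$, $$\Big(\int_0^\infty\Big|\widetilde{\mathcal H}_{\frac{a-1}2}(F)\Big(\xi,-\frac{\xi^2}{2\pi}\Big)\Big|^2d\omega_a(\xi)\Big)^{1/2}\le C(a,r)\|F\|_{L^{q'}_tL^{r'}_a}.$$ In particular (taking $q=r=\frac{2(a+3)}{a+1}$), there is $C(a)>0$ with $$\Big(\int_0^\infty\Big|\widetilde{\mathcal H}_{\frac{a-1}2}(F)\Big(\xi,-\frac{\xi^2}{2\pi}\Big)\Big|^2d\omega_a(\xi)\Big)^{1/2}\le C(a)\Big(\int_{\mathbb R}\int_0^\infty|F(x,t)|^{\frac{2(a+3)}{a+5}}\,d\omega_a(x)\,dt\Big)^{\frac{a+5}{2(a+3)}}.$$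
   Context: $\mathbb R^+=(0,\infty)$, $d\omega_a(x)=x^a\,dx$, $L^r_a=L^r(\mathbb R^+,d\omega_a)$, $\|u\|_{L^q_tL^r_a}=(\int_{\mathbb R}\|u(\cdot,t)\|_{L^r_a}^q\,dt)^{1/q}$; primes denote conjugate exponents. A pair $(q,r)$ is $a$-admissible if $r>2$, additionally $r<\frac{2(a+1)}{a-1}$ when $a>1$, and $\frac2q=(a+1)(\frac12-\frac1r)$. $\mathbb S^+$: $F\in C^\infty(\mathbb R^+\times\mathbb R;\mathbb C)$ with $\sup_{k+\ell\le p}\sup_{(x,t)}(1+x^2+t^2)^{p/2}|(x^{-1}\partial_x)^k\partial_t^\ell F(x,t)|<\infty$ for every $p\in\mathbb N_0$. Modified Hankel transform: $\mathcal H_\nu(\varphi)(\xi)=\xi^{-\nu}\int_0^\infty\varphi(y)J_\nu(\xi y)y^{\nu+1}\,dy$ ($J_\nu$ the Bessel function of the first kind). Fourier–Hankel transform: $\widetilde{\mathcal H}_\nu(F)(\xi,\tau)=\int_{\mathbb R}e^{-2\pi i\tau t}\mathcal H_\nu(F(\cdot,t))(\xi)\,dt$. *)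

(* Defs.v *)
From HB Require Import structures.
From mathcomp Require Import all_boot all_order all_algebra.
From mathcomp Require Import all_classical all_reals all_analysis.
Set Implicit Arguments. Unset Strict Implicit. Unset Printing Implicit Defensive.
Import Order.TTheory GRing.Theory Num.Theory.
Import numFieldNormedType.Exports.
Local Open Scope classical_set_scope.
Local Open Scope ring_scope.

Section Defs.
Context {R : realType}.

Definition Rpos : set R := `]0, +oo[.

(* Complex numbers are represented as pairs (real part, imaginary part). *)
Definition cmod (z : R * R) : R := Num.sqrt (z.1 ^+ 2 + z.2 ^+ 2).

Definition pdx (G : R -> R -> R * R) (x t : R) : R * R :=
  (derive1 (fun y => (G y t).1) x, derive1 (fun y => (G y t).2) x).
Definition pdt (G : R -> R -> R * R) (x t : R) : R * R :=
  (derive1 (fun s => (G x s).1) t, derive1 (fun s => (G x s).2) t).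

Fixpoint iterP (l : seq bool) (G : R -> R -> R * R) : R -> R -> R * R :=
  match l with
  | [::] => G
  | b :: l' => if b then pdx (iterP l' G) else pdt (iterP l' G)
  end.

Definition smooth_on_half (G : R -> R -> R * R) : Prop :=
  forall (l : seq bool) (x t : R), 0 < x ->
    [/\ derivable (fun y => (iterP l G y t).1) x 1,
        derivable (fun y => (iterP l G y t).2) x 1,
        derivable (fun s => (iterP l G x s).1) t 1,
        derivable (fun s => (iterP l G x s).2) t 1
      & {for (x, t), continuous (fun p : R * R => iterP l G p.1 p.2)}].

Definition opX (G : R -> R -> R * R) (x t : R) : R * R :=
  let z := pdx G x t in (x^-1 * z.1, x^-1 * z.2).

Definition Splus (F : R -> R -> R * R) : Prop :=
  smooth_on_half F /\
  forall p : nat, exists M : R, forall k l : nat, (k + l <= p)%N ->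
    forall x t : R, 0 < x ->
      Num.sqrt (1 + x ^+ 2 + t ^+ 2) ^+ p
        * cmod (iter k opX (iter l pdt F) x t) <= M.

(* Euler's Gamma function (used for s > 0) *)
Definition Gamma (s : R) : R :=
  \int[lebesgue_measure]_(u in `]0, +oo[) (u `^ (s - 1) * expR (- u)).

(* Bessel function of the first kind (for z > 0), by its power series *)
Definition besselJ (nu z : R) : R :=
  limn (fun n => \sum_(0 <= k < n)
    ((-1) ^+ k / (k`!%:R * Gamma (k%:R + nu + 1)) * (z / 2) `^ (2 * k%:R + nu))).

Definition hankel (nu : R) (phi : R -> R) (xi : R) : R :=
  xi `^ (- nu) *
  \int[lebesgue_measure]_(y in `]0, +oo[) (phi y * besselJ nu (xi * y) * y `^ (nu + 1)).

(* ... of a complex function (it is R-linear with a real kernel) *)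
Definition hankelC (nu : R) (phi : R -> R * R) (xi : R) : R * R :=
  (hankel nu (fun y => (phi y).1) xi, hankel nu (fun y => (phi y).2) xi).

(* Fourier-Hankel transform:
   int_R e^{-2 pi i tau t} H_nu(F(.,t))(xi) dt, written in real/imag parts *)
Definition fourier_hankel (nu : R) (F : R -> R -> R * R) (xi tau : R) : R * R :=
  let G := fun t => hankelC nu (fun y => F y t) xi in
  let th := fun t => 2 * pi * tau * t in
  (\int[lebesgue_measure]_(t in [set: R]) (cos (th t) * (G t).1 + sin (th t) * (G t).2),
   \int[lebesgue_measure]_(t in [set: R]) (cos (th t) * (G t).2 - sin (th t) * (G t).1)).

Definition conjexp (p : R) : R := p / (p - 1).

Definition admissible (a q r : R) : Prop :=
  [/\ 2 < r, (1 < a -> r < 2 * (a + 1) / (a - 1))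
    & 2 / q = (a + 1) * (2^-1 - r^-1)].

Definition restr_norm (a : R) (F : R -> R -> R * R) : \bar R :=
  ((\int[lebesgue_measure]_(xi in Rpos)
      ((cmod (fourier_hankel ((a - 1) / 2) F xi (- (xi ^+ 2) / (2 * pi)))) ^+ 2
         * xi `^ a)%:E) `^ (2^-1))%E.

Definition mixed_norm (a p s : R) (F : R -> R -> R * R) : \bar R :=
  ((\int[lebesgue_measure]_(t in [set: R])
      ((\int[lebesgue_measure]_(x in Rpos)
          ((cmod (F x t)) `^ s * x `^ a)%:E) `^ (p / s))) `^ (p^-1))%E.

End Defs.

(* Main.v *)
Require Import Defs.
From HB Require Import structures.
From mathcomp Require Import all_boot all_order all_algebra.
From mathcomp Require Import all_classical all_reals all_analysis.
From mathcomp Require Import measurable_realfun ring lra.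
Import Order.TTheory GRing.Theory Num.Theory.
Import numFieldNormedType.Exports.
Local Open Scope classical_set_scope.
Local Open Scope ring_scope.
Set Implicit Arguments. Unset Strict Implicit. Unset Printing Implicit Defensive.

(** Put nu = (a-1)/2 and let [bj a] be the normalised Bessel function, so that J_nu(z) is a constant
    times z^nu times [bj a z] ([besselJE]). At tau = -xi^2/(2 pi) the Fourier phase becomes e^{i
    xi^2 t}. The left-hand side is therefore a constant times the weighted L^2 norm of the integral
    over t of e^{i xi^2 t} (hk F_t)(xi), where F_t = F(.,t) and [hk] is the Hankel transform with
    kernel [bj a]. This is the dual form of a Strichartz estimate for the Bessel operator, and it is
    proved by the T T* method.

    Squaring and exchanging integrals ([energy_identity]) gives the double time integral of [hform]
    at time t - s applied to F_t and F_s. Two facts finish the proof. The dispersive estimate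
    [hform_dispersive] bounds that form by C |t-s|^{-lam} times the L^{r'} norms of F_t and F_s. The
    Hardy-Littlewood-Sobolev inequality [hls] then integrates |t-s|^{-lam}. Admissibility says
    exactly that lam = 2/q lies in (0,1) and that the time exponent is q' ([admissible_exponents]).
    A factor e^{-eps xi^2} makes every integral absolutely convergent; the bounds are uniform in
    eps, and [gauss_limit] removes it.

    The dispersive estimate interpolates ([interpolation]) between L^1 and L^2. For L^1 one needs a
    pointwise bound |s|^{-(1+a)/2} on the kernel [kK], the integral of e^{-(eps - i s) xi^2} bj(x
    xi) bj(y xi) xi^a. No closed formula for it is used. With the companion kernel [kM], built from
    bj', it solves a linear differential system along rays from the origin, and [kernel_energy] is a
    monotone energy for this system. The value at the origin, a Gaussian integral, is computed in
    modulus by another differential equation ([gmassE]). For L^2, Cauchy-Schwarz reduces to s = 0.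
    There the kernel is nonnegative ([kernel_ge0]) with uniformly bounded row integrals
    ([schur_int]), so Schur's test applies ([hform_L2_diag]); this takes the place of Plancherel's
    theorem.

    Complex quantities are carried throughout as pairs of real integrals, one with cos and one with
    sin. *)

Section Integrals.
Context {R : realType}.
Notation mu := (@lebesgue_measure R).

(** * Real Lebesgue integrals on the line, and Fubini under a product majorant *)

Definition intg (f : R -> R) : Prop := mu.-integrable setT (fun x => (f x)%:E).
Definition Int (f : R -> R) : R := \int[mu]_x f x.

Lemma intg_meas (f : R -> R) : intg f -> measurable_fun setT f.
Proof. by move=> /integrableP[/measurable_EFinP]. Qed.

Lemma intg_le (f g : R -> R) : measurable_fun setT f ->
  (forall x, `|f x| <= g x) -> intg g -> intg f.
Proof.
move=> mf fg; apply: le_integrable => //; first exact/measurable_EFinP.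
by move=> x _; rewrite /= lee_fin (le_trans (fg x))// ler_norm.
Qed.

Lemma eq_intg (f g : R -> R) : f =1 g -> intg f -> intg g.
Proof. by move=> /funext ->. Qed.

Lemma eq_Int (f g : R -> R) : f =1 g -> Int f = Int g.
Proof. by move=> /funext ->. Qed.

Lemma intgD (f g : R -> R) : intg f -> intg g -> intg (fun x => f x + g x).
Proof. by move=> /(@integrableD _ _ _ mu _ measurableT _ _) /[apply]. Qed.

Lemma intgZ (c : R) (f : R -> R) : intg f -> intg (fun x => c * f x).
Proof. by move=> /(@integrableZl _ _ _ mu _ measurableT c). Qed.

Lemma intgN (f : R -> R) : intg f -> intg (fun x => - f x).
Proof. by move=> /(intgZ (-1)); apply: eq_intg => x; rewrite mulN1r. Qed.

Lemma intgB (f g : R -> R) : intg f -> intg g -> intg (fun x => f x - g x).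
Proof. by move=> If /intgN; exact: intgD. Qed.

Lemma intg_norm (f : R -> R) : intg f -> intg (fun x => `|f x|).
Proof. by move=> /(@integrable_abse _ _ _ mu setT). Qed.

Lemma intg0 : intg (fun=> 0).
Proof. exact: integrable0. Qed.

Lemma intg_bounded (M : R) (f g : R -> R) : measurable_fun setT f ->
  (forall x, `|f x| <= M) -> intg g -> intg (fun x => f x * g x).
Proof.
move=> mf fM ig; apply: (@intg_le _ (fun x => M * `|g x|)).
- by apply: measurable_funM => //; exact: intg_meas.
- by move=> x; rewrite normrM ler_wpM2r.
- exact/intgZ/intg_norm.
Qed.

Lemma IntD (f g : R -> R) : intg f -> intg g ->
  Int (fun x => f x + g x) = Int f + Int g.
Proof. by move=> *; rewrite /Int RintegralD. Qed.

Lemma IntB (f g : R -> R) : intg f -> intg g ->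
  Int (fun x => f x - g x) = Int f - Int g.
Proof. by move=> *; rewrite /Int RintegralB. Qed.

Lemma IntZ (c : R) (f : R -> R) : intg f -> Int (fun x => c * f x) = c * Int f.
Proof. by move=> *; rewrite /Int RintegralZl. Qed.

Lemma Int0 : Int (fun=> 0) = 0.
Proof. by rewrite /Int /Rintegral integral0. Qed.

Lemma IntN (f : R -> R) : intg f -> Int (fun x => - f x) = - Int f.
Proof. by move=> i; rewrite -mulN1r -IntZ//; apply: eq_Int => x; rewrite mulN1r. Qed.

Lemma le_Int (f g : R -> R) : intg f -> intg g -> (forall x, f x <= g x) ->
  Int f <= Int g.
Proof. by move=> i1 i2 fg; apply: le_Rintegral. Qed.

Lemma Int_ge0 (f : R -> R) : (forall x, 0 <= f x) -> 0 <= Int f.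
Proof. by move=> f0; apply: Rintegral_ge0. Qed.

Lemma le_norm_Int (f g : R -> R) : measurable_fun setT f -> intg g ->
  (forall x, `|f x| <= g x) -> `|Int f| <= Int g.
Proof.
move=> mf ig fg; have If : intg f by exact: intg_le fg ig.
apply: le_trans (le_normr_Rintegral _ If) _ => //.
by apply: le_Int => //; exact: intg_norm.
Qed.

Lemma EFin_Int (f : R -> R) : intg f -> (Int f)%:E = (\int[mu]_x (f x)%:E)%E.
Proof. by move=> i; rewrite /Int /Rintegral fineK//; exact: integrable_fin_num. Qed.

Lemma ge0_intgP (f : R -> R) (M : R) : measurable_fun setT f ->
  (forall x, 0 <= f x) -> (\int[mu]_x (f x)%:E <= M%:E)%E ->
  intg f /\ Int f <= M.
Proof.
move=> mf f0 fM; have i : intg f.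
  apply/integrableP; split; first exact/measurable_EFinP.
  apply: le_lt_trans (ltry M); apply: le_trans fM.
  rewrite le_eqVlt; apply/orP; left; apply/eqP; apply: eq_integral => x _.
  by rewrite gee0_abs// lee_fin.
by split => //; rewrite -lee_fin EFin_Int.
Qed.

Lemma ge0_eInt_le (f g : R -> R) : measurable_fun setT f -> measurable_fun setT g ->
  (forall x, 0 <= f x) -> (forall x, f x <= g x) ->
  (\int[mu]_x (f x)%:E <= \int[mu]_x (g x)%:E)%E.
Proof.
move=> mf mg f0 fg; apply: ge0_le_integral => //.
- by move=> x _; rewrite lee_fin.
- exact/measurable_EFinP.
- exact/measurable_EFinP.
- by move=> x _; rewrite lee_fin.
Qed.

Section Fubini.
Variables (G : R * R -> R) (f h : R -> R).
Hypotheses (mG : measurable_fun setT G) (If : intg f) (Ih : intg h).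
Hypothesis GM : forall x y, `|G (x, y)| <= f x * h y.

Let mfh : measurable_fun setT (fun z : R * R => `|f z.1| * `|h z.2|).
Proof.
apply: measurable_funM; apply: measurableT_comp => //; apply: measurableT_comp => //.
- exact: intg_meas.
- exact: intg_meas.
Qed.

Let mEG : measurable_fun setT (fun z => (G z)%:E).
Proof. exact/measurable_EFinP. Qed.

Let iG : (mu \x mu)%E.-integrable setT (fun z => (G z)%:E).
Proof.
apply/integrable12ltyP => //.
apply: (@le_lt_trans _ _ (\int[mu]_x \int[mu]_y (`|f x| * `|h y|)%:E)%E).
  apply: ge0_le_integral => //.
  - by move=> x _; exact: integral_ge0.
  - apply: (measurable_fun_fubini_tonelli_F (m2 := mu)
      (fun z : R * R => `|(G z)%:E|%E)) => //.
    exact: measurableT_comp.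
  - apply: (measurable_fun_fubini_tonelli_F (m2 := mu)
      (fun z : R * R => (`|f z.1| * `|h z.2|)%:E)); first exact/measurable_EFinP.
    by move=> z; rewrite lee_fin mulr_ge0.
  - move=> x _; apply: ge0_le_integral => //.
    + by apply: measurableT_comp => //; apply: measurableT_comp mEG _.
    + apply/measurable_EFinP/measurable_funM => //.
      by apply: measurableT_comp => //; exact: intg_meas.
    + move=> y _; rewrite lee_fin (le_trans (GM x y))//.
      by rewrite (le_trans (ler_norm _))// normrM.
have -> : (\int[mu]_x \int[mu]_y (`|f x| * `|h y|)%:E =
    \int[mu]_x (`|f x|%:E * (Int (fun y => `|h y|))%:E))%E.
  apply: eq_integral => x _; under eq_integral do rewrite EFinM.
  rewrite ge0_integralZl ?lee_fin//; first by rewrite -EFin_Int//; exact: intg_norm.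
  by apply/measurable_EFinP; exact: intg_meas (intg_norm Ih).
rewrite ge0_integralZr ?lee_fin ?Int_ge0//.
- by rewrite -EFin_Int ?ltry//; exact: intg_norm.
- by apply/measurable_EFinP; exact: intg_meas (intg_norm If).
Qed.

Lemma Fubini_sec1 x : intg (fun y => G (x, y)).
Proof.
apply: (@intg_le _ (fun y => f x * h y)) => //; last exact: intgZ.
exact: measurableT_comp.
Qed.

Lemma Fubini_sec2 y : intg (fun x => G (x, y)).
Proof.
apply: (@intg_le _ (fun x => h y * f x)) => //; last exact: intgZ.
  exact: measurableT_comp.
by move=> x; rewrite mulrC.
Qed.

Lemma Fubini_int1 : intg (fun x => Int (fun y => G (x, y))).
Proof.
have := integrable_fubini_F iG; rewrite /fubini_F.
apply: eq_integrable => // x _.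
by rewrite EFin_Int//; exact: Fubini_sec1.
Qed.

Lemma Fubini_Int_prod :
  (Int (fun x => Int (fun y => G (x, y))))%:E = (\int[mu]_y \int[mu]_x (G (x, y))%:E)%E.
Proof.
rewrite EFin_Int; last exact: Fubini_int1.
rewrite -(Fubini iG); apply: eq_integral => x _.
by rewrite EFin_Int//; exact: Fubini_sec1.
Qed.

End Fubini.

Lemma Fubini_int2 (G : R * R -> R) (f h : R -> R) : measurable_fun setT G ->
  intg f -> intg h -> (forall x y, `|G (x, y)| <= f x * h y) ->
  intg (fun y => Int (fun x => G (x, y))).
Proof.
move=> mG If Ih GM; apply: (@Fubini_int1 (fun z => G (z.2, z.1)) h f) => //.
- apply: (measurableT_comp mG); apply: measurable_fun_pair => //.
- by move=> x y; rewrite mulrC.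
Qed.

(** A majorant f(x) h(y) with both factors integrable makes G integrable on the plane, because the
    iterated integral of |f||h| factors. All later exchanges of integrals of signed functions are
    justified in this form. *)
Lemma Fubini_Int (G : R * R -> R) (f h : R -> R) : measurable_fun setT G ->
  intg f -> intg h -> (forall x y, `|G (x, y)| <= f x * h y) ->
  Int (fun x => Int (fun y => G (x, y))) = Int (fun y => Int (fun x => G (x, y))).
Proof.
move=> mG If Ih GM; apply: EFin_inj; rewrite (Fubini_Int_prod mG If Ih GM).
rewrite EFin_Int; last exact: Fubini_int2 GM.
apply: eq_integral => y _; rewrite EFin_Int//; exact: Fubini_sec2 GM _.
Qed.

End Integrals.

(** * The fundamental theorem of calculus on open and unbounded intervals *)

Section FTC.
Context {R : realType}.
Notation mu := (@lebesgue_measure R).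
Implicit Types f F : R -> R.

Lemma FTC_cc f F (a b : R) : a < b ->
  (forall x, a <= x <= b -> is_derive x 1 F (f x)) ->
  (forall x, a <= x <= b -> {for x, continuous f}) ->
  (\int[mu]_(x in `[a, b]) (f x)%:E = (F b - F a)%:E)%E.
Proof.
move=> ab dF cf.
have cF x : a <= x <= b -> {for x, continuous F}.
  by move=> xab; have := dF x xab => -[/derivable1_diffP/differentiable_continuous].
rewrite (@continuous_FTC2 R f F a b) ?EFinB//.
- by apply: continuous_in_subspaceT => x; rewrite inE/= in_itv/=; exact: cf.
- split.
  + move=> x; rewrite in_itv/= => /andP[/ltW ax /ltW xb].
    by have := dF x; rewrite ax xb => /(_ isT) [].
  + by apply: cvg_at_right_filter; apply: cF; rewrite lexx ltW.
  + by apply: cvg_at_left_filter; apply: cF; rewrite lexx ltW.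
- move=> x; rewrite in_itv/= => /andP[/ltW ax /ltW xb].
  have := dF x; rewrite ax xb => /(_ isT) d; rewrite derive1E; exact: derive_val.
Qed.

Section exhaustion.
Variables (f F : R -> R) (A : set R) (a b : nat -> R).
Hypothesis ab : forall n, a n < b n.
Hypothesis nda : forall n, a n.+1 <= a n.
Hypothesis ndb : forall n, b n <= b n.+1.
Hypothesis AE : forall x, A x <-> exists n, a n <= x <= b n.
Hypothesis dF : forall x, A x -> is_derive x 1 F (f x).
Hypothesis cf : forall x, A x -> {for x, continuous f}.

Let ndab : nondecreasing_seq (fun n => `[a n, b n]%classic).
Proof.
apply/nondecreasing_seqP => n; rewrite subsetEset => x /=; rewrite !in_itv/=.
by move=> /andP[/(le_trans (nda n)) -> /le_trans->].
Qed.

Let bigA : A = \bigcup_n `[a n, b n]%classic.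
Proof.
apply/seteqP; split => x; first by move=> /AE[n h]; exists n => //=; rewrite in_itv.
by move=> [n _ /=]; rewrite in_itv/= => h; apply/AE; exists n.
Qed.

Let subA n : `[a n, b n]%classic `<=` A.
Proof. by move=> x; rewrite /= in_itv/= => h; apply/AE; exists n. Qed.

Lemma exhaust_measurable : measurable A.
Proof. by rewrite bigA; exact: bigcup_measurable. Qed.

Lemma exhaust_measurable_fun : measurable_fun A f.
Proof.
rewrite bigA; apply/measurable_fun_bigcup => // n.
apply: subspace_continuous_measurable_fun => //.
apply: continuous_in_subspaceT => x; rewrite inE/= in_itv/= => h.
by apply: cf; apply/AE; exists n.
Qed.

Let FTCn n : (\int[mu]_(x in `[a n, b n]) (f x)%:E = (F (b n) - F (a n))%:E)%E.
Proof. by apply: FTC_cc => // x h; [apply: dF|apply: cf]; apply/AE; exists n. Qed.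

(** For nonnegative f a bound on the increments of the primitive is enough: the formula on each
    compact interval passes to A by monotone convergence, with no limit of F to compute. *)
Lemma exhaust_FTC_le (L : R) : (forall x, A x -> 0 <= f x) ->
  (forall n, F (b n) - F (a n) <= L) ->
  (\int[mu]_(x in A) (f x)%:E <= L%:E)%E.
Proof.
move=> f0 FL.
have mf n : measurable_fun `[a n, b n] (EFin \o f).
  apply/measurable_EFinP; apply: measurable_funS exhaust_measurable_fun.
    exact: exhaust_measurable.
  exact: subA.
have f0' n x : `[a n, b n]%classic x -> (0 <= (EFin \o f) x)%E.
  by move=> h; rewrite lee_fin f0//; exact: subA h.
have h := ge0_nondecreasing_set_cvg_integral (mu := mu) ndab
  (fun n => measurable_itv _) mf f0'.
rewrite -bigA in h; rewrite -(cvg_lim _ h)//.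
apply: lime_le; last by apply: nearW => n; rewrite FTCn lee_fin.
by apply/cvg_ex; exists (\int[mu]_(x in A) (f x)%:E)%E.
Qed.

(** Here f may change sign, so the passage to the limit is by dominated convergence with |f| as
    majorant. *)
Lemma exhaust_FTC (l : R) : mu.-integrable A (EFin \o f) ->
  F (b n) - F (a n) @[n --> \oo] --> l -> \int[mu]_(x in A) f x = l.
Proof.
move=> iA FL.
pose g n := (EFin \o f) \_ `[a n, b n]%classic.
have mA := exhaust_measurable.
have mg n : measurable_fun A (g n).
  apply: measurable_funTS; apply/(measurable_restrictT _ _).1 => //.
  apply/measurable_EFinP; exact: measurable_funS exhaust_measurable_fun.
have [] := @dominated_convergence _ _ _ mu A mA g (EFin \o f) (abse \o (EFin \o f)) mg.
- by apply/measurable_EFinP; exact: exhaust_measurable_fun.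
- apply: aeW => x Ax; have /AE[N hN] := Ax.
  apply: cvg_near_cst; exists N => // n /= Nn; rewrite /g patchE mem_set//=.
  by have := ndab Nn; rewrite subsetEset; apply; rewrite /= in_itv.
- exact: integrable_abse.
- apply: aeW => x n _; rewrite /g patchE; case: ifP => [_|_]; first exact: lexx.
  have -> : (point : \bar R) = 0%E by []. rewrite abse0; exact: abse_ge0.
- move=> _ _; rewrite /g.
  have -> : (fun n => \int[mu]_(x in A) ((EFin \o f) \_ `[a n, b n]) x)%E =
      (fun n => (F (b n) - F (a n))%:E).
    apply/funext => n; rewrite -FTCn -integral_mkcondr.
    congr (integral _ _ _); apply/setIidPr; exact: subA.
  move=> h; rewrite /Rintegral.
  have h' : (F (b n) - F (a n))%:E @[n --> \oo] --> l%:E by exact: cvg_EFin (nearW _ _) FL.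
  by rewrite -(cvg_unique _ h' h).
Qed.
End exhaustion.

Let archi (x y : R) : 0 < x -> exists n : nat, y / n.+1%:R < x.
Proof.
move=> x0; exists (Num.truncn (y / x)).
by rewrite ltr_pdivrMr// mulrC -ltr_pdivrMr// Num.Theory.truncnS_gt.
Qed.

Let archi_le (x y : R) (m n : nat) : 0 <= y -> (m <= n)%N -> y / m.+1%:R < x ->
  y / n.+1%:R <= x.
Proof.
move=> y0 mn /ltW; apply: le_trans; rewrite ler_wpM2l// lef_pV2 ?posrE//.
by rewrite ler_nat.
Qed.

Let archi_all (x : R) : 0 < x -> exists n : nat, forall m, (n <= m)%N -> m.+2%:R^-1 <= x.
Proof.
move=> x0; have [n h] := @archi x 1 x0; exists n => m nm.
by have := archi_le (n := m.+1) ler01 (leqW nm) h; rewrite div1r.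
Qed.

Let archi_nat (x : R) : exists n : nat, forall m, (n <= m)%N -> x <= m.+1%:R.
Proof.
exists (Num.truncn x) => m nm; apply/ltW/(lt_le_trans (Num.Theory.truncnS_gt x)).
by rewrite ler_nat ltnS.
Qed.

Let invS (n : nat) : n.+2%:R^-1 <= n.+1%:R^-1 :> R.
Proof. by rewrite lef_pV2 ?posrE// ler_nat. Qed.

Lemma FTC_le_oo f F (c d L : R) : c < d ->
  (forall x, c < x < d -> is_derive x 1 F (f x)) ->
  (forall x, c < x < d -> {for x, continuous f}) ->
  (forall x, c < x < d -> 0 <= f x) ->
  (forall x y, c < x -> x < y -> y < d -> F y - F x <= L) ->
  (\int[mu]_(x in `]c, d[) (f x)%:E <= L%:E)%E.
Proof.
move=> cd dF cf f0 FL; have dc0 : 0 < d - c by rewrite subr_gt0.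
have [e [e0 e2 eS eA]] : exists e : nat -> R, [/\ forall n, 0 < e n,
    forall n, e n * 2 < d - c, forall n, e n.+1 <= e n &
    forall x, 0 < x -> exists n, forall m, (n <= m)%N -> e m <= x].
  exists (fun n => (d - c) / n.+3%:R); split.
  - by move=> n; rewrite divr_gt0.
  - by move=> n; rewrite mulrAC ltr_pdivrMr// ltr_pM2l// ltr_nat.
  - by move=> n; rewrite ler_wpM2l ?(ltW dc0)// invS.
  - move=> x x0; have [m h] := @archi x (d - c) x0; exists m => n mn.
    by apply: (archi_le (ltW dc0) _ h); rewrite (leq_trans mn)// -addn2 leq_addr.
apply: (@exhaust_FTC_le f F _ (fun n => c + e n) (fun n => d - e n)).
- by move=> n; have := e2 n; lra.
- by move=> n; rewrite lerD2l.
- by move=> n; rewrite lerD2l lerN2.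
- move=> x; rewrite /= in_itv/=; split => [/andP[cx xd]|[n]]; last first.
    by have := e0 n; lra.
  have [|m1 h1] := eA (x - c); first by rewrite subr_gt0.
  have [|m2 h2] := eA (d - x); first by rewrite subr_gt0.
  exists (maxn m1 m2).
  have := h1 _ (leq_maxl m1 m2); have := h2 _ (leq_maxr m1 m2).
  by move: (e _) => y; lra.
- by move=> x; rewrite /= in_itv/=; exact: cf.
- by move=> x; rewrite /= in_itv/=; exact: f0.
- by move=> n; apply: FL; have := e0 n; have := e2 n; lra.
Qed.

Section oy.
Variables (f F : R -> R) (c : R).
Hypothesis dF : forall x, c < x -> is_derive x 1 F (f x).
Hypothesis cf : forall x, c < x -> {for x, continuous f}.
Let a n : R := c + n.+2%:R^-1.
Let b n : R := c + n.+1%:R.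

Let ab n : a n < b n.
Proof.
rewrite ltrD2l (@lt_le_trans _ _ 1) ?ler1n//.
by rewrite invf_lt1// ltr1n.
Qed.

Let ca n : c < a n.
Proof. by rewrite ltrDl. Qed.

Let AE x : `]c, +oo[%classic x <-> exists n, a n <= x <= b n.
Proof.
rewrite /= in_itv/= andbT; split => [cx|[n]]; last by have := ca n; lra.
have [|m1 h1] := @archi_all (x - c); first by rewrite subr_gt0.
have [m2 h2] := archi_nat (x - c).
exists (maxn m1 m2); rewrite /a /b.
have := h1 _ (leq_maxl m1 m2); have := h2 _ (leq_maxr m1 m2).
by move=> h3 h4; rewrite -lerBrDl h4/= -lerBlDl.
Qed.

Lemma FTC_le_oy (L : R) : (forall x, c < x -> 0 <= f x) ->
  (forall x y, c < x -> x < y -> F y - F x <= L) ->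
  (\int[mu]_(x in `]c, +oo[) (f x)%:E <= L%:E)%E.
Proof.
move=> f0 FL; apply: (@exhaust_FTC_le f F _ a b) => //.
- by move=> n; rewrite lerD2l.
- by move=> n; rewrite lerD2l ler_nat.
- by move=> x; rewrite /= in_itv/= andbT; exact: dF.
- by move=> x; rewrite /= in_itv/= andbT; exact: cf.
- by move=> x; rewrite /= in_itv/= andbT; exact: f0.
- by move=> n; exact: FL.
Qed.

Lemma FTC_oy (l0 l : R) : mu.-integrable `]c, +oo[ (EFin \o f) ->
  F x @[x --> c^'+] --> l0 -> F x @[x --> +oo] --> l ->
  \int[mu]_(x in `]c, +oo[) f x = l - l0.
Proof.
move=> iF Fl0 Fl; apply: (@exhaust_FTC f F _ a b) => //.
- by move=> n; rewrite lerD2l.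
- by move=> n; rewrite lerD2l ler_nat.
- by move=> x; rewrite /= in_itv/= andbT; exact: dF.
- by move=> x; rewrite /= in_itv/= andbT; exact: cf.
- apply: cvgB.
    apply: cvg_comp Fl; apply/cvgryPge => M.
    near=> n; rewrite /b -lerBlDl; apply: (@le_trans _ _ n%:R).
      by near: n; exact: nbhs_infty_ger.
    by rewrite ler_nat.
  have /cvg_at_rightP h := Fl0; apply: h; split => [n|]; first exact: ca.
  rewrite -[X in _ --> X]addr0; apply: cvgD; first exact: cvg_cst.
  by have := @cvg_harmonic R; rewrite -cvg_shiftS.
Unshelve. all: by end_near. Qed.
End oy.

Lemma FTC_le_Nyo f F (c L : R) :
  (forall x, x < c -> is_derive x 1 F (f x)) ->
  (forall x, x < c -> {for x, continuous f}) ->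
  (forall x, x < c -> 0 <= f x) ->
  (forall x y, x < y -> y < c -> F y - F x <= L) ->
  (\int[mu]_(x in `]-oo, c[) (f x)%:E <= L%:E)%E.
Proof.
move=> dF cf f0 FL.
pose a n : R := c - n.+1%:R; pose b n : R := c - n.+2%:R^-1.
have bc n : b n < c by rewrite gtrBl.
apply: (@exhaust_FTC_le f F _ a b) => //.
- move=> n; rewrite ltrD2l ltrN2 (@lt_le_trans _ _ 1) ?ler1n//.
  by rewrite invf_lt1// ltr1n.
- by move=> n; rewrite lerD2l lerN2 ler_nat.
- by move=> n; rewrite lerD2l lerN2.
- move=> x; rewrite /= in_itv/=; split => [cx|[n]]; last by have := bc n; lra.
  have [|m1 h1] := @archi_all (c - x); first by rewrite subr_gt0.
  have [m2 h2] := archi_nat (c - x).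
  exists (maxn m1 m2); rewrite /a /b.
  have := h1 _ (leq_maxl m1 m2); have := h2 _ (leq_maxr m1 m2).
  by move=> h3 h4; rewrite lerBlDr -lerBlDl h3/= lerBrDr -lerBrDl.
- move=> n; apply: FL => //.
  rewrite ltrD2l ltrN2 (@lt_le_trans _ _ 1) ?ler1n//.
  by rewrite invf_lt1// ltr1n.
Qed.

End FTC.

(** * Rules for derivatives at a point, and monotonicity from the sign of the derivative *)

Section PointwiseDerivatives.
Context {R : realType}.
Implicit Types (f g : R -> R) (x a b : R).

Lemma is_derive_ext f g x a b : is_derive x 1 f a -> f =1 g -> a = b ->
  is_derive x 1 g b.
Proof. by move=> df /funext <- <-. Qed.

Lemma derD f g x a b : is_derive x 1 f a -> is_derive x 1 g b ->
  is_derive x 1 (fun y => f y + g y) (a + b).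
Proof. by move=> df dg; exact: is_deriveD. Qed.

Lemma derN f x a : is_derive x 1 f a -> is_derive x 1 (fun y => - f y) (- a).
Proof. by move=> df; exact: is_deriveN. Qed.

Lemma derB f g x a b : is_derive x 1 f a -> is_derive x 1 g b ->
  is_derive x 1 (fun y => f y - g y) (a - b).
Proof. by move=> df dg; exact: is_deriveB. Qed.

Lemma derM f g x a b : is_derive x 1 f a -> is_derive x 1 g b ->
  is_derive x 1 (fun y => f y * g y) (a * g x + f x * b).
Proof.
move=> df dg; have := is_deriveM df dg; move/is_derive_ext; apply => //.
by rewrite /GRing.scale/= addrC (mulrC a).
Qed.

Lemma derZ (c : R) f x a : is_derive x 1 f a ->
  is_derive x 1 (fun y => c * f y) (c * a).
Proof. by move=> df; exact: is_deriveZ. Qed.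

Lemma derC (c : R) x : is_derive x 1 (fun=> c) 0.
Proof. exact: is_derive_cst. Qed.

Lemma derI x : is_derive x 1 (fun y : R => y) 1.
Proof. exact: is_derive_id. Qed.

Lemma dercomp f g x a b : is_derive (g x) 1 f a -> is_derive x 1 g b ->
  is_derive x 1 (fun y => f (g y)) (a * b).
Proof. by move=> df dg; exact: is_derive1_comp. Qed.

Lemma derX2 f x a : is_derive x 1 f a ->
  is_derive x 1 (fun y => f y ^+ 2) (2 * f x * a).
Proof.
move=> df; apply: (is_derive_ext (derM df df)) => [y|]; first by rewrite expr2.
ring.
Qed.

Lemma derexp f x a : is_derive x 1 f a ->
  is_derive x 1 (fun y => expR (f y)) (a * expR (f x)).
Proof. by move=> df; rewrite mulrC; apply: dercomp => //; exact: is_derive_expR. Qed.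

Lemma der_derivable f x a : is_derive x 1 f a -> derivable f x 1.
Proof. by case. Qed.

Lemma der_continuous f x a : is_derive x 1 f a -> {for x, continuous f}.
Proof. by case=> /derivable1_diffP/differentiable_continuous. Qed.

Lemma le_of_derive_ge0 f (f' : R -> R) (x y : R) : x <= y ->
  (forall z, x <= z <= y -> {for z, continuous f}) ->
  (forall z, x < z < y -> is_derive z 1 f (f' z)) ->
  (forall z, x < z < y -> 0 <= f' z) -> f x <= f y.
Proof.
move=> xy cf df f'0.
have := @ger0_derive1_le R f x y; apply => //.
- by move=> z; rewrite in_itv/= => h; apply: der_derivable (df z h).
- move=> z; rewrite in_itv/= => h; rewrite derive1E.
  by have := df z h => dz; rewrite (@derive_val _ _ _ _ _ _ _ dz) f'0.
- by apply: (@continuous_in_subspaceT _ _ `[x, y]%classic) => z; rewrite inE/= in_itv/=; exact: cf.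
- by rewrite in_itv/= lexx.
- by rewrite in_itv/= lexx xy.
Qed.

Lemma ge_of_derive_le0 f (f' : R -> R) (x y : R) : x <= y ->
  (forall z, x <= z <= y -> {for z, continuous f}) ->
  (forall z, x < z < y -> is_derive z 1 f (f' z)) ->
  (forall z, x < z < y -> f' z <= 0) -> f y <= f x.
Proof.
move=> xy cf df f'0; rewrite -lerN2.
apply: (@le_of_derive_ge0 (fun z => - f z) (fun z => - f' z)) => //.
- by move=> z h; apply: cvgN; exact: cf.
- by move=> z h; apply: derN; exact: df.
- by move=> z h; rewrite oppr_ge0 f'0.
Qed.

End PointwiseDerivatives.

(** * Power series dominated by the exponential series *)

Section EntireSeries.
Context {R : realType}.
Implicit Types c : nat -> R.

(** The bound 1/k! gives comparison with exp at every point and is inherited by the differentiated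
    series, so termwise differentiation can be iterated. *)
Definition entire c := forall k, `|c k| <= k`!%:R^-1.
Definition psum c (x : R) : R := limn (pseries c x).

Lemma entire_cvg c x : entire c -> cvgn (pseries c x).
Proof.
move=> ec; apply: normed_cvg.
apply: (@series_le_cvg _ _ (exp_coeff `|x|)) => //.
- by move=> n; exact: normr_ge0.
- by move=> n; rewrite /exp_coeff/= divr_ge0.
- move=> n; rewrite /exp_coeff/= normrM normrX mulrC.
  by rewrite ler_wpM2l ?exprn_ge0.
- exact: is_cvg_series_exp_coeff.
Qed.

Lemma entire_diffs c : entire c -> entire (pseries_diffs c).
Proof.
move=> ec k; rewrite /pseries_diffs normrM ger0_norm//.
have := ec k.+1; rewrite factS natrM invfM => h.
by rewrite mulrC -ler_pdivlMr ?ltr0n// mulrC.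
Qed.

Lemma derive_psum c (x : R) : entire c ->
  is_derive x 1 (psum c) (psum (pseries_diffs c) x).
Proof.
move=> ec; have e1 := entire_diffs ec; have e2 := entire_diffs e1.
apply: (@pseries_snd_diffs _ _ (`|x| + 1)); try exact: entire_cvg.
by rewrite [ltRHS]ger0_norm ?addr_ge0// ltrDl.
Qed.

Lemma psum0 c : psum c 0 = c 0.
Proof.
rewrite /psum; apply/cvg_lim => //.
rewrite -cvg_shiftS /=; apply: cvg_near_cst; apply: nearW => n.
rewrite /pseries /series/= big_nat_recl//= expr0 mulr1 big1 ?addr0// => i _.
by rewrite exprS mul0r mulr0.
Qed.

End EntireSeries.

(** * The normalised Bessel function, its equation and its energy bound *)

Section Bessel.
Context {R : realType}.
Variable a : R.
Hypothesis a0 : 0 <= a.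

(** Up to sign, the coefficients in z^2 of Gamma(nu+1) (2/z)^nu J_nu(z) with nu = (a-1)/2. They are
    given by their recurrence, so that the Gamma function enters only when [besselJ] is compared
    with [bj]. *)
Fixpoint dcoef k : R :=
  if k is k'.+1 then dcoef k' / ((2 * k'.+1%:R) * (2 * k'%:R + 1 + a)) else 1.

Definition jcoef k : R := (-1) ^+ k * dcoef k.

Let pos1 (k : nat) : 1 <= 2 * k%:R + 1 + a.
Proof. by rewrite -addrA addrCA lerDl addr_ge0// mulr_ge0. Qed.

Lemma dcoef_bnd k : 0 <= dcoef k <= k`!%:R^-1.
Proof.
elim: k => [|k /andP[d0 dk]] /=; first by rewrite fact0 invr1 ler01 lexx.
have h := pos1 k; have h0 : 0 < 2 * k%:R + 1 + a by rewrite (lt_le_trans _ h).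
rewrite divr_ge0 ?mulr_ge0 ?(ltW h0)//=.
rewrite factS natrM [leRHS]invfM [leLHS]mulrC ler_pM// ?invr_ge0 ?mulr_ge0 ?(ltW h0)//.
rewrite lef_pV2 ?posrE ?mulr_gt0 ?ltr0n//.
rewrite -[leLHS]mulr1 ler_pM//.
by rewrite ler_peMl// ler1n.
Qed.

Lemma jcoef_entire : entire jcoef.
Proof.
move=> k; rewrite /jcoef normrM normrX normrN1 expr1n mul1r.
by have /andP[d0 dk] := dcoef_bnd k; rewrite ger0_norm.
Qed.

Definition bj (z : R) : R := psum jcoef (z ^+ 2).
(** The quotient bj'(z)/z continued through z = 0; the singular term (a/z) bj' of Bessel's equation
    is written a [bq]. *)
Definition bq (z : R) : R := 2 * psum (pseries_diffs jcoef) (z ^+ 2).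
Definition bj1 (z : R) : R := z * bq z.

Let jcoefS k : jcoef k = - (2 * k.+1%:R) * (2 * k%:R + 1 + a) * jcoef k.+1.
Proof.
rewrite /jcoef /= exprS.
have h0 : 2 * k%:R + 1 + a != 0 by rewrite gt_eqF// (lt_le_trans _ (pos1 k)).
have : k.+1%:R != 0 :> R by rewrite pnatr_eq0.
move: (k.+1%:R) (2 * k%:R + 1 + a) h0 => u v v0 u0.
by field; rewrite u0 v0.
Qed.

(** Bessel's equation bj'' + (a/z) bj' + bj = 0 after the substitution w = z^2; coefficientwise it
    is the recurrence [jcoefS]. *)
Lemma bessel_series_ode w :
  4 * w * psum (pseries_diffs (pseries_diffs jcoef)) w
  + 2 * (1 + a) * psum (pseries_diffs jcoef) w + psum jcoef w = 0.
Proof.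
have e := jcoef_entire; have e1 := entire_diffs e; have e2 := entire_diffs e1.
have c0 := @entire_cvg _ _ w e; have c1 := @entire_cvg _ _ w e1; have c2 := @entire_cvg _ _ w e2.
set L := (X in X = 0).
suff : (fun=> 0 : R) n @[n --> \oo] --> L by move/(cvg_lim (@Rhausdorff R)) => <-; rewrite lim_cst.
(* The factor w raises the degree of the first sum by one, so the other two are cut one term later;
   the truncated combination then vanishes exactly for every n. *)
have h : (4 * w * pseries (pseries_diffs (pseries_diffs jcoef)) w n
   + 2 * (1 + a) * pseries (pseries_diffs jcoef) w n.+1
   + pseries jcoef w n.+1) @[n --> \oo] --> L.
  apply: cvgD; first apply: cvgD.
  - by apply: cvgM; [exact: cvg_cst|exact: c2].
  - by apply: cvgM; [exact: cvg_cst|rewrite (cvg_shiftS (pseries (pseries_diffs jcoef) w)); exact: c1].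
  - rewrite (cvg_shiftS (pseries jcoef w)); exact: c0.
apply: cvg_trans h; apply: near_eq_cvg; apply: nearW => n; symmetry.
rewrite /pseries /series/= /pseries_diffs; elim: n => [|n IH].
  rewrite big_geq// !big_nat1 !expr0 (jcoefS 0); ring.
rewrite big_nat_recr//=; set A := (X in _ * (X + _) + _ + _).
rewrite [X in _ + _ * X + _]big_nat_recr//=; set B := (X in _ + _ * (X + _) + _).
rewrite [X in _ + X]big_nat_recr//=; set C := (X in _ + (X + _)).
have {IH} -> : C = - (4 * w * A + 2 * (1 + a) * B).
  by apply/eqP; rewrite -addr_eq0 addrC; exact/eqP.
rewrite (jcoefS n.+1) exprS -!natr1; ring.
Qed.

Lemma derive_bj (z : R) : is_derive z 1 bj (bj1 z).
Proof.
have h := derive_psum (z ^+ 2) jcoef_entire.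
apply: (is_derive_ext (dercomp (g := fun y => y ^+ 2) h (derX2 (derI z)))) => //.
rewrite /bj1 /bq; ring.
Qed.

Lemma continuous_bq : continuous bq.
Proof.
move=> z; have h := derive_psum (z ^+ 2) (entire_diffs jcoef_entire).
exact: der_continuous (derZ 2 (dercomp (g := fun y => y ^+ 2) h (derX2 (derI z)))).
Qed.

Lemma derive_bj1 (z : R) : is_derive z 1 bj1 (- bj z - a * bq z).
Proof.
have h := derive_psum (z ^+ 2) (entire_diffs jcoef_entire).
apply: (is_derive_ext (derM (derI z) (derZ 2 (dercomp (g := fun y => y ^+ 2) h (derX2 (derI z)))))) => //.
have := bessel_series_ode (z ^+ 2); rewrite /bj /bq.
move: (psum _ _) (psum _ _) (psum _ _) => u v t /eqP; rewrite addr_eq0 => /eqP <-.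
by ring.
Qed.

Lemma continuous_bj : continuous bj.
Proof. by move=> z; exact: der_continuous (derive_bj z). Qed.

Lemma continuous_bj1 : continuous bj1.
Proof. by move=> z; exact: der_continuous (derive_bj1 z). Qed.

Lemma bj0 : bj 0 = 1.
Proof. by rewrite /bj expr0n/= psum0 /jcoef mul1r. Qed.

Lemma bj10 : bj1 0 = 0.
Proof. by rewrite /bj1 mul0r. Qed.

(** By Bessel's equation the derivative of bj^2 + bj'^2 is -2 a z bq^2, which is nonpositive for z
    >= 0, and the value at 0 is 1; the expression is even in z. *)
Lemma bessel_energy z : bj z ^+ 2 + bj1 z ^+ 2 <= 1.
Proof.
wlog z0 : z / 0 <= z.
  move=> H; have [|zn] := leP 0 z; first exact: H.
  have := H (- z); rewrite oppr_ge0 => /(_ (ltW zn)).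
  by rewrite /bj1 /bj /bq !sqrrN mulNr sqrrN.
have := @ge_of_derive_le0 R (fun z => bj z ^+ 2 + bj1 z ^+ 2)
  (fun z => - 2 * a * (z * bq z ^+ 2)) 0 z z0.
rewrite bj0 bj10 expr1n expr0n/= addr0; apply.
- by move=> t _; exact: der_continuous (derD (derX2 (derive_bj t)) (derX2 (derive_bj1 t))).
- move=> t _; apply: (is_derive_ext (derD (derX2 (derive_bj t)) (derX2 (derive_bj1 t)))) => //.
  rewrite /bj1; ring.
- move=> t /andP[t0 _]; rewrite !mulNr oppr_le0 mulr_ge0 ?(mulr_ge0 _ a0)//.
  by apply: mulr_ge0; [exact: ltW|exact: sqr_ge0].
Qed.

Lemma bj_le1 z : `|bj z| <= 1.
Proof. by rewrite ler_norml; have := bessel_energy z; have := sqr_ge0 (bj1 z); nra. Qed.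

Lemma bj1_le1 z : `|bj1 z| <= 1.
Proof. by rewrite ler_norml; have := bessel_energy z; have := sqr_ge0 (bj z); nra. Qed.

End Bessel.

(** * Closure rules for measurable functions, collected in a tactic *)

Section Measurability.
Context {R : realType} {d : measure_display} {T : measurableType d}.
Implicit Types f g : T -> R.
Notation meas := (measurable_fun [set: T]).

Lemma meas_cont (h : R -> R) f : continuous h -> meas f -> meas (fun x => h (f x)).
Proof. by move=> /continuous_measurable_fun mh mf; exact: measurableT_comp mh mf. Qed.

Lemma meas_exp f : meas f -> meas (fun x => expR (f x)).
Proof. exact/meas_cont/continuous_expR. Qed.

Lemma meas_cos f : meas f -> meas (fun x => cos (f x)).
Proof. exact/meas_cont/continuous_cos. Qed.

Lemma meas_sin f : meas f -> meas (fun x => sin (f x)).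
Proof. exact/meas_cont/continuous_sin. Qed.

Lemma meas_norm f : meas f -> meas (fun x => `|f x|).
Proof. by move=> mf; exact: measurableT_comp mf. Qed.

Lemma meas_X n f : meas f -> meas (fun x => f x ^+ n).
Proof. exact: measurable_funX. Qed.

Lemma meas_powR (b : R) f : meas f -> meas (fun x => f x `^ b).
Proof. by move=> mf; exact: measurableT_comp (measurable_powR b) mf. Qed.

Lemma meas_N f : meas f -> meas (fun x => - f x).
Proof. exact: measurable_funN. Qed.

Lemma meas_if (b : T -> bool) f g : measurable_fun setT b -> meas f -> meas g ->
  meas (fun x => if b x then f x else g x).
Proof. exact: measurable_fun_ifT. Qed.

Lemma meas_lt f g : meas f -> meas g -> measurable_fun setT (fun x => f x < g x).
Proof. exact: measurable_fun_ltr. Qed.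

Lemma meas_le f g : meas f -> meas g -> measurable_fun setT (fun x => f x <= g x).
Proof. exact: measurable_fun_ler. Qed.

Lemma meas_and (b c : T -> bool) : measurable_fun setT b -> measurable_fun setT c ->
  measurable_fun setT (fun x => b x && c x).
Proof. exact: measurable_and. Qed.

End Measurability.

Ltac meas := repeat first
  [ assumption | exact: measurable_cst | exact: measurable_id
  | exact: measurable_fst | exact: measurable_snd
  | apply: meas_exp | apply: meas_cos | apply: meas_sin | apply: meas_norm
  | apply: meas_powR | apply: meas_X | apply: meas_if | apply: meas_lt | apply: meas_le
  | apply: meas_and
  | apply: measurable_funM | apply: measurable_funB | apply: meas_N | apply: measurable_funD ].

(** * Integrals over the positive half-line, power weights and Gaussians *)

Section HalfLine.
Context {R : realType}.
Notation mu := (@lebesgue_measure R).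
Implicit Types f : R -> R.

Definition half f : R -> R := fun x => if 0 < x then f x else 0.

Lemma halfE f : half f = f \_ `]0, +oo[.
Proof.
apply/funext => x; rewrite patchE /half.
case: ifPn => x0; first by rewrite mem_set//= in_itv/= x0.
by rewrite memNset//= in_itv/= andbT; exact/negP.
Qed.

Lemma integral_half f :
  (\int[mu]_(x in `]0%R, +oo[) (f x)%:E = \int[mu]_x (half f x)%:E)%E.
Proof. by rewrite integral_mkcond halfE; apply: eq_integral => x _; rewrite restrict_EFin. Qed.

Lemma Rintegral_half f : \int[mu]_(x in `]0, +oo[) f x = Int (half f).
Proof. by rewrite /Rintegral integral_half. Qed.

Lemma meas_half f : measurable_fun (`]0%R, +oo[%classic : set R) f <-> measurable_fun setT (half f).
Proof. by rewrite halfE; apply: measurable_restrictT. Qed.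

Lemma intg_half f : intg (half f) <-> mu.-integrable `]0%R, +oo[%classic (EFin \o f).
Proof.
have := @integrable_mkcond _ _ R mu `]0%R, +oo[%classic (EFin \o f) (measurable_itv _).
by rewrite /intg halfE restrict_EFin => -[h1 h2]; split.
Qed.

Lemma half_cont_meas f : (forall x, 0 < x -> {for x, continuous f}) ->
  measurable_fun setT (half f).
Proof.
move=> cf; apply/meas_half; apply: open_continuous_measurable_fun => //.
by move=> x; rewrite inE/= in_itv/= andbT; exact: cf.
Qed.

Lemma intg_exp : intg (half (fun x : R => expR (- x))).
Proof.
have cf (x : R) : {for x, continuous (fun x : R => expR (- x))}.
  exact: der_continuous (derexp (derN (derI x))).
have [] // := @ge0_intgP R (half (fun x : R => expR (- x))) 1.
- exact: half_cont_meas.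
- by move=> x; rewrite /half; case: ifP; rewrite ?expR_ge0.
- rewrite -integral_half; apply: (@FTC_le_oy R _ (fun x => - expR (- x))) => //.
  + move=> x _; apply: (is_derive_ext (derN (derexp (derN (derI x))))) => //; ring.
  + move=> x y x0 xy; have := expR_gt0 (- y).
    have : expR (- x) <= 1 by rewrite -expR0 ler_expR; lra.
    by move: (expR _) (expR _) => u v; lra.
Qed.

Definition wt (b : R) : R -> R := half (fun x => x `^ b).

Lemma wt_ge0 b x : 0 <= wt b x.
Proof. by rewrite /wt /half; case: ifP => // _; exact: powR_ge0. Qed.

Lemma meas_wt b : measurable_fun setT (wt b).
Proof. by rewrite /wt /half; meas. Qed.

Lemma powR_le_exp (b x : R) : 0 <= b -> 0 < x -> x `^ b <= expR (b * x).
Proof.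
move=> b0 x0; rewrite /powR gt_eqF// ler_expR ler_wpM2l//.
exact/ltW/ln_sublinear.
Qed.

Definition gauss (eps x : R) : R := expR (- (eps * x ^+ 2)).

Lemma gauss_ge0 eps x : 0 <= gauss eps x.
Proof. exact: expR_ge0. Qed.

Lemma meas_gauss eps : measurable_fun setT (gauss eps).
Proof. by rewrite /gauss; meas. Qed.

(** Since x^b <= e^{b x}, the exponent is at most -eps x^2 + (b+1) x - x; completing the square
    bounds the first two terms by (b+1)^2/(4 eps). *)
Lemma gauss_wt_le (eps b x : R) : 0 < eps -> 0 <= b -> 0 < x ->
  gauss eps x * x `^ b <= expR ((b + 1) ^+ 2 / (4 * eps)) * expR (- x).
Proof.
move=> e0 b0 x0; rewrite (le_trans (ler_wpM2l (expR_ge0 _) (powR_le_exp b0 x0)))//.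
rewrite -!expRD ler_expR.
have : 0 <= (2 * eps * x - (b + 1)) ^+ 2 / (4 * eps).
  by rewrite divr_ge0 ?sqr_ge0// mulr_ge0// ltW.
have -> : (2 * eps * x - (b + 1)) ^+ 2 / (4 * eps) =
  eps * x ^+ 2 - (b + 1) * x + (b + 1) ^+ 2 / (4 * eps) by field; rewrite gt_eqF.
lra.
Qed.

Lemma intg_gauss_wt (eps b : R) : 0 < eps -> 0 <= b ->
  intg (fun x => gauss eps x * wt b x).
Proof.
move=> e0 b0.
apply: (@intg_le _ _ (fun x => expR ((b + 1) ^+ 2 / (4 * eps)) * half (fun x => expR (- x)) x)).
- by apply: measurable_funM; [exact: meas_gauss|exact: meas_wt].
- move=> x; rewrite ger0_norm ?mulr_ge0 ?gauss_ge0 ?wt_ge0//.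
  rewrite /wt /half; case: ifP => [x0|_]; last by rewrite !mulr0.
  exact: gauss_wt_le.
- exact/intgZ/intg_exp.
Qed.

Lemma wtD1 (b x : R) : x * wt b x = wt (b + 1) x.
Proof.
rewrite /wt /half; case: ifP => x0; last by rewrite mulr0.
have -> : x `^ (b + 1) = x `^ b * x `^ 1 by rewrite powRD// (gt_eqF x0) implybT.
by rewrite powRr1 ?(ltW x0)// mulrC.
Qed.

End HalfLine.

Lemma squeeze_norm0 {R : realType} (F : set_system R) {FF : Filter F} (f g : R -> R) :
  (\forall x \near F, `|f x| <= g x) -> g x @[x --> F] --> 0 -> f x @[x --> F] --> 0.
Proof.
move=> fg g0; apply: (squeeze_cvgr (f := fun x => - g x) (h := g)) => //.
  by apply: filterS fg => x; rewrite ler_norml.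
by rewrite -oppr0; exact: cvgN.
Qed.

(** * Weighted Gaussian oscillatory integrals and integration by parts *)

Section GaussianIntegrals.
Context {R : realType}.
Notation mu := (@lebesgue_measure R).
Variable a : R.
Hypothesis a0 : 0 <= a.
Implicit Types (T f : R -> R) (eps s : R).

(** For T = cos and T = sin these are the real and imaginary parts of the half-line integral of
    e^{-(eps - i s) x^2} f(x) x^a. *)
Definition gint T eps s f : R :=
  Int (fun x => gauss eps x * T (s * x ^+ 2) * f x * wt a x).

Lemma intg_gauss_lin eps (A B : R) : 0 < eps ->
  intg (fun x => (A + B * x ^+ 2) * (gauss eps x * wt a x)).
Proof.
move=> e0; have h1 := intgZ A (intg_gauss_wt e0 a0).
have h2 := intgZ B (intg_gauss_wt e0 (addr_ge0 (addr_ge0 a0 ler01) ler01)).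
apply: eq_intg (intgD h1 h2) => x /=; rewrite -!wtD1; ring.
Qed.

Lemma intg_gint T eps s f (A : R) : 0 < eps -> measurable_fun setT T ->
  (forall u, `|T u| <= 1) -> measurable_fun setT f ->
  (forall x : R, 0 < x -> `|f x| <= A * (1 + x ^+ 2)) ->
  intg (fun x => gauss eps x * T (s * x ^+ 2) * f x * wt a x).
Proof.
move=> e0 mT T1 mf fA.
apply: intg_le (intg_gauss_lin A A e0) => [|x].
  have mTs : measurable_fun setT (fun x : R => T (s * x ^+ 2)).
    apply: (measurableT_comp mT); meas.
  have := @meas_gauss R eps; have := @meas_wt R a; move=> ? ?; meas.
rewrite /wt /half; case: ifP => x0; last by rewrite !mulr0 normr0.
rewrite !normrM (ger0_norm (gauss_ge0 eps x)) (ger0_norm (powR_ge0 x a)).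
rewrite mulrA; apply: ler_wpM2r; first exact: powR_ge0.
rewrite [leRHS]mulrC -mulrA; apply: ler_wpM2l; first exact: gauss_ge0.
rewrite -[leRHS]mul1r; apply: ler_pM => //.
by rewrite (le_trans (fA x x0))// mulrDr mulr1.
Qed.

Section by_parts.
Variables (T T1 : R -> R) (eps s A : R) (phi phi1 psi : R -> R).
Hypotheses (dT : forall u : R, is_derive u 1 T (T1 u)) (cT1 : continuous T1).
Hypotheses (Tle : forall u, `|T u| <= 1) (T1le : forall u, `|T1 u| <= 1).
Hypothesis e0 : 0 < eps.
Hypothesis dphi : forall x : R, 0 < x -> is_derive x 1 phi (phi1 x).
Hypothesis cphi1 : forall x : R, 0 < x -> {for x, continuous phi1}.
Hypothesis psiE : forall x : R, 0 < x -> psi x = phi1 x + a * phi x / x.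
Hypotheses (mphi : measurable_fun setT phi) (mpsi : measurable_fun setT psi).
Hypothesis phiA : forall x : R, 0 < x -> `|phi x| <= A * (1 + x).
Hypothesis psiA : forall x : R, 0 < x -> `|psi x| <= A * (1 + x).
Hypothesis phi0 : phi x @[x --> 0^'+] --> 0.

Let cT u : {for u, continuous T}. Proof. exact: der_continuous (dT u). Qed.

Let A0 : 0 <= A.
Proof.
have := psiA ltr01; move/(le_trans (normr_ge0 _)).
by rewrite pmulr_lge0// ltr0n.
Qed.

Let lin_le (x : R) : 0 < x -> A * (1 + x) <= (2 * A) * (1 + x ^+ 2).
Proof.
move=> x0; rewrite -mulrA mulrCA ler_wpM2l//; have := sqr_ge0 (1 - x); nra.
Qed.

Let F (x : R) := gauss eps x * T (s * x ^+ 2) * phi x * x `^ a.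
Let F1 (x : R) := gauss eps x * T (s * x ^+ 2) * psi x * x `^ a
  - (2 * eps) * (gauss eps x * T (s * x ^+ 2) * (x * phi x) * x `^ a)
  + (2 * s) * (gauss eps x * T1 (s * x ^+ 2) * (x * phi x) * x `^ a).

Let dF (x : R) : 0 < x -> is_derive x 1 F (F1 x).
Proof.
move=> x0; have dg : is_derive x 1 (gauss eps) (- (2 * eps * x) * gauss eps x).
  apply: (is_derive_ext (derexp (derN (derZ eps (derX2 (derI x)))))) => //.
  by rewrite /gauss; ring.
have ds : is_derive x 1 (fun x => s * x ^+ 2) (2 * s * x).
  by apply: (is_derive_ext (derZ s (derX2 (derI x)))) => //; ring.
have dTs := dercomp (g := fun x => s * x ^+ 2) (dT _) ds.
have dp := is_derive1_powR a x0.
apply: (is_derive_ext (derM (derM (derM dg dTs) (dphi x0)) dp)) => //.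
have -> : x `^ (a - 1) = x `^ a / x.
  rewrite powRD; last by rewrite (gt_eqF x0) implybT.
  by rewrite powR_inv1// ltW.
rewrite /F1 psiE//; move: (T _) (T1 _) (x `^ a) => u v t.
by field; rewrite gt_eqF.
Qed.

Let cF1 (x : R) : 0 < x -> {for x, continuous F1}.
Proof.
move=> x0.
have cg : {for x, continuous (gauss eps)}.
  by apply: der_continuous (derexp (derN (derZ eps (derX2 (derI x))))).
have cs : {for x, continuous (fun x : R => s * x ^+ 2)}.
  exact: der_continuous (derZ s (derX2 (derI x))).
have cTs : {for x, continuous (fun x : R => T (s * x ^+ 2))}.
  by apply: (continuous_comp cs); exact: cT.
have cT1s : {for x, continuous (fun x : R => T1 (s * x ^+ 2))}.
  by apply: (continuous_comp cs); exact: cT1.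
have cp : {for x, continuous (fun x : R => x `^ a)}.
  exact: der_continuous (is_derive1_powR a x0).
have cphi := der_continuous (dphi x0).
have ci : {for x, continuous (fun x : R => x)} by exact: der_continuous (derI x).
have cpsi : {for x, continuous psi}.
  have h : {for x, continuous (fun x : R => phi1 x + a * phi x / x)}.
    apply: cvgD; first exact: cphi1.
    apply: cvgM; first by apply: cvgM; [exact: cvg_cst|exact: cphi].
    by apply: cvgV; [rewrite gt_eqF|exact: ci].
  rewrite /prop_for /continuous_at psiE//; apply: cvg_trans h; apply: near_eq_cvg.
  near=> y; rewrite psiE//; near: y; exact: lt_nbhsr.
apply: cvgD; first apply: cvgB.
- by apply: cvgM => //; apply: cvgM => //; exact: cvgM.
- apply: cvgM; first exact: cvg_cst.
  by apply: cvgM => //; apply: cvgM => //; [exact: cvgM|exact: cvgM].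
- apply: cvgM; first exact: cvg_cst.
  by apply: cvgM => //; apply: cvgM => //; [exact: cvgM|exact: cvgM].
Unshelve. all: by end_near. Qed.

Let F_le (x : R) : 0 < x -> `|F x| <= `|phi x| * (gauss eps x * x `^ a).
Proof.
move=> x0; rewrite /F !normrM (ger0_norm (gauss_ge0 eps x)) (ger0_norm (powR_ge0 x a)).
rewrite [leLHS](_ : _ = `|phi x| * (gauss eps x * x `^ a) * `|T (s * x ^+ 2)|); last by ring.
by rewrite ler_piMr ?mulr_ge0 ?gauss_ge0 ?powR_ge0.
Qed.

Let F0 : F x @[x --> 0^'+] --> 0.
Proof.
apply: (@squeeze_norm0 _ _ _ _ (fun x => `|phi x|)).
- near=> x; have x0 : 0 < x by near: x; exact: nbhs_right_gt.
  have x1 : x <= 1 by near: x; exact: nbhs_right_le.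
  rewrite (le_trans (F_le x0))// ler_piMr//.
  rewrite mulr_ile1 ?gauss_ge0 ?powR_ge0//.
  + rewrite /gauss -expR0 ler_expR oppr_le0 mulr_ge0 ?sqr_ge0//; exact: ltW.
  + have : x `^ a <= 1 `^ a by rewrite ge0_ler_powR ?nnegrE// ltW.
    by rewrite powR1.
- have : `|phi x| @[x --> 0^'+] --> `|0 : R| by exact: cvg_norm.
  by rewrite normr0.
Unshelve. all: by end_near. Qed.

Let Fy : F x @[x --> +oo] --> 0.
Proof.
pose C := A * (expR ((a + 1) ^+ 2 / (4 * eps)) + expR ((a + 1 + 1) ^+ 2 / (4 * eps))).
apply: (@squeeze_norm0 _ _ _ _ (fun x => C * expR (- x))).
- near=> x; have x0 : 0 < x by near: x; exact: nbhs_pinfty_gt.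
  rewrite (le_trans (F_le x0))//.
  apply: (@le_trans _ _ (A * (gauss eps x * x `^ a + gauss eps x * x `^ (a + 1)))).
    have -> : x `^ (a + 1) = x `^ a * x.
      by rewrite powRD ?(gt_eqF x0) ?implybT// powRr1 ?(ltW x0).
    have -> : A * (gauss eps x * x `^ a + gauss eps x * (x `^ a * x)) =
      A * (1 + x) * (gauss eps x * x `^ a) by ring.
    by rewrite ler_wpM2r ?mulr_ge0 ?gauss_ge0 ?powR_ge0// phiA.
  rewrite /C -mulrA ler_wpM2l// mulrDl lerD ?gauss_wt_le//.
  by rewrite addr_ge0.
- by rewrite -[X in _ --> X](mulr0 C); apply: cvgM; [exact: cvg_cst|exact: cvgr_expR].
Unshelve. all: by end_near. Qed.

(** The derivative of e^{-eps x^2} T(s x^2) phi(x) x^a integrates to zero: [phi0] handles the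
    endpoint 0 and the Gaussian handles infinity. The function psi = phi' + a phi/x, that is x^{-a}
    (x^a phi)', is kept separate so that a regular expression can be supplied for the singular
    quotient. *)
Lemma gint_by_parts :
  gint T eps s psi = 2 * eps * gint T eps s (fun x => x * phi x)
    - 2 * s * gint T1 eps s (fun x => x * phi x).
Proof.
have mT := continuous_measurable_fun (fun u => @cT u).
have mT1 := continuous_measurable_fun cT1.
have xphiA (x : R) : 0 < x -> `|x * phi x| <= (2 * A) * (1 + x ^+ 2).
  move=> x0; rewrite normrM (gtr0_norm x0).
  rewrite (le_trans (ler_wpM2l (ltW x0) (phiA x0)))//.
  rewrite mulrCA -mulrA (mulrCA 2) ler_wpM2l//; have := sqr_ge0 (1 - x); nra.
have mxphi : measurable_fun setT (fun x : R => x * phi x) by meas.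
have psiA' (x : R) : 0 < x -> `|psi x| <= (2 * A) * (1 + x ^+ 2).
  by move=> x0; rewrite (le_trans (psiA x0))// lin_le.
have i1 := intg_gint s e0 mT Tle mpsi psiA'.
have i2 := intg_gint s e0 mT Tle mxphi xphiA.
have i3 := intg_gint s e0 mT1 T1le mxphi xphiA.
have F1E : half F1 =1 (fun x => gauss eps x * T (s * x ^+ 2) * psi x * wt a x
  - (2 * eps) * (gauss eps x * T (s * x ^+ 2) * (x * phi x) * wt a x)
  + (2 * s) * (gauss eps x * T1 (s * x ^+ 2) * (x * phi x) * wt a x)).
  by move=> x; rewrite /half /wt /half; case: ifP => // _; rewrite !mulr0 subr0 addr0.
have iF : intg (half F1).
  apply: (eq_intg (fun x => esym (F1E x))).
  by apply: intgD; [apply: intgB => //; exact: intgZ|exact: intgZ].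
have := FTC_oy dF cF1 ((intg_half F1).1 iF) F0 Fy.
rewrite subr0 Rintegral_half (eq_Int F1E) IntD ?IntB ?IntZ//.
- by rewrite /gint => h; lra.
- exact: intgZ.
- by apply: intgB => //; exact: intgZ.
- exact: intgZ.
Qed.

End by_parts.
End GaussianIntegrals.

(** * Differentiation and continuity under the integral sign *)

Section ParametricIntegrals.
Context {R : realType}.
Notation mu := (@lebesgue_measure R).

Lemma derive_Int (f f1 : R -> R -> R) (G : R -> R) (u v l0 : R) : u < l0 < v ->
  (forall l, u < l < v -> intg (f l)) -> intg G ->
  (forall l x : R, u < l < v -> is_derive l 1 (fun l => f l x) (f1 l x)) ->
  (forall l x, u < l < v -> `|f1 l x| <= G x) ->
  is_derive l0 1 (fun l => Int (f l)) (Int (f1 l0)).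
Proof.
move=> l0uv If IG df f1G.
have I0 : `]u, v[%classic l0 by rewrite /= in_itv.
have If' l : `]u, v[%classic l -> mu.-integrable setT (EFin \o f l).
  by rewrite /= in_itv; exact: If.
have df' l x : `]u, v[%classic l -> setT x -> derivable (f ^~ x) l 1.
  by rewrite /= in_itv => h _; apply: der_derivable (df l x h).
have f1E l x : u < l < v -> partial1of2 f l x = f1 l x.
  move=> h; rewrite partial1of2E; have := df l x h => d; exact: derive_val.
have G0 x : 0 <= G x by rewrite (le_trans _ (f1G l0 x l0uv)).
have Gub l x : `]u, v[%classic l -> setT x -> `|partial1of2 f l x| <= G x.
  by rewrite /= in_itv => h _; rewrite f1E//; exact: f1G.
apply: DeriveDef.
  exact: (derivable_under_integral (mu := mu) measurableT I0 If' df' G0 IG Gub).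
rewrite -derive1E.
rewrite (differentiation_under_integral (mu := mu) measurableT I0 If' df' G0 IG Gub).
by apply: eq_Int => x; rewrite f1E.
Qed.

Lemma continuous_Int (f : R -> R -> R) (G : R -> R) (u v l0 : R) : u < l0 < v ->
  (forall l, u < l < v -> intg (f l)) -> intg G ->
  (forall x, continuous (fun l => f l x)) ->
  (forall l x, u < l < v -> `|f l x| <= G x) ->
  {for l0, continuous (fun l => Int (f l))}.
Proof.
move=> l0uv If IG cf fG.
have If' l : `]u, v[%classic l -> mu.-integrable setT (EFin \o f l).
  by rewrite /= in_itv; exact: If.
apply: (continuity_under_integral (mu := mu) measurableT If' _ IG).
- by apply: aeW => x _ l _; exact: cf.
- by move=> l; rewrite /= in_itv => h; apply: aeW => x _; exact: fG.
- by rewrite inE/= in_itv.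
Qed.

End ParametricIntegrals.

(** * Linearity, differentiability and continuity of the Gaussian integrals in a parameter *)

Section Kernel.
Context {R : realType}.
Variable a : R.
Hypothesis a0 : 0 <= a.
Local Notation gint := (gint a).

Lemma cos_abs (u : R) : `|cos u| <= 1. Proof. exact: cos_max. Qed.
Lemma sin_abs (u : R) : `|sin u| <= 1. Proof. exact: sin_max. Qed.

Section trig.
Variables (eps s : R).
Hypothesis e0 : 0 < eps.

Definition trig (T : R -> R) := measurable_fun setT T /\ forall u, `|T u| <= 1.

Lemma trig_cos : trig cos.
Proof. by split; [apply: continuous_measurable_fun; exact: continuous_cos|exact: cos_abs]. Qed.

Lemma trig_sin : trig sin.
Proof. by split; [apply: continuous_measurable_fun; exact: continuous_sin|exact: sin_abs]. Qed.

Lemma gintD T (f g : R -> R) (A B : R) : trig T -> measurable_fun setT f -> measurable_fun setT g ->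
  (forall x : R, 0 < x -> `|f x| <= A * (1 + x ^+ 2)) ->
  (forall x : R, 0 < x -> `|g x| <= B * (1 + x ^+ 2)) ->
  gint T eps s (fun x => f x + g x) = gint T eps s f + gint T eps s g.
Proof.
move=> [mT T1] mf mg fA gA; rewrite /gint -IntD//.
- by apply: eq_Int => x; ring.
- exact: (intg_gint a0 s e0 mT T1 mf fA).
- exact: (intg_gint a0 s e0 mT T1 mg gA).
Qed.

Lemma gintZ T (f : R -> R) (A c : R) : trig T -> measurable_fun setT f ->
  (forall x : R, 0 < x -> `|f x| <= A * (1 + x ^+ 2)) ->
  gint T eps s (fun x => c * f x) = c * gint T eps s f.
Proof.
move=> [mT T1] mf fA; rewrite /gint -IntZ//.
- by apply: eq_Int => x; ring.
- exact: (intg_gint a0 s e0 mT T1 mf fA).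
Qed.

Lemma gintN T (f : R -> R) (A : R) : trig T -> measurable_fun setT f ->
  (forall x : R, 0 < x -> `|f x| <= A * (1 + x ^+ 2)) ->
  gint (fun u => - T u) eps s f = - gint T eps s f.
Proof.
move=> [mT T1] mf fA; rewrite /gint -IntN//.
- by apply: eq_Int => x; ring.
- exact: (intg_gint a0 s e0 mT T1 mf fA).
Qed.

Lemma eq_gint T (f g : R -> R) : (forall x : R, 0 < x -> f x = g x) ->
  gint T eps s f = gint T eps s g.
Proof.
move=> fg; apply: eq_Int => x; rewrite /wt /half; case: ifP => x0; last by rewrite !mulr0.
by rewrite fg.
Qed.

Lemma derive_gint T (f f1 : R -> R -> R) (A u v l0 : R) : trig T -> u < l0 < v ->
  (forall l, measurable_fun setT (f l)) ->
  (forall l x, u < l < v -> 0 < x -> `|f l x| <= A * (1 + x ^+ 2)) ->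
  (forall l x, u < l < v -> 0 < x -> `|f1 l x| <= A * (1 + x ^+ 2)) ->
  (forall l x : R, u < l < v -> 0 < x -> is_derive l 1 (fun l => f l x) (f1 l x)) ->
  is_derive l0 1 (fun l => gint T eps s (f l)) (gint T eps s (f1 l0)).
Proof.
move=> [mT T1] h mf fA f1A df.
apply: (@derive_Int _ (fun l x => gauss eps x * T (s * x ^+ 2) * f l x * wt a x)
  (fun l x => gauss eps x * T (s * x ^+ 2) * f1 l x * wt a x)
  (fun x => (A + A * x ^+ 2) * (gauss eps x * wt a x)) u v).
- exact: h.
- by move=> l hl; apply: (intg_gint a0 s e0 mT T1 (mf l)) => x x0; exact: fA.
- exact: intg_gauss_lin.
- move=> l x hl; rewrite /wt /half; case: ifP => x0; last first.
    by rewrite mulr0; apply: (is_derive_ext (derC 0 l)) => // z; rewrite mulr0.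
  apply: (is_derive_ext (derM (derZ (gauss eps x * T (s * x ^+ 2)) (df l x hl x0))
    (derC (x `^ a) l))) => //; ring.
- move=> l x hl; rewrite /wt /half; case: ifP => x0; last by rewrite !mulr0 normr0.
  rewrite !normrM (ger0_norm (gauss_ge0 eps x)) (ger0_norm (powR_ge0 x a)).
  rewrite mulrA; apply: ler_wpM2r; first exact: powR_ge0.
  rewrite [leRHS]mulrC -mulrA; apply: ler_wpM2l; first exact: gauss_ge0.
  rewrite -[leRHS]mul1r; apply: ler_pM => //.
  by rewrite (le_trans (f1A l x hl x0))// mulrDr mulr1.
Qed.

Lemma continuous_gint T (f : R -> R -> R) (A l0 : R) : trig T ->
  (forall l, measurable_fun setT (f l)) ->
  (forall l x, 0 < x -> `|f l x| <= A * (1 + x ^+ 2)) ->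
  (forall x, continuous (fun l => f l x)) ->
  {for l0, continuous (fun l => gint T eps s (f l))}.
Proof.
move=> [mT T1] mf fA cf.
apply: (@continuous_Int _ (fun l x => gauss eps x * T (s * x ^+ 2) * f l x * wt a x)
  (fun x => (A + A * x ^+ 2) * (gauss eps x * wt a x)) (l0 - 1) (l0 + 1)).
- by rewrite gtrBl ltrDl ltr01.
- by move=> l hl; apply: (intg_gint a0 s e0 mT T1 (mf l)) => x x0; exact: fA.
- exact: intg_gauss_lin.
- move=> x l; apply: cvgM; last exact: cvg_cst.
  by apply: cvgM; [exact: cvg_cst|exact: cf].
- move=> l x hl; rewrite /wt /half; case: ifP => x0; last by rewrite !mulr0 normr0.
  rewrite !normrM (ger0_norm (gauss_ge0 eps x)) (ger0_norm (powR_ge0 x a)).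
  rewrite mulrA; apply: ler_wpM2r; first exact: powR_ge0.
  rewrite [leRHS]mulrC -mulrA; apply: ler_wpM2l; first exact: gauss_ge0.
  rewrite -[leRHS]mul1r; apply: ler_pM => //.
  by rewrite (le_trans (fA l x x0))// mulrDr mulr1.
Qed.

End trig.
End Kernel.

(** * The propagator kernel: a differential system along rays, its energy and its positivity *)

Section KernelBounds.
Context {R : realType}.
Variable a : R.
Hypothesis a0 : 0 <= a.
Local Notation gint := (gint a).
Local Notation j := (bj a).
Local Notation j1 := (bj1 a).
Local Notation q := (bq a).

Lemma meas_bj (c : R) : measurable_fun setT (fun x : R => j (c * x)).
Proof. by apply: meas_cont; [exact: continuous_bj|meas]. Qed.

Lemma meas_bj1 (c : R) : measurable_fun setT (fun x : R => j1 (c * x)).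
Proof. by apply: meas_cont; [exact: continuous_bj1|meas]. Qed.

Let cmul (c : R) : continuous (fun x : R => c * x).
Proof. by move=> x; exact: der_continuous (derZ c (derI x)). Qed.

Let cj (c : R) : continuous (fun x : R => j (c * x)).
Proof.
move=> x; apply: (@continuous_comp _ _ _ (fun x : R => c * x) (bj a)); first exact: cmul.
exact: continuous_bj.
Qed.

Let cj1 (c : R) : continuous (fun x : R => j1 (c * x)).
Proof.
move=> x; apply: (@continuous_comp _ _ _ (fun x : R => c * x) (bj1 a)); first exact: cmul.
exact: continuous_bj1.
Qed.

Let cq (c : R) : continuous (fun x : R => q (c * x)).
Proof.
move=> x; apply: (@continuous_comp _ _ _ (fun x : R => c * x) (bq a)); first exact: cmul.
exact: continuous_bq.
Qed.

Let dj (c x : R) : is_derive x 1 (fun x : R => j (c * x)) (c * j1 (c * x)).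
Proof.
rewrite mulrC; apply: dercomp; first exact: derive_bj.
by apply: (is_derive_ext (derZ c (derI x))) => //; rewrite mulr1.
Qed.

Let dj1 (c x : R) : is_derive x 1 (fun x : R => j1 (c * x)) (c * (- j (c * x) - a * q (c * x))).
Proof.
rewrite mulrC; apply: dercomp; first exact: derive_bj1.
by apply: (is_derive_ext (derZ c (derI x))) => //; rewrite mulr1.
Qed.

Section mixed.
Variables (X Y : R).
Let phi x := j1 (X * x) * j (Y * x).
Let psi x := - X * (j (X * x) * j (Y * x)) + Y * (j1 (X * x) * j1 (Y * x)).

Let le1 (u v : R) : `|u| <= 1 -> `|v| <= 1 -> `|u * v| <= 1.
Proof. by move=> *; rewrite normrM mulr_ile1. Qed.

Let le1x (u A x : R) : 0 < x -> 1 <= A -> `|u| <= 1 -> `|u| <= A * (1 + x).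
Proof. by move=> x0 A1 u1; rewrite (le_trans u1)//; nra. Qed.

Let psi_le x : `|psi x| <= `|X| + `|Y|.
Proof.
rewrite (le_trans (ler_normD _ _))// lerD// normrM ?normrN ler_piMr// le1 ?bj_le1 ?bj1_le1//.
Qed.

(** Integration by parts with phi(x) = j1(Xx) j(Yx). In phi' + a phi/x the terms with a cancel by
    Bessel's equation, leaving only the products j j and j1 j1. *)
Lemma by_parts_mixed (T T1 : R -> R) (eps s : R) :
  (forall u : R, is_derive u 1 T (T1 u)) -> continuous T1 ->
  (forall u, `|T u| <= 1) -> (forall u, `|T1 u| <= 1) -> 0 < eps ->
  gint T eps s psi = 2 * eps * gint T eps s (fun x => x * phi x)
    - 2 * s * gint T1 eps s (fun x => x * phi x).
Proof.
move=> dT cT1 Tle T1le e0.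
apply: (@gint_by_parts _ a a0 T T1 eps s (1 + `|X| + `|Y|) phi (fun x =>
  (X * (- j (X * x) - a * q (X * x))) * j (Y * x) + j1 (X * x) * (Y * j1 (Y * x)))) => //.
- by move=> x _; apply: derM; [exact: dj1|exact: dj].
- move=> x _; apply: cvgD; apply: cvgM.
  + apply: cvgM; first exact: cvg_cst.
    apply: cvgB; first by apply: cvgN; exact: cj.
    by apply: cvgM; [exact: cvg_cst|exact: cq].
  + exact: cj.
  + exact: cj1.
  + by apply: cvgM; [exact: cvg_cst|exact: cj1].
- by move=> x x0; rewrite /psi /phi /bj1; field; rewrite gt_eqF.
- by apply: measurable_funM; [exact: meas_bj1|exact: meas_bj].
- have := meas_bj X; have := meas_bj Y; have := meas_bj1 X; have := meas_bj1 Y.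
  by move=> *; rewrite /psi; meas.
- move=> x x0; apply: le1x => //; last by rewrite /phi le1 ?bj_le1 ?bj1_le1.
  by rewrite -addrA lerDl addr_ge0.
- move=> x x0; rewrite (le_trans (psi_le x))//.
  have := normr_ge0 X; have := normr_ge0 Y; move: `|X| `|Y| => u v; nra.
- apply: cvg_at_right_filter.
  have : phi x @[x --> (0 : R)] --> phi 0 by exact: (cvgM (@cj1 X 0) (@cj Y 0)).
  have -> : phi 0 = 0 by rewrite /phi mulr0 bj10 mul0r.
  exact.
Qed.

End mixed.

Section kernel.
Variables (eps s : R).
Hypothesis e0 : 0 < eps.

(** The kernel of the regularised propagator. Together with [kM], where both factors are
    differentiated, it forms a closed linear system; the mixed integral [kPhi] is the intermediate
    quantity to be eliminated. *)
Definition kK T (X Y : R) := gint T eps s (fun x => j (X * x) * j (Y * x)).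
Definition kM T (X Y : R) := gint T eps s (fun x => j1 (X * x) * j1 (Y * x)).
Definition kPhi T (X Y : R) := gint T eps s (fun x => x * (j1 (X * x) * j (Y * x))).

Lemma mul_le1 (u v x : R) : `|u| <= 1 -> `|v| <= 1 -> `|u * v| <= 1 * (1 + x ^+ 2).
Proof.
move=> u1 v1; rewrite normrM mul1r (@le_trans _ _ 1) ?mulr_ile1//.
by rewrite lerDl sqr_ge0.
Qed.

Lemma mul_lex (u v x : R) : 0 < x -> `|u| <= 1 -> `|v| <= 1 ->
  `|x * (u * v)| <= 1 * (1 + x ^+ 2).
Proof.
move=> x0 u1 v1; rewrite normrM (gtr0_norm x0) mul1r.
rewrite (@le_trans _ _ x)//; last by nra.
by rewrite ler_piMr ?(ltW x0)// normrM mulr_ile1.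
Qed.

Let jj_le (X Y x : R) : `|j (X * x) * j (Y * x)| <= 1 * (1 + x ^+ 2).
Proof. by apply: mul_le1; exact: bj_le1. Qed.

Let j1j1_le (X Y x : R) : `|j1 (X * x) * j1 (Y * x)| <= 1 * (1 + x ^+ 2).
Proof. by apply: mul_le1; exact: bj1_le1. Qed.

Let xj1j_le (X Y x : R) : 0 < x -> `|x * (j1 (X * x) * j (Y * x))| <= 1 * (1 + x ^+ 2).
Proof. by move=> x0; apply: mul_lex => //; [exact: bj1_le1|exact: bj_le1]. Qed.

Lemma meas_jj (X Y : R) : measurable_fun setT (fun x : R => j (X * x) * j (Y * x)).
Proof. by apply: measurable_funM; exact: meas_bj. Qed.

Lemma meas_j1j1 (X Y : R) : measurable_fun setT (fun x : R => j1 (X * x) * j1 (Y * x)).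
Proof. by apply: measurable_funM; exact: meas_bj1. Qed.

Lemma meas_xj1j (X Y : R) :
  measurable_fun setT (fun x : R => x * (j1 (X * x) * j (Y * x))).
Proof.
apply: measurable_funM; first exact: measurable_id.
by apply: measurable_funM; [exact: meas_bj1|exact: meas_bj].
Qed.

Lemma gint_lin2 T (f g : R -> R) (A B c d : R) : trig T ->
  measurable_fun setT f -> measurable_fun setT g ->
  (forall x : R, 0 < x -> `|f x| <= A * (1 + x ^+ 2)) ->
  (forall x : R, 0 < x -> `|g x| <= B * (1 + x ^+ 2)) ->
  gint T eps s (fun x => c * f x + d * g x) =
  c * gint T eps s f + d * gint T eps s g.
Proof.
move=> tT mf mg fA gB.
rewrite (@gintD _ a a0 eps s e0 T _ _ (`|c| * A) (`|d| * B))//; last 4 first.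
- by meas.
- by meas.
- by move=> x x0; rewrite normrM -mulrA ler_wpM2l// fA.
- by move=> x x0; rewrite normrM -mulrA ler_wpM2l// gB.
rewrite (gintZ a0 s e0 c tT mf fA) (gintZ a0 s e0 d tT mg gB)//.
Qed.

Let mixed_lin T (X Y : R) : trig T ->
  gint T eps s (fun x => - X * (j (X * x) * j (Y * x)) + Y * (j1 (X * x) * j1 (Y * x)))
  = - X * kK T X Y + Y * kM T X Y.
Proof.
move=> tT; apply: (gint_lin2 _ _ tT (meas_jj X Y) (meas_j1j1 X Y)) => x _.
- exact: jj_le.
- exact: j1j1_le.
Qed.

Let mixed_cos X Y : - X * kK cos X Y + Y * kM cos X Y =
  2 * eps * kPhi cos X Y + 2 * s * kPhi sin X Y.
Proof.
rewrite -(mixed_lin X Y trig_cos) (@by_parts_mixed X Y cos (fun u => - sin u))//.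
- rewrite (gintN a0 s e0 trig_sin (meas_xj1j X Y) (@xj1j_le X Y)).
  by rewrite mulrN opprK.
- by move=> u; exact: cvgN (@continuous_sin R u).
- exact: cos_abs.
- by move=> u; rewrite normrN sin_abs.
Qed.

Let mixed_sin X Y : - X * kK sin X Y + Y * kM sin X Y =
  2 * eps * kPhi sin X Y - 2 * s * kPhi cos X Y.
Proof.
rewrite -(mixed_lin X Y trig_sin) (@by_parts_mixed X Y sin cos)//.
- exact: continuous_cos.
- exact: sin_abs.
- exact: cos_abs.
Qed.

Let D := 2 * (eps ^+ 2 + s ^+ 2).
Let D0 : 0 < D.
Proof. by rewrite /D mulr_gt0// ltr_pwDl ?sqr_ge0// exprn_gt0. Qed.

(** With z = eps - i s, the identities [mixed_cos] and [mixed_sin] say -X K + Y M = 2 z Phi. Solving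
    for Phi is division by 2 z, and D = 2 |z|^2 is the real denominator. *)
Let solve_cos X Y : D * kPhi cos X Y = eps * (- X * kK cos X Y + Y * kM cos X Y)
  - s * (- X * kK sin X Y + Y * kM sin X Y).
Proof. by rewrite mixed_cos mixed_sin /D; ring. Qed.

Let solve_sin X Y : D * kPhi sin X Y = s * (- X * kK cos X Y + Y * kM cos X Y)
  + eps * (- X * kK sin X Y + Y * kM sin X Y).
Proof. by rewrite mixed_cos mixed_sin /D; ring. Qed.

Lemma kK_sym T X Y : kK T X Y = kK T Y X.
Proof. by apply: eq_gint => x _; rewrite mulrC. Qed.

Lemma kM_sym T X Y : kM T X Y = kM T Y X.
Proof. by apply: eq_gint => x _; rewrite mulrC. Qed.

Section ray.
Variables (x y : R).
Hypotheses (x0 : 0 <= x) (y0 : 0 <= y).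

Let K T l := kK T (l * x) (l * y).
Let M T l := kM T (l * x) (l * y).

Let dK T (l : R) : trig T -> is_derive l 1 (K T)
  (x * kPhi T (l * x) (l * y) + y * kPhi T (l * y) (l * x)).
Proof.
move=> tT.
rewrite -(gint_lin2 x y tT (meas_xj1j (l * x) (l * y)) (meas_xj1j (l * y) (l * x))
  (@xj1j_le _ _) (@xj1j_le _ _)).
pose f1 l z : R := x * (z * (j1 (l * x * z) * j (l * y * z)))
  + y * (z * (j1 (l * y * z) * j (l * x * z))).
have xy1 : 1 <= 1 + x + y by rewrite -addrA lerDl addr_ge0.
apply: (@derive_gint _ a a0 eps s e0 T (fun l z => j (l * x * z) * j (l * y * z)) f1
  (1 + x + y) (l - 1) (l + 1)) => //.
- by rewrite gtrBl ltrDl ltr01.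
- by move=> m; exact: meas_jj.
- move=> m z _ _; rewrite (le_trans (jj_le _ _ _))// ler_wpM2r//.
  by rewrite addr_ge0// sqr_ge0.
- move=> m z _ z0; rewrite /f1 (le_trans (ler_normD _ _))//.
  rewrite !(normrM x) !(normrM y) (ger0_norm x0) (ger0_norm y0).
  have := xj1j_le (m * x) (m * y) z0; have := xj1j_le (m * y) (m * x) z0.
  have := sqr_ge0 z; rewrite !mul1r.
  move: `|_| `|_| (z ^+ 2) => A B Z Z0 B1 A1.
  have := ler_wpM2l x0 A1; have := ler_wpM2l x0 B1.
  have := ler_wpM2l y0 A1; have := ler_wpM2l y0 B1; lra.
- move=> m z _ z0.
  have h1 := dj (x * z) m; have h2 := dj (y * z) m.
  apply: (is_derive_ext (derM h1 h2)) => [t|].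
    by congr (bj a _ * bj a _); ring.
  rewrite /f1 (_ : x * z * m = m * x * z); last by ring.
  rewrite (_ : y * z * m = m * y * z); last by ring.
  by ring.
Qed.

Let dM T (l : R) : trig T -> 0 < l -> is_derive l 1 (M T)
  (- x * kPhi T (l * y) (l * x) - y * kPhi T (l * x) (l * y) - 2 * a / l * M T l).
Proof.
move=> tT l0.
pose g m z : R := - x * (z * (j1 (m * y * z) * j (m * x * z)))
  + - y * (z * (j1 (m * x * z) * j (m * y * z))).
pose f1 m z : R := 1 * g m z + - (2 * a / m) * (j1 (m * x * z) * j1 (m * y * z)).
have gl m z : 0 < z -> `|g m z| <= (x + y) * (1 + z ^+ 2).
  move=> z0; rewrite /g (le_trans (ler_normD _ _))//.
  rewrite !(normrM (- x)) !(normrM (- y)) !normrN (ger0_norm x0) (ger0_norm y0).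
  have := xj1j_le (m * x) (m * y) z0; have := xj1j_le (m * y) (m * x) z0.
  rewrite !mul1r; move: `|_| `|_| (z ^+ 2) => A B Z B1 A1.
  have := ler_wpM2l x0 A1; have := ler_wpM2l x0 B1.
  have := ler_wpM2l y0 A1; have := ler_wpM2l y0 B1; lra.
have mg m : measurable_fun setT (g m).
  have := meas_xj1j (m * y) (m * x); have := meas_xj1j (m * x) (m * y).
  by move=> h1 h2; rewrite /g; apply: measurable_funD; apply: measurable_funM.
have -> : - x * kPhi T (l * y) (l * x) - y * kPhi T (l * x) (l * y) - 2 * a / l * M T l =
    gint T eps s (f1 l).
  rewrite /f1 (gint_lin2 _ _ tT (mg l) (meas_j1j1 _ _) (gl l) (fun x _ => j1j1_le _ _ x)).
  rewrite /g (gint_lin2 _ _ tT (meas_xj1j (l * y) (l * x)) (meas_xj1j (l * x) (l * y))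
    (@xj1j_le _ _) (@xj1j_le _ _)).
  by rewrite mul1r !mulNr.
have B0 : 0 <= 2 * a / (l / 2) by rewrite !divr_ge0 ?mulr_ge0// ltW.
(* The window (l/2, l+1) keeps the parameter away from 0, so that 2a/m stays below 2a/(l/2) and a
   single majorant serves. *)
apply: (@derive_gint _ a a0 eps s e0 T (fun l z => j1 (l * x * z) * j1 (l * y * z)) f1
  (1 + (x + y) + 2 * a / (l / 2)) (l / 2) (l + 1)) => //.
- by rewrite gtr_pMr ?ltrDl ?invf_lt1 ?ltr1n ?ltr01.
- by move=> m; exact: meas_j1j1.
- move=> m z _ _; rewrite (le_trans (j1j1_le _ _ _))// ler_wpM2r//.
    by rewrite addr_ge0// sqr_ge0.
  by rewrite -addrA lerDl !addr_ge0.
- move=> m z /andP[lm _] z0; rewrite /f1 (le_trans (ler_normD _ _))//.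
  have m0 : 0 < m by rewrite (lt_trans _ lm)// divr_gt0.
  have h1 : `|- (2 * a / m)| <= 2 * a / (l / 2).
    rewrite normrN ger0_norm ?divr_ge0 ?mulr_ge0 ?(ltW m0)//.
    rewrite ler_wpM2l ?mulr_ge0// lef_pV2 ?posrE ?divr_gt0//; exact: ltW.
  rewrite mul1r normrM.
  have h2 := j1j1_le (m * x) (m * y) z; have h3 := gl m z z0.
  have h4 := ler_pM (normr_ge0 _) (normr_ge0 _) h1 h2.
  rewrite mul1r in h4; have := sqr_ge0 z; move: h3 h4 => /=; lra.
- move=> m z /andP[lm _] z0.
  have m0 : 0 < m by rewrite (lt_trans _ lm)// divr_gt0.
  have h1 := dj1 (x * z) m; have h2 := dj1 (y * z) m.
  apply: (is_derive_ext (derM h1 h2)) => [t|].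
    by congr (bj1 a _ * bj1 a _); ring.
  rewrite /f1 /g (_ : x * z * m = m * x * z); last by ring.
  rewrite (_ : y * z * m = m * y * z); last by ring.
  rewrite /bj1; move: (q _) (q _) (j _) (j _) => u v t r.
  by field; rewrite gt_eqF.
Qed.

Let cK T (l : R) : trig T -> {for l, continuous (K T)}.
Proof. by move=> tT; exact: der_continuous (dK l tT). Qed.

Let cM T (l : R) : trig T -> {for l, continuous (M T)}.
Proof.
move=> tT; apply: (@continuous_gint _ a a0 eps s e0 T
  (fun l z => j1 (l * x * z) * j1 (l * y * z)) 1) => //.
- by move=> m; exact: meas_j1j1.
- move=> z; have h := cj1 (c := x * z); have h2 := cj1 (c := y * z).
  have e : (fun l : R => j1 (l * x * z) * j1 (l * y * z)) =
      (fun l : R => j1 (x * z * l) * j1 (y * z * l)).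
    by apply/funext => t; congr (bj1 a _ * bj1 a _); ring.
  rewrite e; move=> t; apply: cvgM; [exact: h|exact: h2].
Qed.

(** With z = eps - i s, the system along the ray l -> (l x, l y) reads K' = V/(2z) and M' = W/(2z) -
    (2a/l) M. *)
Let V T l := l * (2 * x * y * M T l - (x ^+ 2 + y ^+ 2) * K T l).
Let W T l := l * (2 * x * y * K T l - (x ^+ 2 + y ^+ 2) * M T l).

Let Dneq : D != 0. Proof. by rewrite gt_eqF. Qed.

Let PhicE X Y : kPhi cos X Y = (eps * (- X * kK cos X Y + Y * kM cos X Y)
  - s * (- X * kK sin X Y + Y * kM sin X Y)) / D.
Proof. by rewrite -solve_cos mulrC mulKf. Qed.

Let PhisE X Y : kPhi sin X Y = (s * (- X * kK cos X Y + Y * kM cos X Y)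
  + eps * (- X * kK sin X Y + Y * kM sin X Y)) / D.
Proof. by rewrite -solve_sin mulrC mulKf. Qed.

Let dKc (l : R) : is_derive l 1 (K cos) ((eps * V cos l - s * V sin l) / D).
Proof.
apply: (is_derive_ext (dK l trig_cos)) => //.
rewrite !PhicE /V /K /M.
rewrite !(kK_sym _ (l * y)) !(kM_sym _ (l * y)).
by move: (kK _ _ _) (kK _ _ _) (kM _ _ _) (kM _ _ _) D^-1 => ? ? ? ? ?; ring.
Qed.

Let dKs (l : R) : is_derive l 1 (K sin) ((s * V cos l + eps * V sin l) / D).
Proof.
apply: (is_derive_ext (dK l trig_sin)) => //.
rewrite !PhisE /V /K /M.
rewrite !(kK_sym _ (l * y)) !(kM_sym _ (l * y)).
by move: (kK _ _ _) (kK _ _ _) (kM _ _ _) (kM _ _ _) D^-1 => ? ? ? ? ?; ring.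
Qed.

Let dMc (l : R) : 0 < l ->
  is_derive l 1 (M cos) ((eps * W cos l - s * W sin l) / D - 2 * a / l * M cos l).
Proof.
move=> l0; apply: (is_derive_ext (dM trig_cos l0)) => //.
rewrite !PhicE /W /K /M.
rewrite !(kK_sym _ (l * y)) !(kM_sym _ (l * y)).
by move: (kK _ _ _) (kK _ _ _) (kM _ _ _) (kM _ _ _) D^-1 => ? ? ? ? ?; ring.
Qed.

Let dMs (l : R) : 0 < l ->
  is_derive l 1 (M sin) ((s * W cos l + eps * W sin l) / D - 2 * a / l * M sin l).
Proof.
move=> l0; apply: (is_derive_ext (dM trig_sin l0)) => //.
rewrite !PhisE /W /K /M.
rewrite !(kK_sym _ (l * y)) !(kM_sym _ (l * y)).
by move: (kK _ _ _) (kK _ _ _) (kM _ _ _) (kM _ _ _) D^-1 => ? ? ? ? ?; ring.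
Qed.

Let K0 T : K T 0 = gint T eps s (fun=> 1).
Proof. by apply: eq_gint => z _; rewrite !mul0r bj0 mulr1. Qed.

Let M0 T : M T 0 = 0.
Proof.
rewrite /M /kM /gint (eq_Int (g := fun=> 0)) ?Int0// => z.
by rewrite !mul0r bj10 !(mulr0, mul0r).
Qed.

Let cexp (c l : R) : {for l, continuous (fun l : R => expR (c * l ^+ 2))}.
Proof. exact: der_continuous (derexp (derZ c (derX2 (derI l)))). Qed.

Let cX2 (f : R -> R) (l : R) : {for l, continuous f} ->
  {for l, continuous (fun l => f l ^+ 2)}.
Proof. by move=> cf; apply: (cvgM cf cf). Qed.

(** A Gronwall argument on the ray: (|K|^2 + |M|^2) e^{c l^2} is nonincreasing for l in [0,1]. At l
    = 0 one has bj = 1 and bj' = 0, so M vanishes and K is the plain Gaussian integral. *)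
Lemma kernel_energy : kK cos x y ^+ 2 + kK sin x y ^+ 2 + kM cos x y ^+ 2 + kM sin x y ^+ 2
  <= (gint cos eps s (fun=> 1) ^+ 2 + gint sin eps s (fun=> 1) ^+ 2)
     * expR (- (eps * (x - y) ^+ 2 / (2 * (eps ^+ 2 + s ^+ 2)))).
Proof.
(* This c is what turns the quadratic form in K and M into -2xy |K - M|^2, through (x-y)^2 = x^2 +
   y^2 - 2xy; the terms carrying s cancel between the cos and sin components. *)
rewrite -/D; pose c := eps * (x - y) ^+ 2 / D.
pose E l := K cos l ^+ 2 + K sin l ^+ 2 + M cos l ^+ 2 + M sin l ^+ 2.
pose f l := E l * expR (c * l ^+ 2).
have cf (l : R) : {for l, continuous f}.
  apply: cvgM; last exact: cexp.
  apply: cvgD; [apply: cvgD; [apply: cvgD|]|].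
  - apply: cX2; exact: cK trig_cos.
  - apply: cX2; exact: cK trig_sin.
  - apply: cX2; exact: cM trig_cos.
  - apply: cX2; exact: cM trig_sin.
pose f1 l := - (4 * eps * l * x * y / D * ((K cos l - M cos l) ^+ 2 + (K sin l - M sin l) ^+ 2)
  + 4 * (a / l) * (M cos l ^+ 2 + M sin l ^+ 2)) * expR (c * l ^+ 2).
have df (l : R) : 0 < l < 1 -> is_derive l 1 f (f1 l).
  move=> /andP[l0 _].
  have h := derM (derD (derD (derD (derX2 (dKc l)) (derX2 (dKs l))) (derX2 (dMc l0)))
    (derX2 (dMs l0))) (derexp (derZ c (derX2 (derI l)))).
  apply: (is_derive_ext h) => //; rewrite /f1 /V /W /c /=.
  move: D^-1 (K cos l) (K sin l) (M cos l) (M sin l) (expR _) => ? ? ? ? ? ?.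
  ring.
have := @ge_of_derive_le0 R f f1 0 1 ler01 (fun l _ => cf l) df.
have f1le (l : R) : 0 < l < 1 -> f1 l <= 0.
  move=> /andP[l0 _]; rewrite /f1 mulNr oppr_le0 mulr_ge0 ?expR_ge0//.
  by rewrite addr_ge0// ?mulr_ge0 ?addr_ge0 ?sqr_ge0 ?invr_ge0 ?(ltW l0) ?(ltW D0) ?(ltW e0).
move=> /(_ f1le); rewrite /f /E !K0 !M0 expr0n/= mulr0 expR0 mulr1 !addr0 /K /M !mul1r.
rewrite expr1n mulr1 -ler_pdivlMr ?expR_gt0// -expRN.
exact.
Qed.

(** For s = 0 the quantity (K^2 - M^2) e^{c l^2} is nondecreasing along the ray and starts at c0^2.
    If c0 > 0, then K has no zero on [0,1] and keeps its initial sign by the intermediate value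
    theorem; if c0 = 0, the energy bound forces K = 0. *)
Lemma kernel_ge0 : s = 0 -> 0 <= kK cos x y.
Proof.
move=> s0; set c0 := gint cos eps s (fun=> 1).
have c00 : 0 <= c0.
  apply: Int_ge0 => z; rewrite s0 mul0r cos0 !mulr1.
  by rewrite mulr_ge0 ?gauss_ge0 ?wt_ge0.
have sin0E : gint sin eps s (fun=> 1) = 0.
  rewrite /gint (eq_Int (g := fun=> 0)) ?Int0// => z.
  by rewrite s0 mul0r sin0 mulr0 !mul0r.
have [c0E|c0N] := eqVneq c0 0.
  have := kernel_energy; rewrite sin0E -/c0 c0E expr0n/= addr0 mul0r => h.
  have := sqr_ge0 (kK sin x y); have := sqr_ge0 (kM cos x y); have := sqr_ge0 (kM sin x y).
  move=> h1 h2 h3; have h4 : kK cos x y ^+ 2 <= 0 by lra.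
  have : kK cos x y ^+ 2 == 0 by rewrite eq_le h4 sqr_ge0.
  by rewrite sqrf_eq0 => /eqP ->.
pose c := (x ^+ 2 + y ^+ 2) / (2 * eps).
pose f l := (K cos l ^+ 2 - M cos l ^+ 2) * expR (c * l ^+ 2).
have cf (l : R) : {for l, continuous f}.
  apply: cvgM; last exact: cexp.
  by apply: cvgB; [apply: cX2; exact: cK trig_cos|apply: cX2; exact: cM trig_cos].
pose f1 l := 4 * (a / l) * M cos l ^+ 2 * expR (c * l ^+ 2).
have df (l : R) : 0 < l < 1 -> is_derive l 1 f (f1 l).
  move=> /andP[l0 _].
  have h := derM (derB (derX2 (dKc l)) (derX2 (dMc l0))) (derexp (derZ c (derX2 (derI l)))).
  apply: (is_derive_ext h) => //; rewrite /f1 /V /W /c /D s0 /=.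
  move: (K cos l) (K sin l) (M cos l) (M sin l) (expR _) => ? ? ? ? ?.
  by field; rewrite (gt_eqF e0) (gt_eqF l0).
have f1ge (l : R) : 0 < l < 1 -> 0 <= f1 l.
  move=> /andP[l0 _]; rewrite /f1 mulr_ge0 ?expR_ge0// mulr_ge0 ?sqr_ge0//.
  by rewrite mulr_ge0// divr_ge0// ltW.
have Kneq0 (l : R) : 0 <= l <= 1 -> K cos l != 0.
  move=> /andP[l0 l1]; apply/eqP => Kl.
  have : f 0 <= f l.
    apply: (@le_of_derive_ge0 R f f1 0 l l0) => // z /andP[z0 zl].
    - by apply: df; rewrite z0 (lt_le_trans zl).
    - by apply: f1ge; rewrite z0 (lt_le_trans zl).
  rewrite /f K0 M0 -/c0 Kl expr0n/= mulr0 expR0 mulr1 subr0 sub0r mulNr.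
  have : 0 < c0 ^+ 2 by rewrite exprn_even_gt0.
  have : 0 <= M cos l ^+ 2 * expR (c * l ^+ 2) by rewrite mulr_ge0 ?sqr_ge0 ?expR_ge0.
  lra.
rewrite leNgt; apply/negP => Kn.
have [|z] := @IVT R (K cos) 0 1 0 ler01 (continuous_in_subspaceT (fun l _ => @cK cos l trig_cos)).
  rewrite K0 -/c0 /K !mul1r; apply/andP; split.
    by rewrite ge_min (ltW Kn) orbT.
  by rewrite le_max c00.
by rewrite in_itv/= => /Kneq0/eqP.
Qed.

End ray.
End kernel.
End KernelBounds.

(** * The modulus of the complex Gaussian integral *)

Section GaussianMass.
Context {R : realType}.
Variable a : R.
Hypothesis a0 : 0 <= a.
Local Notation gint := (gint a).

(** The squared modulus of the half-line integral of e^{-(eps - i s) x^2} x^a. *)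
Definition gmass (eps s : R) : R :=
  gint cos eps s (fun=> 1) ^+ 2 + gint sin eps s (fun=> 1) ^+ 2.

Section moments.
Variables (eps s : R).
Hypothesis e0 : 0 < eps.

Let x2_le (x : R) : `|x * x| <= 1 * (1 + x ^+ 2).
Proof. by rewrite -expr2 ger0_norm ?sqr_ge0// mul1r lerDr. Qed.

Let one_le (x : R) : `|1 : R| <= 1 * (1 + x ^+ 2).
Proof. by rewrite normr1 mul1r lerDl sqr_ge0. Qed.

(** Integration by parts with phi(x) = x. The cos and sin cases together say (1+a) I_0 = 2 z I_2,
    where z = eps - i s and I_k is the integral with an extra x^k. *)
Lemma moment_by_parts (T T1 : R -> R) :
  (forall u : R, is_derive u 1 T (T1 u)) -> continuous T1 ->
  (forall u, `|T u| <= 1) -> (forall u, `|T1 u| <= 1) ->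
  (1 + a) * gint T eps s (fun=> 1) = 2 * eps * gint T eps s (fun x => x * x)
    - 2 * s * gint T1 eps s (fun x => x * x).
Proof.
move=> dT cT1 Tle T1le.
have mT : measurable_fun setT T.
  by apply: continuous_measurable_fun => u; exact: der_continuous (dT u).
have mone : measurable_fun setT (fun _ : R => 1 : R) by exact: measurable_cst.
rewrite -(gintZ a0 s e0 (1 + a) (conj mT Tle) mone (fun x _ => one_le x)).
have a1 : 1 <= 1 + a by rewrite lerDl.
apply: (@gint_by_parts _ a a0 T T1 eps s (1 + a) (fun x => x) (fun=> 1) (fun=> (1 + a) * 1)) => //.
- by move=> x _; exact: cvg_cst.
- by move=> x x0; field; rewrite gt_eqF.
- by move=> x x0; rewrite (gtr0_norm x0); nra.
- by move=> x x0; rewrite mulr1 ger0_norm ?addr_ge0//; nra.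
- by apply: cvg_at_right_filter; exact: cvg_id.
Qed.

Lemma moment_cos : (1 + a) * gint cos eps s (fun=> 1) =
  2 * eps * gint cos eps s (fun x => x * x) + 2 * s * gint sin eps s (fun x => x * x).
Proof.
rewrite (@moment_by_parts cos (fun u => - sin u))//.
- rewrite (gintN a0 s e0 trig_sin _ (fun x _ => x2_le x)); first by rewrite mulrN opprK.
  by meas.
- by move=> u; exact: cvgN (@continuous_sin R u).
- exact: cos_abs.
- by move=> u; rewrite normrN sin_abs.
Qed.

Lemma moment_sin : (1 + a) * gint sin eps s (fun=> 1) =
  2 * eps * gint sin eps s (fun x => x * x) - 2 * s * gint cos eps s (fun x => x * x).
Proof.
apply: moment_by_parts.
- exact: continuous_cos.
- exact: sin_abs.
- exact: cos_abs.
Qed.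

End moments.

Section path.
Variables (L s : R).
Let e (t : R) := expR (L * t).
Let A T t := gint T (e t) (s * t) (fun=> 1).
Let A2 T t := gint T (e t) (s * t) (fun x => x * x).

Let dA (T T1 : R -> R) (t : R) :
  (forall u : R, is_derive u 1 T (T1 u)) -> trig T -> trig T1 -> -1 < t < 2 ->
  is_derive t 1 (A T) (- (L * e t) * A2 T t + s * A2 T1 t).
Proof.
move=> dT tT tT1 ht.
have e_gt0 l : 0 < e l by exact: expR_gt0.
(* On the window -1 < t < 2 around [0,1] the rate e(t) is at least m, so one Gaussian of rate m
   dominates all the integrands. *)
pose m := expR (- (2 * `|L|)).
have m0 : 0 < m by exact: expR_gt0.
have Ll (l : R) : -1 < l < 2 -> `|L * l| <= 2 * `|L|.
  move=> hl; rewrite normrM mulrC ler_wpM2r// ler_norml; lra.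
have em (l : R) : -1 < l < 2 -> m <= e l.
  by move=> /Ll; rewrite ler_norml => /andP[h _]; rewrite ler_expR.
have eM (l : R) : -1 < l < 2 -> e l <= expR (2 * `|L|).
  by move=> /Ll; rewrite ler_norml => /andP[_ h]; rewrite ler_expR.
pose B := `|L| * expR (2 * `|L|) + `|s|.
have B0 : 0 <= B by rewrite addr_ge0// mulr_ge0// expR_ge0.
pose f1 l x : R := (- (L * e l) * (gauss (e l) x * T (s * l * x ^+ 2) * (x * x) * wt a x)
  + s * (gauss (e l) x * T1 (s * l * x ^+ 2) * (x * x) * wt a x)).
have mone : measurable_fun setT (fun _ : R => 1 : R) by exact: measurable_cst.
have mxx : measurable_fun setT (fun x : R => x * x) by meas.
have one_le (x : R) : 0 < x -> `|1 : R| <= 1 * (1 + x ^+ 2).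
  by move=> _; rewrite normr1 mul1r lerDl sqr_ge0.
have xx_le (x : R) : 0 < x -> `|x * x| <= 1 * (1 + x ^+ 2).
  by move=> _; rewrite -expr2 ger0_norm ?sqr_ge0// mul1r lerDr.
have -> : - (L * e t) * A2 T t + s * A2 T1 t = Int (f1 t).
  rewrite /f1 IntD ?IntZ//.
  - exact: (intg_gint a0 _ (e_gt0 t) tT.1 tT.2 mxx xx_le).
  - exact: (intg_gint a0 _ (e_gt0 t) tT1.1 tT1.2 mxx xx_le).
  - exact/intgZ/(intg_gint a0 _ (e_gt0 t) tT.1 tT.2 mxx xx_le).
  - exact/intgZ/(intg_gint a0 _ (e_gt0 t) tT1.1 tT1.2 mxx xx_le).
apply: (@derive_Int R (fun l x => gauss (e l) x * T (s * l * x ^+ 2) * 1 * wt a x) f1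
  (fun x => (0 + B * x ^+ 2) * (gauss m x * wt a x)) (-1) 2 t ht).
- move=> l _; exact: (intg_gint a0 _ (e_gt0 l) tT.1 tT.2 mone one_le).
- exact: intg_gauss_lin.
- move=> l x _.
  have de : is_derive l 1 e (L * e l).
    by apply: (is_derive_ext (derexp (derZ L (derI l)))) => //; rewrite mulr1.
  have dg : is_derive l 1 (fun l => gauss (e l) x) (- (L * e l * x ^+ 2) * gauss (e l) x).
    by apply: (is_derive_ext (derexp (derN (derM de (derC (x ^+ 2) l))))) => //=;
      rewrite mulr0 addr0.
  have dTs : is_derive l 1 (fun l => T (s * l * x ^+ 2)) (T1 (s * l * x ^+ 2) * (s * x ^+ 2)).
    apply: (dercomp (g := fun l => s * l * x ^+ 2) (dT _)).
    apply: (is_derive_ext (derM (derZ s (derI l)) (derC (x ^+ 2) l))) => //; ring.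
  apply: (is_derive_ext (derM (derM dg dTs) (derC (wt a x) l))) => [z|].
    by rewrite mulr1.
  by rewrite /f1 expr2; ring.
- move=> l x hl; rewrite /f1.
  have gm : gauss (e l) x <= gauss m x.
    by rewrite ler_expR lerN2 ler_wpM2r ?sqr_ge0// em.
  have h (T0 : R -> R) : trig T0 ->
      `|gauss (e l) x * T0 (s * l * x ^+ 2) * (x * x) * wt a x| <= x ^+ 2 * (gauss m x * wt a x).
    move=> [_ T0le]; rewrite !normrM (ger0_norm (gauss_ge0 _ x)) (ger0_norm (wt_ge0 a x)).
    rewrite [leRHS]mulrA ler_wpM2r ?wt_ge0// -normrM -expr2 (ger0_norm (sqr_ge0 x)).
    rewrite mulrC ler_wpM2l ?sqr_ge0// -[leRHS]mulr1 ler_pM ?gauss_ge0//.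
  rewrite (le_trans (ler_normD _ _))// !(normrM (- _)) !(normrM s) normrN normrM.
  rewrite (ger0_norm (ltW (e_gt0 l))).
  have h1 : `|L| * e l <= `|L| * expR (2 * `|L|) by rewrite ler_wpM2l// eM.
  have h2 := ler_pM _ (normr_ge0 _) h1 (h T tT).
  have h3 := ler_pM (normr_ge0 s) (normr_ge0 _) (lexx `|s|) (h T1 tT1).
  rewrite add0r -(mulrA B) /B mulrDl lerD//; apply: h2.
  by rewrite mulr_ge0// ltW.
Qed.

Let P (t : R) := e t ^+ 2 + (s * t) ^+ 2.
Let b := (1 + a) / 2.
Let f t := (A cos t ^+ 2 + A sin t ^+ 2) * P t `^ b.

Let P0 t : 0 < P t.
Proof. by rewrite ltr_pwDl ?sqr_ge0// exprn_gt0// expR_gt0. Qed.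

Let df (t : R) : -1 < t < 2 -> is_derive t 1 f 0.
Proof.
move=> ht.
have dc := dA (fun u => is_derive_cos u) trig_cos
  (conj (measurable_funN (@trig_sin R).1) (fun u => eq_ind_r (fun z => z <= 1) (@sin_abs R u) (normrN _))) ht.
have ds := dA (fun u => is_derive_sin u) trig_sin trig_cos ht.
have e_gt0 : 0 < e t by exact: expR_gt0.
have de : is_derive t 1 e (L * e t).
  by apply: (is_derive_ext (derexp (derZ L (derI t)))) => //; rewrite mulr1.
have dP : is_derive t 1 P (2 * e t * (L * e t) + 2 * (s * t) * s).
  apply: (is_derive_ext (derD (derX2 de) (derX2 (derZ s (derI t))))) => //=.
  by rewrite mulr1.
have dPb := dercomp (g := P) (is_derive1_powR b (P0 t)) dP.
apply: (is_derive_ext (derM (derD (derX2 dc) (derX2 ds)) dPb)) => //=.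
have -> : P t `^ (b - 1) = P t `^ b / P t.
  by rewrite powRD ?(gt_eqF (P0 t)) ?implybT// powR_inv1// ltW.
have -> : A2 (fun u => - sin u) t = - A2 sin t.
  rewrite /A2 (@gintN _ a a0 _ _ e_gt0 sin _ 1 trig_sin)//; first by meas.
  by move=> x _; rewrite -expr2 ger0_norm ?sqr_ge0// mul1r lerDr.
have := moment_cos (s * t) e_gt0; have := moment_sin (s * t) e_gt0.
rewrite -/(A cos t) -/(A sin t) -/(A2 cos t) -/(A2 sin t) => hs hc.
have Pn : P t != 0 by rewrite gt_eqF.
have hA2 : A2 cos t = b * (e t * A cos t - s * t * A sin t) / P t.
  apply: (mulIf Pn); rewrite mulfVK// /b.
  rewrite (_ : (1 + a) / 2 * _ = (e t * ((1 + a) * A cos t) - s * t * ((1 + a) * A sin t)) / 2);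
    last by field.
  by rewrite hs hc /P; field.
have hB2 : A2 sin t = b * (s * t * A cos t + e t * A sin t) / P t.
  apply: (mulIf Pn); rewrite mulfVK// /b.
  rewrite (_ : (1 + a) / 2 * _ = (s * t * ((1 + a) * A cos t) + e t * ((1 + a) * A sin t)) / 2);
    last by field.
  by rewrite hs hc /P; field.
rewrite hA2 hB2; move: (A cos t) (A sin t) (P t `^ b) (P t) (e t) Pn => u v w p z Pn.
by field.
Qed.

(** By the moment relation |I_0(z)|^2 |z|^{1+a} has zero derivative along z(t) = e^{Lt} - i s t.
    This path joins 1 to e^L - i s and keeps the real part positive, so no complex power is
    involved. *)
Lemma gmass_path : gmass (expR L) s * (expR L ^+ 2 + s ^+ 2) `^ ((1 + a) / 2) = gmass 1 0.
Proof.
have h1 : f 0 <= f 1.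
  apply: (@le_of_derive_ge0 R f (fun=> 0) 0 1 ler01) => // [z hz|z hz].
  - by apply: (der_continuous (df _)); lra.
  - by apply: df; lra.
have h2 : f 1 <= f 0.
  apply: (@ge_of_derive_le0 R f (fun=> 0) 0 1 ler01) => // [z hz|z hz].
  - by apply: (der_continuous (df _)); lra.
  - by apply: df; lra.
have : f 1 = f 0 by apply/eqP; rewrite eq_le h1 h2.
rewrite /f /P /A /e !mulr1 !mulr0 expR0 expr1n expr0n/= addr0 powR1 mulr1.
exact.
Qed.
End path.

Lemma gmassE (eps s : R) : 0 < eps ->
  gmass eps s = gmass 1 0 * (eps ^+ 2 + s ^+ 2) `^ (- ((1 + a) / 2)).
Proof.
move=> e0; have := gmass_path (ln eps) s; rewrite lnK ?posrE// => <-.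
have P0 : 0 < eps ^+ 2 + s ^+ 2 by rewrite ltr_pwDl ?sqr_ge0// exprn_gt0.
by rewrite powRN mulfK// gt_eqF// powR_gt0.
Qed.

End GaussianMass.

(** * Measurability of parametric integrals, removal of the Gaussian, a discriminant inequality *)

Section MoreIntegrals.
Context {R : realType}.
Notation mu := (@lebesgue_measure R).

Lemma meas_Int {d} {T : measurableType d} (H : T * R -> R) (h : R -> R) :
  measurable_fun setT H -> intg h -> (forall z x, `|H (z, x)| <= h x) ->
  measurable_fun setT (fun z => Int (fun x => H (z, x))).
Proof.
move=> mH ih Hh.
have iH z : intg (fun x => H (z, x)).
  by apply: intg_le ih => //; apply: (measurableT_comp mH); exact: measurable_fun_pair.
(* Adding the majorant h makes the integrand nonnegative, so that Tonelli's theorem gives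
   measurability; the constant Int h is then subtracted. *)
have -> : (fun z => Int (fun x => H (z, x))) =
    (fun z => fine (\int[mu]_x (H (z, x) + h x)%:E) - Int h).
  apply/funext => z; rewrite -EFin_Int/=; last exact: intgD.
  by rewrite IntD// addrK.
apply: measurable_funB => //.
apply: (measurableT_comp (fine_measurable measurableT)).
apply: (measurable_fun_fubini_tonelli_F (m2 := mu) (fun z : T * R => (H z + h z.2)%:E)).
- apply/measurable_EFinP/measurable_funD => //.
  by apply: measurableT_comp => //; exact: intg_meas.
- move=> [z x]; rewrite lee_fin /=.
  by have := Hh z x; rewrite ler_norml => /andP[+ _]; lra.
Qed.

(** Monotone convergence along eps = 1/(n+1): a bound uniform in eps survives the removal of the
    regularisation. *)
Lemma gauss_limit (f : R -> R) (M : \bar R) : measurable_fun setT f ->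
  (forall x, 0 <= f x) ->
  (forall eps, 0 < eps -> (\int[mu]_x (gauss eps x * f x)%:E <= M)%E) ->
  (\int[mu]_x (f x)%:E <= M)%E.
Proof.
move=> mf f0 fM.
pose g (n : nat) x := (gauss n.+1%:R^-1 x * f x)%:E.
have mg n : measurable_fun setT (g n).
  by apply/measurable_EFinP/measurable_funM => //; exact: meas_gauss.
have g0 n x : setT x -> (0 <= g n x)%E.
  by move=> _; rewrite lee_fin mulr_ge0 ?gauss_ge0.
have ndg x : setT x -> {homo g^~ x : n m / (n <= m)%N >-> (n <= m)%E}.
  move=> _ n m nm; rewrite lee_fin ler_wpM2r// ler_expR lerN2 ler_wpM2r ?sqr_ge0//.
  by rewrite lef_pV2 ?posrE// ler_nat.
have gf x : setT x -> g n x @[n --> \oo] --> (f x)%:E.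
  move=> _; apply: cvg_EFin; first exact: nearW.
  have h1 : - (n.+1%:R^-1 * x ^+ 2) @[n --> \oo] --> - (0 * x ^+ 2).
    by apply: cvgN; apply: cvgM; [exact: cvg_harmonic|exact: cvg_cst].
  have h2 : expR (- (n.+1%:R^-1 * x ^+ 2)) * f x @[n --> \oo] --> expR (- (0 * x ^+ 2)) * f x.
    by apply: cvgM; [exact: (continuous_cvg _ (@continuous_expR R _) h1)|exact: cvg_cst].
  by move: h2; rewrite mul0r oppr0 expR0 mul1r.
have := cvg_monotone_convergence (mu := mu) measurableT mg g0 ndg.
have -> : (fun x => limn (g^~ x)) = (fun x => (f x)%:E).
  by apply/funext => x; apply/cvg_lim => //; exact: gf.
move=> h; rewrite -(cvg_lim _ h)//; apply: lime_le.
  by apply/cvg_ex; exists (\int[mu]_x (f x)%:E)%E.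
by apply: nearW => n; exact: fM.
Qed.

(** The best choice is k = |B|/A; when A = 0, a nonzero B is excluded by k = (C+1)/|B|. *)
Lemma cauchy_schwarz_discr (A B C : R) : 0 <= A -> 0 <= C ->
  (forall k, 0 < k -> 2 * k * `|B| <= k ^+ 2 * A + C) -> B ^+ 2 <= A * C.
Proof.
move=> A0 C0 h; rewrite -(real_normK (num_real B)); move: `|B| (normr_ge0 B) h => {}B.
rewrite le_eqVlt => /predU1P[<- _|B0 h]; first by rewrite expr0n/= mulr_ge0.
move: A0; rewrite le_eqVlt => /predU1P[A0|A0].
  have := h ((C + 1) / B); rewrite divr_gt0 ?ltr_wpDl// => /(_ isT).
  by rewrite -A0 mulr0 add0r -mulrA mulfVK ?gt_eqF//; lra.
have := h (B / A); rewrite divr_gt0// => /(_ isT).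
rewrite -(ler_pM2l A0) => h2; have -> : B ^+ 2 = A * (2 * (B / A) * B) - A * ((B / A) ^+ 2 * A).
  by field; rewrite gt_eqF.
by rewrite lerBlDr -mulrDr addrC.
Qed.

End MoreIntegrals.

(** * The Hankel transform and the L^1 and L^2 bounds for the regularised propagator *)

Section HankelOperator.
Context {R : realType}.
Notation mu := (@lebesgue_measure R).
Variable a : R.
Hypothesis a0 : 0 <= a.
Local Notation j := (bj a).
Local Notation w := (wt a).

Definition hk (f : R -> R) (xi : R) : R := Int (fun x => f x * w x * j (x * xi)).

Lemma meas_bjM {d} {T : measurableType d} (f g : T -> R) :
  measurable_fun setT f -> measurable_fun setT g ->
  measurable_fun setT (fun z => j (f z * g z)).
Proof. by move=> mf mg; apply: meas_cont; [exact: continuous_bj|exact: measurable_funM]. Qed.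

Lemma intg_hk (f : R -> R) (xi : R) : intg (fun x => f x * w x) ->
  intg (fun x => f x * w x * j (x * xi)).
Proof.
move=> If; have := @intg_bounded R 1 (fun x => j (x * xi)) _ _ (fun x => bj_le1 a0 _) If.
move=> h; apply: eq_intg (h _) => [x|]; first by rewrite mulrC.
by apply: meas_bjM; meas.
Qed.

Lemma hk_le (f : R -> R) (xi : R) : intg (fun x => f x * w x) ->
  `|hk f xi| <= Int (fun x => `|f x * w x|).
Proof.
move=> If; apply: le_norm_Int.
- exact: intg_meas (intg_hk xi If).
- exact: intg_norm.
- by move=> x; rewrite normrM ler_piMr// bj_le1.
Qed.

Lemma meas_hk (f : R -> R) : intg (fun x => f x * w x) -> measurable_fun setT (hk f).
Proof.
move=> If.
apply: (@meas_Int _ _ _ (fun z : R * R => f z.2 * w z.2 * j (z.2 * z.1)) (fun x => `|f x * w x|)).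
- apply: measurable_funM; last by apply: meas_bjM; meas.
  exact: (measurableT_comp (intg_meas If) measurable_snd).
- exact: intg_norm.
- by move=> xi x /=; rewrite normrM ler_piMr// bj_le1.
Qed.

Lemma hk_duality (f h : R -> R) : intg (fun x => f x * w x) -> intg h ->
  Int (fun xi => h xi * hk f xi) =
  Int (fun x => f x * w x * Int (fun xi => h xi * j (x * xi))).
Proof.
move=> If Ih.
pose G (z : R * R) := h z.1 * (f z.2 * w z.2 * j (z.2 * z.1)).
have mG : measurable_fun setT G.
  apply: measurable_funM; first exact: (measurableT_comp (intg_meas Ih)).
  apply: measurable_funM; last by apply: meas_bjM; meas.
  exact: (measurableT_comp (intg_meas If) measurable_snd).
have GM xi x : `|G (xi, x)| <= `|h xi| * `|f x * w x|.
  by rewrite /G /= normrM ler_wpM2l// normrM ler_piMr// bj_le1.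
have := Fubini_Int mG (intg_norm Ih) (intg_norm If) GM; rewrite /G /=.
have -> : (fun xi => Int (fun x => h xi * (f x * w x * j (x * xi)))) =
    (fun xi => h xi * hk f xi).
  by apply/funext => xi; rewrite IntZ//; exact: intg_hk.
move=> ->; apply: eq_Int => x; rewrite -IntZ.
  by apply: eq_Int => xi; ring.
apply: eq_intg (intg_bounded _ (fun xi => bj_le1 a0 (x * xi)) Ih) => [xi|].
  by rewrite mulrC.
by apply: meas_bjM; meas.
Qed.

(** The real part of the pairing of e^{i s xi^2} hk f with hk g, cut off by a Gaussian. Only the
    cosine is kept, since f and g are real and the time integrals are symmetric in t and s. *)
Definition hform (eps s : R) (f g : R -> R) : R :=
  gint a cos eps s (fun xi => hk f xi * hk g xi).

Section estimates.
Variables (eps s : R).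
Hypothesis e0 : 0 < eps.

Lemma intg_cosw (f : R -> R) (A : R) : measurable_fun setT f -> (forall x, `|f x| <= A) ->
  intg (fun x => gauss eps x * cos (s * x ^+ 2) * w x * f x).
Proof.
move=> mf fA.
have h := intg_gint a0 s e0 (@trig_cos R).1 (@trig_cos R).2 mf (A := A).
apply: eq_intg (h _) => [x|x x0]; first by ring.
rewrite (le_trans (fA x))// ler_peMr ?lerDl ?sqr_ge0//.
by rewrite (le_trans _ (fA 0)).
Qed.

Lemma hform_kernel (f g : R -> R) :
  intg (fun x => f x * w x) -> intg (fun x => g x * w x) ->
  hform eps s f g = Int (fun x => f x * w x * Int (fun y => g y * w y * kK a eps s cos x y)).
Proof.
move=> If Ig.
have h1 := intg_cosw (meas_hk Ig) (fun x => hk_le x Ig).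
transitivity (Int (fun xi => (gauss eps xi * cos (s * xi ^+ 2) * w xi * hk g xi) * hk f xi)).
  by apply: eq_Int => x; ring.
rewrite (hk_duality If h1); apply: eq_Int => x; congr (_ * _).
have mj : measurable_fun setT (fun xi : R => j (x * xi)) by apply: meas_bjM; meas.
have h2 := intg_cosw mj (fun xi => bj_le1 a0 _).
transitivity (Int (fun xi => (gauss eps xi * cos (s * xi ^+ 2) * w xi * j (x * xi)) * hk g xi)).
  by apply: eq_Int => xi; ring.
rewrite (hk_duality Ig h2); apply: eq_Int => y; congr (_ * _).
by apply: eq_Int => xi; ring.
Qed.

Lemma meas_kK : measurable_fun setT (fun z : R * R => kK a eps s cos z.1 z.2).
Proof.
apply: (@meas_Int _ _ _ (fun z : (R * R) * R => gauss eps z.2 * cos (s * z.2 ^+ 2) *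
  (j (z.1.1 * z.2) * j (z.1.2 * z.2)) * w z.2) (fun x => gauss eps x * w x)).
- have m1 : measurable_fun setT (fun z : (R * R) * R => z.1.1) by exact: measurableT_comp.
  have m2 : measurable_fun setT (fun z : (R * R) * R => z.1.2) by exact: measurableT_comp.
  have m3 : measurable_fun setT (fun z : (R * R) * R => z.2) by exact: measurable_snd.
  have m4 := measurableT_comp (meas_wt a) m3.
  have m5 := measurableT_comp (@meas_gauss R eps) m3.
  have m6 := meas_bjM m1 m3; have m7 := meas_bjM m2 m3.
  by meas.
- exact: intg_gauss_wt.
- move=> [x y] xi /=; rewrite !normrM (ger0_norm (gauss_ge0 eps xi)) (ger0_norm (wt_ge0 a xi)).
  rewrite ler_wpM2r ?wt_ge0// -mulrA ler_piMr ?gauss_ge0//.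
  by rewrite mulr_ile1 ?mulr_ge0 ?cos_abs// mulr_ile1// bj_le1.
Qed.

Lemma kK_sqr_le (x y : R) : 0 <= x -> 0 <= y -> kK a eps s cos x y ^+ 2 <=
  gmass a eps s * expR (- (eps * (x - y) ^+ 2 / (2 * (eps ^+ 2 + s ^+ 2)))).
Proof.
move=> x0 y0; apply: le_trans (kernel_energy a0 s e0 x0 y0).
have := sqr_ge0 (kK a eps s sin x y); have := sqr_ge0 (kM a eps s cos x y).
have := sqr_ge0 (kM a eps s sin x y); lra.
Qed.

Lemma gmass_ge0 : 0 <= gmass a eps s.
Proof. by rewrite addr_ge0 ?sqr_ge0. Qed.

Lemma norm_le_of_sqr (u v : R) : 0 <= v -> u ^+ 2 <= v ^+ 2 -> `|u| <= v.
Proof.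
move=> v0 uv; rewrite -(@ler_pXn2r _ 2)// ?nnegrE//.
by rewrite real_normK ?num_real.
Qed.

Definition disp : R := Num.sqrt (gmass a 1 0) * `|s| `^ (- ((1 + a) / 2)).

(** In [kernel_energy] the exponential is at most 1, and [gmassE] makes the mass a multiple of
    (eps^2 + s^2)^{-(1+a)/2}; dropping eps^2 leaves a bound free of eps, x and y. *)
Lemma kK_disp (x y : R) : s != 0 -> 0 <= x -> 0 <= y -> `|kK a eps s cos x y| <= disp.
Proof.
move=> s0 x0 y0; have ns : 0 < `|s| by rewrite normr_gt0.
have g1 : 0 <= gmass a 1 0 by rewrite addr_ge0 ?sqr_ge0.
apply: norm_le_of_sqr; first by rewrite mulr_ge0 ?sqrtr_ge0 ?powR_ge0.
rewrite (le_trans (kK_sqr_le x0 y0))//.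
rewrite (@le_trans _ _ (gmass a eps s))//.
  rewrite ler_piMr ?gmass_ge0// -expR0 ler_expR oppr_le0.
  apply: divr_ge0; first by apply: mulr_ge0; [exact: ltW|exact: sqr_ge0].
  by apply: mulr_ge0 => //; apply: addr_ge0; exact: sqr_ge0.
rewrite gmassE// exprMn sqr_sqrtr// ler_wpM2l// !powRN.
rewrite exprVn lef_pV2 ?posrE ?exprn_gt0 ?powR_gt0//; last first.
  by rewrite ltr_pwDl ?sqr_ge0// exprn_gt0.
have -> : (`|s| `^ ((1 + a) / 2)) ^+ 2 = (s ^+ 2) `^ ((1 + a) / 2).
  rewrite -[LHS]powR_mulrn ?powR_ge0// powRAC powR_mulrn//.
  by rewrite real_normK ?num_real.
rewrite ge0_ler_powR ?nnegrE ?sqr_ge0//.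
- by rewrite divr_ge0// addr_ge0.
- by rewrite addr_ge0 ?sqr_ge0.
- by rewrite lerDr sqr_ge0.
Qed.

Lemma kK_bnd (x y : R) : `|kK a eps s cos x y| <= Int (fun z => gauss eps z * w z).
Proof.
apply: le_norm_Int; last 2 first.
- exact: intg_gauss_wt.
- move=> z; rewrite normrM (ger0_norm (wt_ge0 a z)) ler_wpM2r ?wt_ge0//.
  rewrite normrM -[leRHS]mulr1 ler_pM//.
    by rewrite normrM (ger0_norm (gauss_ge0 eps z)) ler_piMr ?gauss_ge0// cos_abs.
  by rewrite normrM mulr_ile1// bj_le1.
- have := meas_jj a0 x y; have := @meas_gauss R eps; have := meas_wt a.
  by move=> ? ? ?; meas.
Qed.

Lemma meas_hk_kernel (g : R -> R) : intg (fun x => g x * w x) ->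
  measurable_fun setT (fun x => Int (fun y => g y * w y * kK a eps s cos x y)).
Proof.
move=> Ig; apply: (@meas_Int _ _ _ (fun z : R * R => g z.2 * w z.2 * kK a eps s cos z.1 z.2)
    (fun y => Int (fun z => gauss eps z * w z) * `|g y * w y|)).
- apply: measurable_funM; last exact: meas_kK.
  exact: (measurableT_comp (intg_meas Ig) measurable_snd).
- exact/intgZ/intg_norm.
- by move=> x y /=; rewrite normrM mulrC ler_wpM2r// kK_bnd.
Qed.

Lemma hform_L1 (f g : R -> R) : s != 0 ->
  intg (fun x => f x * w x) -> intg (fun x => g x * w x) ->
  `|hform eps s f g| <= disp * Int (fun x => `|f x * w x|) * Int (fun x => `|g x * w x|).
Proof.
move=> s0 If Ig; rewrite hform_kernel//.
have wK (g0 : R -> R) x y : 0 <= x -> `|g0 y * w y * kK a eps s cos x y| <= disp * `|g0 y * w y|.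
  move=> x0; rewrite normrM mulrC; have [y0|y0] := leP 0 y.
    by rewrite ler_wpM2r// kK_disp.
  by rewrite /wt /half (lt_gtF y0) !mulr0 normr0 !mulr0.
have mKx x : measurable_fun setT (fun y => kK a eps s cos x y).
  exact: (measurableT_comp meas_kK (pair1_measurable _)).
have T_le x : 0 <= x -> `|Int (fun y => g y * w y * kK a eps s cos x y)| <=
    disp * Int (fun x => `|g x * w x|).
  move=> x0; rewrite -IntZ; last exact: intg_norm.
  apply: le_norm_Int.
  - by apply: measurable_funM => //; exact: intg_meas.
  - exact/intgZ/intg_norm.
  - by move=> y; exact: wK.
set cg := Int (fun x => `|g x * w x|).
have -> : disp * Int (fun x => `|f x * w x|) * cg = Int (fun x => disp * cg * `|f x * w x|).
  by rewrite IntZ; [ring|exact: intg_norm].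
apply: le_norm_Int.
- apply: measurable_funM; first exact: intg_meas.
  exact: meas_hk_kernel.
- exact/intgZ/intg_norm.
- move=> x; rewrite normrM mulrC; have [x0|x0] := leP 0 x.
    by rewrite ler_wpM2r// T_le.
  by rewrite /wt /half (lt_gtF x0) !mulr0 normr0 !mulr0.
Qed.

End estimates.
Section L2.
Let m0 := gmass a 1 0.
Let b := (1 + a) / 2.

(** The product of the masses of the Gaussians of rates d and 1/(4d), in which d cancels
    ([gmass_dual]). *)
Definition schur : R := Num.sqrt (m0 ^+ 2 * 16^-1 `^ (- b)).

Lemma schur_ge0 : 0 <= schur. Proof. exact: sqrtr_ge0. Qed.

Lemma gmass_sqrt (eps : R) : Num.sqrt (gmass a eps 0) = Int (fun x => gauss eps x * w x).
Proof.
have -> : gmass a eps 0 = Int (fun x => gauss eps x * w x) ^+ 2.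
  rewrite /gmass /gint (eq_Int (g := fun x => gauss eps x * w x)); last first.
    by move=> z; rewrite mul0r cos0 !mulr1.
  rewrite [X in _ + X ^+ 2](eq_Int (g := fun=> 0)) ?Int0 ?expr0n ?addr0// => z.
  by rewrite mul0r sin0 mulr0 !mul0r.
by rewrite sqrtr_sqr ger0_norm// Int_ge0// => x; rewrite mulr_ge0 ?gauss_ge0 ?wt_ge0.
Qed.

Lemma gmass_dual (d : R) : 0 < d ->
  Num.sqrt (gmass a d 0) * Num.sqrt (gmass a (4 * d)^-1 0) = schur.
Proof.
move=> d0; have d40 : 0 < (4 * d)^-1 by rewrite invr_gt0 mulr_gt0.
rewrite -sqrtrM ?gmass_ge0// (gmassE a0 0 d0) (gmassE a0 0 d40) /schur.
have -> : (0 : R) ^+ 2 = 0 by rewrite expr0n.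
rewrite !addr0 -[gmass a 1 0]/m0 -[(1 + a) / 2]/b.
rewrite mulrACA -expr2 -powRM ?sqr_ge0//; congr (Num.sqrt (_ * _ `^ _)).
by field; rewrite gt_eqF.
Qed.

(** The transform of a Gaussian is the kernel for s = 0 at the point x = 0, where the energy bound
    has the factor e^{-xi^2/(2d)}, the square of a Gaussian of rate 1/(4d). *)
Lemma hk_gauss_le (d xi : R) : 0 < d -> 0 <= xi ->
  `|hk (gauss d) xi| <= Num.sqrt (gmass a d 0) * gauss (4 * d)^-1 xi.
Proof.
move=> d0 xi0.
have -> : hk (gauss d) xi = kK a d 0 cos 0 xi.
  apply: eq_Int => x; rewrite !mul0r cos0 bj0 mulr1 mul1r (mulrC x); ring.
apply: norm_le_of_sqr; first by rewrite mulr_ge0 ?sqrtr_ge0 ?gauss_ge0.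
rewrite (le_trans (kK_sqr_le 0 d0 (lexx 0) xi0))// exprMn sqr_sqrtr ?gmass_ge0//.
have -> : gauss (4 * d)^-1 xi ^+ 2 = expR (- (2 * ((4 * d)^-1 * xi ^+ 2))).
  by rewrite /gauss [LHS]expr2 -expRD; congr expR; ring.
rewrite ler_wpM2l ?gmass_ge0// ler_expR le_eqVlt; apply/orP; left; apply/eqP.
by field; rewrite gt_eqF.
Qed.

Variable eps : R.
Hypothesis e0 : 0 < eps.
Let K := kK a eps 0 cos.

(** Duality moves the transform onto the Gaussian of rate d. Bounding |bj| and the factor of rate
    eps by 1 leaves the mass at d times the mass at 1/(4d), which is [schur] whatever d is. *)
Lemma schur_trunc (x d : R) : 0 < d -> 0 <= x ->
  intg (fun y => gauss d y * (K x y * w y)) /\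
  Int (fun y => gauss d y * (K x y * w y)) <= schur.
Proof.
move=> d0 x0; have d40 : 0 < (4 * d)^-1 by rewrite invr_gt0 mulr_gt0.
have Ig := intg_gauss_wt d0 a0.
have mKx : measurable_fun setT (fun y => K x y).
  exact: (measurableT_comp (meas_kK 0 e0) (pair1_measurable _)).
split.
  have := intg_bounded mKx (fun y => kK_bnd 0 e0 x y) Ig.
  by apply: eq_intg => y; ring.
have mj : measurable_fun setT (fun xi : R => j (x * xi)) by apply: meas_bjM; meas.
have h2 := intg_cosw 0 e0 mj (fun xi => bj_le1 a0 _).
have -> : Int (fun y => gauss d y * (K x y * w y)) =
    Int (fun xi => (gauss eps xi * cos (0 * xi ^+ 2) * w xi * j (x * xi)) * hk (gauss d) xi).
  rewrite (hk_duality Ig h2); apply: eq_Int => y; rewrite mulrA [LHS]mulrAC; congr (_ * _).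
  by apply: eq_Int => xi; ring.
rewrite -(gmass_dual d0) (gmass_sqrt (4 * d)^-1) -IntZ; last exact: intg_gauss_wt.
apply: le_trans (ler_norm _) _; apply: le_norm_Int.
- apply: measurable_funM; first exact: intg_meas h2.
  exact: meas_hk.
- exact/intgZ/intg_gauss_wt.
- move=> xi; rewrite !normrM (ger0_norm (gauss_ge0 eps xi)) (ger0_norm (wt_ge0 a xi)).
  have [xi0|xi0] := leP 0 xi; last by rewrite /wt /half (lt_gtF xi0) !(mulr0, mul0r).
  have h := hk_gauss_le d0 xi0.
  have g1 : gauss eps xi <= 1.
    by rewrite -expR0 ler_expR oppr_le0 mulr_ge0 ?sqr_ge0// ltW.
  rewrite [leLHS](_ : _ = w xi *
    (gauss eps xi * (`|cos (0 * xi ^+ 2)| * `|j (x * xi)|) * `|hk (gauss d) xi|)); last by ring.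
  rewrite [leRHS](_ : _ = w xi * (Num.sqrt (gmass a d 0) * gauss (4 * d)^-1 xi)); last by ring.
  rewrite ler_wpM2l ?wt_ge0// -[leRHS]mul1r ler_pM// ?mulr_ge0 ?gauss_ge0//.
  by rewrite mulr_ile1 ?mulr_ge0 ?gauss_ge0// mulr_ile1// ?cos_abs ?bj_le1.
Qed.

Let Kw_ge0 (x y : R) : 0 <= x -> 0 <= K x y * w y.
Proof.
move=> x0; have [y0|y0] := leP 0 y; last by rewrite /wt /half (lt_gtF y0) mulr0.
by rewrite mulr_ge0 ?wt_ge0// kernel_ge0.
Qed.

Let mKw (x : R) : measurable_fun setT (fun y => K x y * w y).
Proof.
apply: measurable_funM; last exact: meas_wt.
exact: (measurableT_comp (meas_kK 0 e0) (pair1_measurable _)).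
Qed.

(** The truncation of rate d can be removed by monotone convergence because the kernel is
    nonnegative. *)
Lemma schur_int (x : R) : 0 <= x -> (\int[mu]_y (K x y * w y)%:E <= schur%:E)%E.
Proof.
move=> x0; apply: gauss_limit => //.
- by move=> y; exact: Kw_ge0.
- move=> d d0; have [i h] := schur_trunc d0 x0.
  by rewrite -EFin_Int ?lee_fin.
Qed.

Lemma kK_symm (x y : R) : K x y = K y x. Proof. exact: kK_sym. Qed.

Section quadratic.
Variable f : R -> R.
Hypothesis mf : measurable_fun setT f.
Hypothesis If : intg (fun x => f x * w x).
Hypothesis If2 : intg (fun x => f x ^+ 2 * w x).

Let f2w_ge0 (x : R) : 0 <= f x ^+ 2 * w x.
Proof. by rewrite mulr_ge0 ?sqr_ge0 ?wt_ge0. Qed.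

Let H (z : R * R) : R := f z.1 ^+ 2 * w z.1 * (K z.1 z.2 * w z.2).

Let H_ge0 z : 0 <= H z.
Proof.
rewrite /H; have [z0|z0] := leP 0 z.1; first by rewrite mulr_ge0// Kw_ge0.
by rewrite /wt /half (lt_gtF z0) !(mulr0, mul0r).
Qed.

Let mf1 : measurable_fun setT (fun z : R * R => f z.1).
Proof. exact: measurableT_comp. Qed.
Let mf2 : measurable_fun setT (fun z : R * R => f z.2).
Proof. exact: measurableT_comp. Qed.
Let mKz : measurable_fun setT (fun z : R * R => K z.1 z.2).
Proof. exact: meas_kK. Qed.

Let mH : measurable_fun setT H.
Proof. by rewrite /H; meas. Qed.

Let intH : (\int[mu]_x \int[mu]_y (H (x, y))%:E <=
  (schur * Int (fun x => f x ^+ 2 * w x))%:E)%E.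
Proof.
rewrite -IntZ// EFin_Int; last exact: intgZ.
apply: ge0_le_integral => //.
- by move=> x _; apply: integral_ge0 => y _; rewrite lee_fin.
- apply: (measurable_fun_fubini_tonelli_F (m2 := mu) (fun z : R * R => (H z)%:E)).
    exact/measurable_EFinP.
  by move=> z; rewrite lee_fin.
- by apply/measurable_EFinP; exact: intg_meas (intgZ _ If2).
- move=> x _; have [x0|x0] := leP 0 x; last first.
    have wx0 : w x = 0 by rewrite /wt /half (lt_gtF x0).
    under eq_integral do rewrite /H /= wx0 mulr0 mul0r.
    by rewrite integral0 wx0 !mulr0.
  rewrite /H /=; under eq_integral do rewrite EFinM.
  rewrite ge0_integralZl_EFin//; last 2 first.
  - by move=> y _; rewrite lee_fin Kw_ge0.
  - by apply/measurable_EFinP; exact: mKw.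
  by rewrite (mulrC schur) (EFinM (f x ^+ 2 * w x) schur); apply: lee_wpmul2l; [rewrite lee_fin|exact: schur_int].
Qed.

(** Schur's test: |f(x) f(y)| <= (f(x)^2 + f(y)^2)/2, and by symmetry of the kernel each half is
    controlled by the row bound [schur_int]. *)
Lemma hform_L2_diag : hform eps 0 f f <= schur * Int (fun x => f x ^+ 2 * w x).
Proof.
pose G (z : R * R) : R := `|f z.1| * w z.1 * (`|f z.2| * w z.2 * K z.1 z.2).
have mG : measurable_fun setT G by rewrite /G; meas.
have G_ge0 z : 0 <= G z.
  rewrite /G; have [z0|z0] := leP 0 z.1.
    rewrite (_ : `|f z.1| * w z.1 * (`|f z.2| * w z.2 * K z.1 z.2) =
      `|f z.1| * w z.1 * `|f z.2| * (K z.1 z.2 * w z.2)); last by ring.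
    apply: mulr_ge0; last exact: Kw_ge0.
    by rewrite !mulr_ge0 ?wt_ge0.
  by rewrite /wt /half (lt_gtF z0) !(mulr0, mul0r).
pose c := Int (fun z => gauss eps z * w z).
have GM x y : `|G (x, y)| <= (c * `|f x * w x|) * `|f y * w y|.
  rewrite /G /= !normrM !normr_id (mulrC c) -(mulrA _ c) ler_wpM2l ?mulr_ge0//.
  by rewrite mulrC ler_wpM2r ?mulr_ge0// kK_bnd.
have Ifa := intg_norm If.
apply: (@le_trans _ _ (Int (fun x => Int (fun y => G (x, y))))).
  rewrite hform_kernel//; apply: le_trans (ler_norm _) _.
  apply: le_norm_Int.
  - by apply: measurable_funM; [exact: intg_meas|exact: meas_hk_kernel].
  - exact: (Fubini_int1 mG (intgZ c Ifa) Ifa GM).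
  - move=> x; rewrite /G /=; have [x0|x0] := leP 0 x; last first.
      have wx0 : w x = 0 by rewrite /wt /half (lt_gtF x0).
      by rewrite {1}wx0 mulr0 mul0r normr0 Int_ge0// => y; exact: (G_ge0 (x, y)).
    have iy : intg (fun y => `|f y| * w y * K x y).
      have mKx : measurable_fun setT (fun y => K x y).
        exact: (measurableT_comp (meas_kK 0 e0) (pair1_measurable _)).
      have := intg_bounded mKx (fun y => kK_bnd 0 e0 x y) Ifa.
      by apply: eq_intg => y; rewrite normrM (ger0_norm (wt_ge0 a y)) mulrC.
    rewrite IntZ// normrM [`|f x * w x|]normrM (ger0_norm (wt_ge0 a x)).
    rewrite ler_wpM2l ?mulr_ge0 ?wt_ge0//; apply: le_norm_Int => //.
      apply: measurable_funM; first exact: intg_meas.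
      exact: (measurableT_comp (meas_kK 0 e0) (pair1_measurable _)).
    move=> y; have := Kw_ge0 y x0 => Kwy.
    rewrite -!mulrA (mulrC (w y)) !(normrM (f y)) ler_wpM2l//.
    by rewrite (ger0_norm Kwy).
rewrite -lee_fin (Fubini_Int_prod mG (intgZ c Ifa) Ifa GM).
pose H2 (z : R * R) := H (z.2, z.1).
have mH2 : measurable_fun setT H2.
  by apply: (measurableT_comp mH); exact: measurable_fun_pair.
have GH z : G z <= 2^-1 * (H z + H2 z).
  rewrite /G /H2 /H /= (kK_symm z.2 z.1).
  have [z10|z10] := leP 0 z.1; last by rewrite /wt /half (lt_gtF z10) !(mulr0, mul0r, addr0).
  have := Kw_ge0 z.2 z10 => Kwz.
  rewrite [leLHS](_ : _ = w z.1 * (K z.1 z.2 * w z.2) * (`|f z.1| * `|f z.2|)); last by ring.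
  rewrite [leRHS](_ : _ = w z.1 * (K z.1 z.2 * w z.2) * (2^-1 * (f z.1 ^+ 2 + f z.2 ^+ 2)));
    last by ring.
  apply: ler_wpM2l; first by apply: mulr_ge0 Kwz; exact: wt_ge0.
  rewrite -(real_normK (num_real (f z.1))) -(real_normK (num_real (f z.2))).
  have := sqr_ge0 (`|f z.1| - `|f z.2|); move: `|f z.1| `|f z.2| => u v; lra.
rewrite -(fubini_tonelli2 (m1 := mu) (m2 := mu) (fun z : R * R => (G z)%:E)); last 2 first.
- exact/measurable_EFinP.
- by move=> z; rewrite lee_fin.
apply: (@le_trans _ _ (\int[mu \x mu]_z (2^-1 * (H z + H2 z))%:E)%E).
  apply: ge0_le_integral => //.
  - by move=> z _; rewrite lee_fin.
  - exact/measurable_EFinP.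
  - by apply/measurable_EFinP; apply: measurable_funM => //; exact: measurable_funD.
  - by move=> z _; rewrite lee_fin.
have H2_ge0 z : 0 <= H2 z by exact: H_ge0.
under eq_integral do rewrite EFinM EFinD.
rewrite ge0_integralZl_EFin//; last 2 first.
- by move=> z _; rewrite adde_ge0 ?lee_fin.
- by apply: emeasurable_funD; exact/measurable_EFinP.
have side : (forall z, (0 <= (H z)%:E)%E) /\ (forall z, (0 <= (H2 z)%:E)%E).
  by split => z; rewrite lee_fin.
have mEH : measurable_fun setT (fun z => (H z)%:E) by exact/measurable_EFinP.
have mEH2 : measurable_fun setT (fun z => (H2 z)%:E) by exact/measurable_EFinP.
rewrite ge0_integralD//; try by [exact: mEH|exact: mEH2|move=> z _; exact: side.1|move=> z _; exact: side.2].
rewrite (fubini_tonelli1 (m1 := mu) (m2 := mu) _ mEH side.1).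
rewrite (fubini_tonelli2 (m1 := mu) (m2 := mu) _ mEH2 side.2).
apply: (@le_trans _ _ (2^-1%:E * ((schur * Int (fun x => f x ^+ 2 * w x))%:E +
  (schur * Int (fun x => f x ^+ 2 * w x))%:E))%E).
  by apply: lee_wpmul2l; [rewrite lee_fin invr_ge0|apply: leeD; exact: intH].
by rewrite -EFinD -EFinM lee_fin; lra.
Qed.

End quadratic.
End L2.
End HankelOperator.

(** * Double sums with geometric decay away from an antidiagonal *)

Section DiagonalSums.
Context {R : realType}.
Variable z : R.
Hypotheses (z0 : 0 < z) (z1 : z < 1).

Let up (i c m : nat) : (1 - z) * \sum_(k < m) (if (c <= i + k)%N then z ^+ (i + k - c) else 0)
  <= 1 - z ^+ (i + m - c).
Proof.
elim: m => [|m IH].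
  by rewrite big_ord0 mulr0 subr_ge0 exprn_ile1 ?ltW.
rewrite big_ord_recr/= mulrDr addnS; case: (leqP c (i + m)) => h.
  by rewrite subSn// exprS; move: IH; lra.
have e : ((i + m).+1 - c = 0)%N by apply/eqP; rewrite subn_eq0.
have e' : ((i + m) - c = 0)%N by apply/eqP; rewrite subn_eq0 ltnW.
by move: IH; rewrite e e' expr0 mulr0 addr0.
Qed.

Let dn (i c m : nat) : (1 - z) * \sum_(k < m) (if (c <= i + k)%N then 0 else z ^+ (c - (i + k)))
  <= z ^+ (c - (i + m)).
Proof.
elim: m => [|m IH]; first by rewrite big_ord0 mulr0 exprn_ge0// ltW.
rewrite big_ord_recr/= mulrDr addnS; case: (leqP c (i + m)) => h.
  have e : (c - (i + m).+1 = 0)%N by apply/eqP; rewrite subn_eq0 leqW.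
  have e' : (c - (i + m) = 0)%N by apply/eqP; rewrite subn_eq0.
  by move: IH; rewrite e e' expr0 mulr0 addr0.
have e : (c - (i + m) = (c - (i + m).+1).+1)%N by rewrite subnSK.
move: IH; rewrite e exprS; have := exprn_ge0 (c - (i + m).+1) (ltW z0).
move: (z ^+ _) (\sum_(_ < _) _) => u v; have := sqr_ge0 (1 - z); nra.
Qed.

(** With truncated subtraction the exponent is the distance |i + k - c|; the sum splits into two
    geometric series, each at most 1/(1-z). *)
Lemma diagonal_sum (i c m : nat) :
  \sum_(k < m) z ^+ ((i + k - c) + (c - (i + k))) <= 2 / (1 - z).
Proof.
rewrite ler_pdivlMr ?subr_gt0// mulrC.
have -> : \sum_(k < m) z ^+ ((i + k - c) + (c - (i + k))) =
    \sum_(k < m) (if (c <= i + k)%N then z ^+ (i + k - c) else 0)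
    + \sum_(k < m) (if (c <= i + k)%N then 0 else z ^+ (c - (i + k))).
  rewrite -big_split/=; apply: eq_bigr => k _; case: (leqP c (i + k)) => h.
    have e : (c - (i + k) = 0)%N by apply/eqP; rewrite subn_eq0.
    by rewrite e addn0 addr0.
  have e : (i + k - c = 0)%N by apply/eqP; rewrite subn_eq0 ltnW.
  by rewrite e add0n add0r.
have := up i c m; have := dn i c m.
have := exprn_ge0 (i + m - c) (ltW z0).
have : z ^+ (c - (i + m)) <= 1 by rewrite exprn_ile1 ?ltW.
rewrite mulrDr; lra.
Qed.

Lemma double_sum (N : nat) (C : R) (a b : nat -> R) (c : nat -> nat -> R) :
  0 <= C -> (forall i, 0 <= a i) -> (forall i, 0 <= b i) ->
  \sum_(i < (2 * N).+1) a i <= 1 -> \sum_(i < (2 * N).+1) b i <= 1 ->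
  (forall i k, (i <= 2 * N)%N -> (k <= 2 * N)%N ->
     `|c i k| <= C * (z ^+ ((i + k - 2 * N) + (2 * N - (i + k))) * (a i + b k))) ->
  `|\sum_(i < (2 * N).+1) \sum_(k < (2 * N).+1) c i k| <= C * (4 / (1 - z)).
Proof.
move=> C0 a0 b0 sa sb hc; set n := (2 * N).+1 in sa sb *.
rewrite (le_trans (ler_norm_sum _ _ _))//.
pose zz (i k : nat) := z ^+ ((i + k - 2 * N) + (2 * N - (i + k))).
have zz0 i k : 0 <= zz i k by rewrite exprn_ge0// ltW.
apply: (@le_trans _ _ (\sum_(i < n) \sum_(k < n) C * (zz i k * (a i + b k)))).
  apply: ler_sum => i _; rewrite (le_trans (ler_norm_sum _ _ _))//.
  by apply: ler_sum => k _; apply: hc; rewrite -ltnS.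
under eq_bigr do rewrite -mulr_sumr; rewrite -mulr_sumr ler_wpM2l//.
have -> : \sum_(i < n) \sum_(k < n) zz i k * (a i + b k) =
    \sum_(i < n) (a i * \sum_(k < n) zz i k) + \sum_(k < n) (b k * \sum_(i < n) zz k i).
  have -> : \sum_(k < n) (b k * \sum_(i < n) zz k i) =
      \sum_(i < n) \sum_(k < n) zz i k * b k.
    rewrite exchange_big/=; apply: eq_bigr => k _; rewrite mulr_sumr.
    by apply: eq_bigr => i _; rewrite mulrC /zz (addnC k i).
  rewrite -big_split/=; apply: eq_bigr => i _; rewrite mulr_sumr -big_split/=.
  by apply: eq_bigr => k _; rewrite mulrDr [zz i k * a i]mulrC.
have c0 : 0 <= 2 / (1 - z) by rewrite divr_ge0// subr_ge0 ltW.
have main (e : nat -> R) : (forall i, 0 <= e i) -> \sum_(i < n) e i <= 1 ->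
    \sum_(i < n) (e i * \sum_(k < n) zz i k) <= 2 / (1 - z).
  move=> e0 se; apply: (@le_trans _ _ (\sum_(i < n) (e i * (2 / (1 - z))))).
    by apply: ler_sum => i _; rewrite ler_wpM2l//; exact: diagonal_sum.
  by rewrite -mulr_suml ler_piMl.
have -> : 4 / (1 - z) = 2 / (1 - z) + 2 / (1 - z) by rewrite -mulrDl; congr (_ / _); ring.
by apply: lerD; apply: main.
Qed.

End DiagonalSums.

(** * Decomposition of a function by the size of its values *)

Section Pieces.
Context {R : realType}.
Variables (w : R -> R) (f : R -> R) (th : nat -> R) (p : R).
Hypothesis th0 : forall n, 0 < th n.
Hypothesis thS : forall n, th n <= th n.+1.
Hypotheses (p1 : 1 < p) (p2 : p < 2).
Hypothesis mf : measurable_fun setT f.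
Hypothesis Ifw : intg (fun x => f x * w x).
Hypothesis w0 : forall x, 0 <= w x.
Variable M : R.
Hypothesis fM : forall x, `|f x| <= M.

(** Lower thresholds are the upper ones shifted by one; piece 0 starts at 0 and collects all small
    values. *)
Definition cutoff (i : nat) : R := if i is i'.+1 then th i' else 0.
Definition piece (i : nat) (x : R) : R :=
  if (cutoff i <= `|f x|) && (`|f x| < th i) then f x else 0.

Let cutS i : cutoff i <= th i.
Proof. by case: i => [|i] /=; [exact: ltW|exact: thS]. Qed.

Lemma sum_piece n x : \sum_(i < n) piece i x = if `|f x| < cutoff n then f x else 0.
Proof.
elim: n => [|n IH]; first by rewrite big_ord0/= ltNge normr_ge0.
rewrite big_ord_recr/= {}IH /piece; have := cutS n.
case: (ltP `|f x| (cutoff n)) => h c.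
  by rewrite /= addr0 (lt_le_trans h c).
by rewrite add0r.
Qed.

Let p0 : p != 0. Proof. by rewrite gt_eqF// (lt_trans _ p1). Qed.

Lemma sum_piece_pow n x : \sum_(i < n) `|piece i x| `^ p <= `|f x| `^ p.
Proof.
suff -> : \sum_(i < n) `|piece i x| `^ p = if `|f x| < cutoff n then `|f x| `^ p else 0.
  by case: ifP => // _; exact: powR_ge0.
elim: n => [|n IH]; first by rewrite big_ord0/= ltNge normr_ge0.
rewrite big_ord_recr/= {}IH /piece; have := cutS n.
case: (ltP `|f x| (cutoff n)) => h c.
  by rewrite /= normr0 powR0// addr0 (lt_le_trans h c).
by rewrite add0r /=; case: ifP => _; rewrite ?normr0 ?powR0.
Qed.

Lemma meas_piece i : measurable_fun setT (piece i).
Proof. by rewrite /piece; meas. Qed.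

Lemma piece_le i x : `|piece i x| <= `|f x|.
Proof. by rewrite /piece; case: ifP => // _; rewrite normr0. Qed.

Lemma intg_piece i : intg (fun x => piece i x * w x).
Proof.
have h : measurable_fun setT (fun x => if (cutoff i <= `|f x|) && (`|f x| < th i) then 1 else 0 : R) by meas.
have := @intg_bounded R 1 _ _ h _ Ifw.
move=> H; apply: eq_intg (H _) => x; rewrite /piece; case: ifP => _; rewrite ?mul1r ?mul0r//.
  by rewrite normr1.
by rewrite normr0.
Qed.

Lemma intg_pow (g : R -> R) (q : R) : 1 <= q -> measurable_fun setT g -> measurable_fun setT w ->
  (forall x, `|g x| <= M) -> intg (fun x => g x * w x) -> intg (fun x => `|g x| `^ q * w x).
Proof.
move=> q1 mg mw gM Ig.
apply: (intg_le _ _ (intgZ (M `^ (q - 1)) (intg_norm Ig))); first by meas.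
move=> x; rewrite normrM (ger0_norm (powR_ge0 _ _)) normrM mulrA ler_wpM2r//.
have g0 := normr_ge0 (g x).
have -> : `|g x| `^ q = `|g x| `^ (q - 1) * `|g x|.
  have [->|gn] := eqVneq `|g x| 0.
    by rewrite powR0 ?mulr0// gt_eqF// (lt_le_trans ltr01).
  by rewrite -[X in _ * X]powRr1// -powRD ?gn ?implybT// subrK.
rewrite ler_wpM2r// ge0_ler_powR ?nnegrE ?subr_ge0//.
exact: le_trans (gM x).
Qed.

(** The upper threshold bounds |f|^{2-p}, since 2 - p > 0. *)
Lemma piece_L2 i x : piece i x ^+ 2 <= th i `^ (2 - p) * `|piece i x| `^ p.
Proof.
rewrite /piece; case: ifP => [/andP[_ h]|_]; last first.
  by rewrite expr0n/= normr0 powR0// mulr0.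
rewrite -(real_normK (num_real (f x))); have g0 := normr_ge0 (f x).
have [->|gn] := eqVneq `|f x| 0; first by rewrite expr0n/= mulr_ge0 ?powR_ge0.
have -> : `|f x| ^+ 2 = `|f x| `^ (2 - p) * `|f x| `^ p.
  by rewrite -powRD ?gn ?implybT// subrK powR_mulrn.
by rewrite ler_wpM2r ?powR_ge0// ge0_ler_powR ?nnegrE ?subr_ge0 ?(ltW p2) ?(ltW h) ?(ltW (th0 i)).
Qed.

(** The lower threshold bounds |f|^{1-p}, since 1 - p < 0. Piece 0 has no positive lower threshold,
    hence the successor index. *)
Lemma piece_L1 i x : `|piece i.+1 x| <= th i `^ (1 - p) * `|piece i.+1 x| `^ p.
Proof.
rewrite /piece /=; case: ifP => [/andP[h _]|_]; last by rewrite normr0 powR0// mulr0.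
have g0 : 0 < `|f x| by exact: lt_le_trans h.
have e : `|f x| = `|f x| `^ (1 - p) * `|f x| `^ p.
  by rewrite -powRD ?(gt_eqF g0) ?implybT// subrK powRr1// ltW.
rewrite {1}e ler_wpM2r ?powR_ge0//.
rewrite -opprB !powRN lef_pV2 ?posrE ?powR_gt0//.
by rewrite ge0_ler_powR ?nnegrE ?subr_ge0 ?(ltW p1) ?(ltW (th0 i)) ?(ltW g0).
Qed.

End Pieces.

Lemma pair_L2 {R : realType} (S b F G t1 t2 A1 A2 c : R) : 0 <= S -> 0 <= c ->
  0 <= A1 -> 0 <= A2 -> 0 <= F -> 0 <= G -> t1 * t2 = c ^+ 2 ->
  b ^+ 2 <= (S * F) * (S * G) -> F <= t1 * A1 -> G <= t2 * A2 ->
  `|b| <= S * c * (A1 + A2).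
Proof.
move=> S0 c0 A10 A20 F0 G0 tc hb hF hG.
apply: norm_le_of_sqr; first by rewrite !mulr_ge0// addr_ge0.
apply: (le_trans hb); apply: (@le_trans _ _ ((S * (t1 * A1)) * (S * (t2 * A2)))).
  by rewrite ler_pM ?mulr_ge0 ?ler_wpM2l.
have -> : S * (t1 * A1) * (S * (t2 * A2)) = (S * c) ^+ 2 * (A1 * A2).
  by rewrite exprMn -tc; ring.
by rewrite [leRHS]exprMn ler_wpM2l ?sqr_ge0//; nra.
Qed.

Lemma pair_L1 {R : realType} (D b F G t1 t2 A1 A2 c : R) : 0 <= D -> 0 <= c ->
  0 <= A1 <= 1 -> 0 <= A2 <= 1 -> 0 <= F -> 0 <= G -> D * (t1 * t2) <= c ->
  `|b| <= D * F * G -> F <= t1 * A1 -> G <= t2 * A2 ->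
  `|b| <= c * (A1 + A2).
Proof.
move=> D0 c0 /andP[A10 A11] /andP[A20 A21] F0 G0 tc hb hF hG.
apply: (le_trans hb); apply: (@le_trans _ _ (D * ((t1 * A1) * (t2 * A2)))).
  by rewrite -mulrA ler_wpM2l// ler_pM.
have -> : D * (t1 * A1 * (t2 * A2)) = D * (t1 * t2) * (A1 * A2) by ring.
apply: (@le_trans _ _ (c * (A1 * A2))); first by rewrite ler_wpM2r ?mulr_ge0.
by rewrite ler_wpM2l//; nra.
Qed.

(** * Real interpolation of a bilinear form between L^1 and L^2 *)

Section Interpolation.
Context {R : realType}.
Variables (w : R -> R) (B : (R -> R) -> (R -> R) -> R) (D S p : R).
Hypotheses (mw : measurable_fun setT w) (w0 : forall x, 0 <= w x).
Hypotheses (D0 : 0 < D) (S0 : 1 <= S) (p1 : 1 < p) (p2 : p < 2).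

(** A class stable under linear combinations and under cutting into level pieces; boundedness makes
    the decomposition finite and the p-th and second powers integrable. *)
Definition bounded_L1 (f : R -> R) : Prop :=
  [/\ measurable_fun setT f, intg (fun x => f x * w x) & exists M, forall x, `|f x| <= M].

Hypothesis BDl : forall f f' g, bounded_L1 f -> bounded_L1 f' -> bounded_L1 g ->
  B (fun x => f x + f' x) g = B f g + B f' g.
Hypothesis BDr : forall f g g', bounded_L1 f -> bounded_L1 g -> bounded_L1 g' ->
  B f (fun x => g x + g' x) = B f g + B f g'.
Hypothesis BZl : forall c f g, bounded_L1 f -> bounded_L1 g -> B (fun x => c * f x) g = c * B f g.
Hypothesis BZr : forall c f g, bounded_L1 f -> bounded_L1 g -> B f (fun x => c * g x) = c * B f g.
Hypothesis BL1 : forall f g, bounded_L1 f -> bounded_L1 g ->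
  `|B f g| <= D * Int (fun x => `|f x * w x|) * Int (fun x => `|g x * w x|).
Hypothesis BL2 : forall f g, bounded_L1 f -> bounded_L1 g ->
  B f g ^+ 2 <= (S * Int (fun x => f x ^+ 2 * w x)) * (S * Int (fun x => g x ^+ 2 * w x)).

Lemma bounded_L1_Z c f : bounded_L1 f -> bounded_L1 (fun x => c * f x).
Proof.
move=> [mf If [M fM]]; split; first by meas.
  by apply: eq_intg (intgZ c If) => x; rewrite mulrA.
by exists (`|c| * M) => x; rewrite normrM ler_wpM2l.
Qed.

Lemma bounded_L1_0 : bounded_L1 (fun=> 0).
Proof.
split; first exact: measurable_cst.
  by apply: eq_intg intg0 => x; rewrite mul0r.
by exists 0 => x; rewrite normr0.
Qed.

Lemma bounded_L1_D f g : bounded_L1 f -> bounded_L1 g -> bounded_L1 (fun x => f x + g x).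
Proof.
move=> [mf If [M fM]] [mg Ig [N gN]]; split; first by meas.
  by apply: eq_intg (intgD If Ig) => x; rewrite mulrDl.
by exists (M + N) => x; rewrite (le_trans (ler_normD _ _))// lerD.
Qed.

Lemma bounded_L1_sum n (f : nat -> R -> R) : (forall i, bounded_L1 (f i)) ->
  bounded_L1 (fun x => \sum_(i < n) f i x).
Proof.
move=> bf; elim: n => [|n IH].
  have -> : (fun x : R => \sum_(i < 0) f i x) = (fun=> 0).
    by apply/funext => x; rewrite big_ord0.
  exact: bounded_L1_0.
have -> : (fun x : R => \sum_(i < n.+1) f i x) = (fun x => \sum_(i < n) f i x + f n x).
  by apply/funext => x; rewrite big_ord_recr.
exact: bounded_L1_D.
Qed.

Lemma B_suml n (f : nat -> R -> R) g : (forall i, bounded_L1 (f i)) -> bounded_L1 g ->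
  B (fun x => \sum_(i < n) f i x) g = \sum_(i < n) B (f i) g.
Proof.
move=> bf bg; elim: n => [|n IH].
  have -> : (fun x : R => \sum_(i < 0) f i x) = (fun x => 0 * 0).
    by apply/funext => x; rewrite big_ord0 mul0r.
  by rewrite big_ord0 (BZl 0 bounded_L1_0 bg) mul0r.
have -> : (fun x : R => \sum_(i < n.+1) f i x) = (fun x => \sum_(i < n) f i x + f n x).
  by apply/funext => x; rewrite big_ord_recr.
by rewrite BDl ?IH ?big_ord_recr//; exact: bounded_L1_sum.
Qed.

Lemma B_sumr n (g : nat -> R -> R) f : (forall i, bounded_L1 (g i)) -> bounded_L1 f ->
  B f (fun x => \sum_(i < n) g i x) = \sum_(i < n) B f (g i).
Proof.
move=> bg bf; elim: n => [|n IH].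
  have -> : (fun x : R => \sum_(i < 0) g i x) = (fun x => 0 * 0).
    by apply/funext => x; rewrite big_ord0 mul0r.
  by rewrite big_ord0 (BZr 0 bf bounded_L1_0) mul0r.
have -> : (fun x : R => \sum_(i < n.+1) g i x) = (fun x => \sum_(i < n) g i x + g n x).
  by apply/funext => x; rewrite big_ord_recr.
by rewrite BDr ?IH ?big_ord_recr//; exact: bounded_L1_sum.
Qed.

(** The larger of the decay ratios supplied by the L^1 bound and the L^2 bound; both are below 1 as
    1 < p < 2. *)
Let zr : R := Num.max (2 `^ (1 - p)) (2^-1 `^ ((2 - p) / 2)).

Let zr0 : 0 < zr. Proof. by rewrite lt_max powR_gt0. Qed.

Let half0 : 0 < 2^-1 :> R. Proof. by rewrite invr_gt0. Qed.

Let powR_lt1 (x c : R) : 0 < x -> x < 1 -> 0 < c -> x `^ c < 1.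
Proof.
move=> x0 x1 c0; have := gt0_ltr_powR c0 (x := x) (y := 1).
by rewrite !nnegrE ler01 (ltW x0) powR1; exact.
Qed.

Let zr1 : zr < 1.
Proof.
rewrite gt_max; apply/andP; split.
- rewrite -opprB powRN invf_lt1 ?powR_gt0//.
  have := gt0_ltr_powR (r := p - 1) _ (x := 1) (y := 2).
  by rewrite subr_gt0 !nnegrE powR1 => /(_ p1); apply; rewrite ?ler01 ?ltr1n.
- apply: powR_lt1 => //; last by rewrite divr_gt0// subr_gt0.
  by rewrite invf_lt1// ltr1n.
Qed.

Let powRXn (x c : R) (e : nat) : 0 <= x -> (x ^+ e) `^ c = (x `^ c) ^+ e.
Proof. by move=> x0; rewrite -[x ^+ e]powR_mulrn// powRAC powR_mulrn// powR_ge0. Qed.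

(** The level at which the two bounds balance: D (h^2)^{1-p} and h^{2-p} have the common value
    D^{2/p-1}. *)
Let h : R := D `^ p^-1.
Let h0 : 0 < h. Proof. exact: powR_gt0. Qed.
Let L : R := D `^ (2 / p - 1).
Let L0 : 0 < L. Proof. exact: powR_gt0. Qed.
Let pn0 : p != 0. Proof. by rewrite gt_eqF// (lt_trans _ p1). Qed.

Let hL2 : h `^ (2 - p) = L.
Proof. by rewrite /h /L -powRrM; congr (_ `^ _); field. Qed.

Let hL1 : D * (h ^+ 2) `^ (1 - p) = L.
Proof.
rewrite -powR_mulrn ?powR_ge0// /h -!powRrM -{1}[D]powRr1 ?(ltW D0)//.
rewrite -powRD ?(gt_eqF D0) ?implybT// /L; congr (_ `^ _); by field.
Qed.

Section pieces.
Variables (f g : R -> R) (N : nat) (M : R).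
Hypotheses (bf : bounded_L1 f) (bg : bounded_L1 g).
Hypotheses (fM : forall x, `|f x| <= M) (gM : forall x, `|g x| <= M).
Hypothesis MN : M < h * 2 ^+ N.
Hypotheses (If1 : Int (fun x => `|f x| `^ p * w x) <= 1).
Hypotheses (Ig1 : Int (fun x => `|g x| `^ p * w x) <= 1).

Let th (i : nat) : R := h * (2 ^+ i / 2 ^+ N).
Let th0 i : 0 < th i. Proof. by rewrite mulr_gt0// divr_gt0 ?exprn_gt0. Qed.
Let thS i : th i <= th i.+1.
Proof.
rewrite ler_pM2l// ler_pM2r ?invr_gt0 ?exprn_gt0//.
by rewrite exprS ler_peMl ?exprn_ge0// ler1n.
Qed.

Let pc (f0 : R -> R) := piece f0 th.
Let A (f0 : R -> R) (i : nat) : R := Int (fun x => `|pc f0 i x| `^ p * w x).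

Section one.
Variable f0 : R -> R.
Hypothesis bf0 : bounded_L1 f0.
Hypothesis f0M : forall x, `|f0 x| <= M.
Hypothesis If01 : Int (fun x => `|f0 x| `^ p * w x) <= 1.

Let mf0 : measurable_fun setT f0. Proof. by case: bf0. Qed.
Let If0 : intg (fun x => f0 x * w x). Proof. by case: bf0. Qed.

Let b_pc i : bounded_L1 (pc f0 i).
Proof.
split; [exact: meas_piece|exact: intg_piece|exists M => x].
exact: le_trans (piece_le _ _ _ _) (f0M x).
Qed.

Let pcM i x : `|pc f0 i x| <= M. Proof. exact: le_trans (piece_le _ _ _ _) (f0M x). Qed.

Let iA i : intg (fun x => `|pc f0 i x| `^ p * w x).
Proof.
have [m1 i1 _] := b_pc i.
exact: (intg_pow (ltW p1) m1 mw (pcM i) i1).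
Qed.

Let A_ge0 i : 0 <= A f0 i.
Proof. by apply: Int_ge0 => x; rewrite mulr_ge0 ?powR_ge0. Qed.

Let sumA n : \sum_(i < n) A f0 i <= 1.
Proof.
have [S1 iS] : \sum_(i < n) A f0 i = Int (fun x => \sum_(i < n) (`|pc f0 i x| `^ p * w x)) /\
    intg (fun x => \sum_(i < n) (`|pc f0 i x| `^ p * w x)).
  elim: n => [|n [IH1 IH2]].
    have -> : (fun x => \sum_(i < 0) (`|pc f0 i x| `^ p * w x)) = (fun=> 0).
      by apply/funext => x; rewrite big_ord0.
    by rewrite big_ord0 Int0; split => //; exact: intg0.
  have -> : (fun x => \sum_(i < n.+1) (`|pc f0 i x| `^ p * w x)) =
      (fun x => \sum_(i < n) (`|pc f0 i x| `^ p * w x) + `|pc f0 n x| `^ p * w x).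
    by apply/funext => x; rewrite big_ord_recr.
  by rewrite big_ord_recr/= IH1 IntD//; split => //; exact: intgD.
rewrite S1 (le_trans _ If01)//; apply: le_Int => //.
  exact: (intg_pow (ltW p1) mf0 mw f0M If0).
by move=> x; rewrite -mulr_suml ler_wpM2r// sum_piece_pow.
Qed.

Let A_le1 i : A f0 i <= 1.
Proof.
apply: le_trans (sumA i.+1); rewrite big_ord_recr/= lerDr.
by apply: sumr_ge0 => j _.
Qed.

Let pc_sum : f0 = (fun x => \sum_(i < (2 * N).+1) pc f0 i x).
Proof.
apply/funext => x; rewrite /pc sum_piece//=.
rewrite (le_lt_trans (f0M x))// (lt_le_trans MN)// /th ler_pM2l//.
by rewrite mul2n -addnn exprD mulfK// gt_eqF// exprn_gt0.
Qed.

Let i2 i : intg (fun x => pc f0 i x ^+ 2 * w x).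
Proof.
have [m1 i1 _] := b_pc i.
have := intg_pow (q := 2) _ m1 mw (pcM i) i1; rewrite ler1n => /(_ isT).
by apply: eq_intg => x; rewrite (powR_mulrn 2) ?real_normK ?num_real.
Qed.

Let A_L2 i : Int (fun x => pc f0 i x ^+ 2 * w x) <= th i `^ (2 - p) * A f0 i.
Proof.
rewrite -IntZ//; apply: le_Int => //; first exact: intgZ.
by move=> x; rewrite mulrA ler_wpM2r// piece_L2.
Qed.

Let A_L1 i : Int (fun x => `|pc f0 i.+1 x * w x|) <= th i `^ (1 - p) * A f0 i.+1.
Proof.
have [m1 i1 _] := b_pc i.+1.
rewrite -IntZ//; apply: le_Int; [exact: intg_norm|exact: intgZ|].
by move=> x; rewrite normrM (ger0_norm (w0 x)) mulrA ler_wpM2r// piece_L1.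
Qed.

Lemma piece_facts : [/\ forall i, bounded_L1 (pc f0 i), forall i, 0 <= A f0 i <= 1,
  forall n, \sum_(i < n) A f0 i <= 1, f0 = (fun x => \sum_(i < (2 * N).+1) pc f0 i x) &
  (forall i, Int (fun x => pc f0 i x ^+ 2 * w x) <= th i `^ (2 - p) * A f0 i) /\
  (forall i, Int (fun x => `|pc f0 i.+1 x * w x|) <= th i `^ (1 - p) * A f0 i.+1)].
Proof. by split=> // i; rewrite A_ge0 A_le1. Qed.

End one.

Let zr_e e : (2^-1 ^+ e) `^ ((2 - p) / 2) <= zr ^+ e.
Proof.
rewrite powRXn ?(ltW half0)// lerXn2r ?nnegrE ?powR_ge0 ?(ltW zr0)//.
by rewrite le_max lexx orbT.
Qed.

Let zr_e' e : (2 ^+ e) `^ (1 - p) <= zr ^+ e.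
Proof.
rewrite powRXn// lerXn2r ?nnegrE ?powR_ge0 ?(ltW zr0)//.
by rewrite le_max lexx.
Qed.

(** Since th i th k = h^2 2^{i+k-2N}, the L^2 bound is used for i + k <= 2N and the L^1 bound
    beyond; each decays geometrically away from i + k = 2N. In the second case neither index can be
    0, so [piece_L1] covers both pieces. *)
Let pair_le i k : (i <= 2 * N)%N -> (k <= 2 * N)%N ->
  `|B (pc f i) (pc g k)| <=
  4 * S * L * (zr ^+ ((i + k - 2 * N) + (2 * N - (i + k))) * (A f i + A g k)).
Proof.
move=> iN kN; have S00 : 0 <= S by exact: le_trans S0.
have F2 f0 n : 0 <= Int (fun x => pc f0 n x ^+ 2 * w x).
  by apply: Int_ge0 => x; apply: mulr_ge0; [exact: sqr_ge0|exact: w0].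
have F1 f0 n : 0 <= Int (fun x => `|pc f0 n x * w x|).
  by apply: Int_ge0 => x; exact: normr_ge0.
have [bpf /(_ i)/andP[Af0 Af1] _ _ [f2 f1]] := piece_facts bf fM If1.
have [bpg /(_ k)/andP[Ag0 Ag1] _ _ [g2 g1]] := piece_facts bg gM Ig1.
case: (leqP (i + k) (2 * N)) => ik.
- have e0 : (i + k - 2 * N = 0)%N by apply/eqP; rewrite subn_eq0.
  rewrite e0 add0n; set e := (2 * N - (i + k))%N.
  have thth : th i * th k = h ^+ 2 * 2^-1 ^+ e.
    have -> : th i * th k = h ^+ 2 * (2 ^+ (i + k) / 2 ^+ (2 * N)).
      by rewrite /th mul2n -addnn !exprD; field; rewrite ?expf_neq0.
    rewrite -(subnK ik) -/e !exprD exprVn; congr (_ * _).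
    by field; rewrite ?expf_neq0.
  have sq : (th i * th k) `^ (2 - p) = (L * (2^-1 ^+ e) `^ ((2 - p) / 2)) ^+ 2.
    rewrite thth powRM ?sqr_ge0 ?exprn_ge0// exprMn -hL2; congr (_ * _).
      by rewrite powRXn// ltW.
    rewrite -[RHS]powR_mulrn ?powR_ge0// -powRrM; congr (_ `^ _); by field.
  have c0 : 0 <= L * (2^-1 ^+ e) `^ ((2 - p) / 2) by rewrite mulr_ge0 ?powR_ge0// ltW.
  rewrite powRM ?(ltW (th0 _))// in sq.
  have := pair_L2 S00 c0 Af0 Ag0 (F2 f i) (F2 g k) sq (BL2 (bpf i) (bpg k)) (f2 i) (g2 k).
  move: (`|B _ _|) (A f i) (A g k) Af0 Ag0 => b A1 A2 A10 A20 hb.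
  apply: (le_trans hb); have := zr_e e; move: (_ `^ _) (zr ^+ e) (powR_ge0 (2^-1 ^+ e) ((2 - p) / 2)) => c1 c2 c10 c12.
  rewrite [leRHS](_ : _ = 4 * (S * (L * c2) * (A1 + A2))); last by ring.
  apply: (@le_trans _ _ (S * (L * c2) * (A1 + A2))).
    by rewrite ler_wpM2r ?addr_ge0// ler_wpM2l// ler_wpM2l// ltW.
  rewrite ler_peMl ?ler1n// mulr_ge0 ?addr_ge0// mulr_ge0// mulr_ge0 ?(ltW L0)//.
  exact: le_trans c12.
- have e0 : (2 * N - (i + k) = 0)%N by apply/eqP; rewrite subn_eq0 ltnW.
  rewrite e0 addn0; set e := (i + k - 2 * N)%N.
  case: i => [|i] in iN ik Af0 Af1 e0 e *.
    by move: ik; rewrite add0n ltnNge kN.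
  case: k => [|k] in kN ik Ag0 Ag1 e0 e *.
    by move: ik; rewrite addn0 ltnNge iN.
  have thth : th i * th k = h ^+ 2 * (2 ^+ e * 4^-1).
    have -> : th i * th k = h ^+ 2 * (2 ^+ (i.+1 + k.+1) / 2 ^+ (2 * N) * 4^-1).
      rewrite /th mul2n -addnn addSn addnS !exprS !exprD; field.
      by rewrite ?expf_neq0.
    rewrite -(subnK (ltnW ik)) -/e exprD mulfK// expf_neq0//.
  (* The quarter comes from using the lower thresholds of pieces i+1 and k+1, each half of the upper
     one; it costs 4^{p-1}. *)
  have q4 : 4^-1 `^ (1 - p) <= 4 :> R.
    rewrite -[4^-1]powR_inv1// -powRrM.
    have -> : -1 * (1 - p) = p - 1 by ring.
    rewrite -[leRHS]powRr1// ler_powR ?ler1n//.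
    by rewrite lerBlDr; exact: (ltW p2).
  have tc : D * (th i `^ (1 - p) * th k `^ (1 - p)) <= 4 * L * zr ^+ e.
    rewrite -powRM ?(ltW (th0 _))// thth powRM ?sqr_ge0 ?mulr_ge0 ?exprn_ge0 ?invr_ge0//.
    rewrite mulrA hL1 powRM ?exprn_ge0 ?invr_ge0//.
    rewrite (mulrC 4 L) -mulrA ler_wpM2l ?(ltW L0)// mulrC ler_pM ?powR_ge0//.
  have c0 : 0 <= 4 * L * zr ^+ e by rewrite !mulr_ge0 ?exprn_ge0 ?(ltW L0) ?(ltW zr0).
  have A1 : 0 <= A f i.+1 <= 1 by rewrite Af0 Af1.
  have A2 : 0 <= A g k.+1 <= 1 by rewrite Ag0 Ag1.
  have hb := pair_L1 (ltW D0) c0 A1 A2 (F1 f i.+1) (F1 g k.+1) tc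
    (BL1 (bpf i.+1) (bpg k.+1)) (f1 i) (g1 k).
  move: (`|B _ _|) (A f i.+1) (A g k.+1) Af0 Ag0 hb => b u v u0 v0 hb.
  apply: (le_trans hb).
  rewrite [leRHS](_ : _ = S * (4 * L * zr ^+ e * (u + v))); last by ring.
  by rewrite ler_peMl// mulr_ge0// addr_ge0.
Qed.

Lemma interp_pieces : `|B f g| <= 16 * S / (1 - zr) * L.
Proof.
have [bpf fA fsA fE _] := piece_facts bf fM If1.
have [bpg gA gsA gE _] := piece_facts bg gM Ig1.
have S00 : 0 <= S by exact: le_trans S0.
have -> : B f g = \sum_(i < (2 * N).+1) \sum_(k < (2 * N).+1) B (pc f i) (pc g k).
  rewrite {1}fE B_suml//; apply: eq_bigr => i _.
  by rewrite {1}gE B_sumr.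
have -> : 16 * S / (1 - zr) * L = 4 * S * L * (4 / (1 - zr)).
  by field; rewrite gt_eqF// subr_gt0.
apply: (double_sum zr0 zr1 _ _ _ (fsA _) (gsA _) pair_le) => [|i|i].
- by rewrite !mulr_ge0 ?(ltW L0).
- by have /andP[] := fA i.
- by have /andP[] := gA i.
Qed.

End pieces.

Definition interp_const : R := 16 * S / (1 - zr).

Lemma interp_const_ge0 : 0 <= interp_const.
Proof.
have S00 : 0 <= S by exact: le_trans S0.
by rewrite divr_ge0 ?mulr_ge0 ?subr_ge0 ?(ltW zr1).
Qed.

(** By bilinearity f and g are normalised to unit p-th integral; the double sum over level pieces
    then has total weight at most 1 in each index, so [double_sum] applies. *)
Lemma interpolation (f g : R -> R) (u v : R) : bounded_L1 f -> bounded_L1 g ->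
  0 < u -> 0 < v ->
  Int (fun x => `|f x| `^ p * w x) <= u `^ p -> Int (fun x => `|g x| `^ p * w x) <= v `^ p ->
  `|B f g| <= interp_const * L * (u * v).
Proof.
move=> bf bg u0 v0 fu gv.
have unit_case (f0 : R -> R) (c : R) : bounded_L1 f0 -> 0 < c ->
    Int (fun x => `|f0 x| `^ p * w x) <= c `^ p ->
    Int (fun x => `|c^-1 * f0 x| `^ p * w x) <= 1.
  move=> [m0 i0 [M0 h0']] c0 hc.
  have I0 := intg_pow (ltW p1) m0 mw h0' i0.
  rewrite (eq_Int (g := fun x => (c `^ p)^-1 * (`|f0 x| `^ p * w x))); last first.
    move=> x; rewrite normrM powRM// normfV (gtr0_norm c0) [RHS]mulrA; congr (_ * _ * _).
    by rewrite -[c^-1]powR_inv1 ?(ltW c0)// powRAC powR_inv1 ?powR_ge0.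
  by rewrite IntZ// mulrC ler_pdivrMr ?mul1r ?powR_gt0.
have b1 := bounded_L1_Z u^-1 bf; have b2 := bounded_L1_Z v^-1 bg.
have [_ _ [M1 h1]] := b1; have [_ _ [M2 h2]] := b2.
pose M := Num.max M1 M2.
have [N MN] : exists N : nat, M < h * 2 ^+ N.
  (* N exceeds M/h and 2^N > N, so the top threshold h 2^N lies above all values of both
     functions. *)
  exists (Num.bound (M / h)); rewrite -ltr_pdivrMl// mulrC.
  rewrite (lt_le_trans (unstable.ltr_bound _))// -natrX ler_nat ltnW//.
  exact: ltn_expl.
have := @interp_pieces _ _ N M b1 b2 _ _ MN (unit_case f u bf u0 fu) (unit_case g v bg v0 gv).
have hh1 x : `|u^-1 * f x| <= M by rewrite le_max h1.
have hh2 x : `|v^-1 * g x| <= M by rewrite le_max h2 orbT.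
move=> /(_ hh1 hh2).
rewrite (BZl _ bf b2) (BZr _ bf bg) !normrM !normfV (gtr0_norm u0) (gtr0_norm v0).
rewrite ler_pdivrMl// ler_pdivrMl// => hB; apply: le_trans hB _.
by rewrite /interp_const le_eqVlt; apply/orP; left; apply/eqP; ring.
Qed.

End Interpolation.

(** * The dispersive estimate *)

Section Dispersive.
Context {R : realType}.
Variable a : R.
Hypothesis a0 : 0 <= a.
Local Notation w := (wt a).
Local Notation bL1 := (bounded_L1 w).

Lemma hkD (f g : R -> R) : intg (fun x => f x * w x) -> intg (fun x => g x * w x) ->
  hk a (fun x => f x + g x) = (fun xi => hk a f xi + hk a g xi).
Proof.
move=> If Ig; apply/funext => xi; rewrite /hk -IntD.
- by apply: eq_Int => x; ring.
- exact: intg_hk.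
- exact: intg_hk.
Qed.

Lemma hkZ (c : R) (f : R -> R) : intg (fun x => f x * w x) ->
  hk a (fun x => c * f x) = (fun xi => c * hk a f xi).
Proof.
move=> If; apply/funext => xi; rewrite /hk -IntZ; last exact: intg_hk.
by apply: eq_Int => x; ring.
Qed.

Section fixed.
Variables (eps s : R).
Hypothesis e0 : 0 < eps.

Lemma hk_prod_bnd (f g : R -> R) : bL1 f -> bL1 g -> exists A, forall x : R, 0 < x ->
  `|hk a f x * hk a g x| <= A * (1 + x ^+ 2).
Proof.
move=> [_ If _] [_ Ig _].
exists (Int (fun x => `|f x * w x|) * Int (fun x => `|g x * w x|)) => x _.
have h : `|hk a f x * hk a g x| <= Int (fun x => `|f x * w x|) * Int (fun x => `|g x * w x|).
  by rewrite normrM ler_pM// hk_le.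
rewrite (le_trans h)// ler_peMr ?lerDl ?sqr_ge0// mulr_ge0 ?Int_ge0//.
Qed.

Lemma meas_hk_prod (f g : R -> R) : bL1 f -> bL1 g ->
  measurable_fun setT (fun x => hk a f x * hk a g x).
Proof. by move=> [_ If _] [_ Ig _]; apply: measurable_funM; exact: meas_hk. Qed.

Lemma hform_sym (f g : R -> R) : hform a eps s f g = hform a eps s g f.
Proof. by apply: eq_Int => x; rewrite (mulrC (hk a f x)). Qed.

Lemma hformDl (f f' g : R -> R) : bL1 f -> bL1 f' -> bL1 g ->
  hform a eps s (fun x => f x + f' x) g = hform a eps s f g + hform a eps s f' g.
Proof.
move=> bf bf' bg; have [A hA] := hk_prod_bnd bf bg; have [A' hA'] := hk_prod_bnd bf' bg.
rewrite /hform -(gintD a0 s e0 (@trig_cos R) (meas_hk_prod bf bg) (meas_hk_prod bf' bg) hA hA').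
by apply: eq_gint => x _; rewrite hkD ?mulrDl//; [case: bf|case: bf'].
Qed.

Lemma hformZl (c : R) (f g : R -> R) : bL1 f -> bL1 g ->
  hform a eps s (fun x => c * f x) g = c * hform a eps s f g.
Proof.
move=> bf bg; have [A hA] := hk_prod_bnd bf bg.
rewrite /hform -(gintZ a0 s e0 c (@trig_cos R) (meas_hk_prod bf bg) hA).
by apply: eq_gint => x _; rewrite hkZ ?mulrA//; case: bf.
Qed.

Lemma bounded_L1_sqr (f : R -> R) : bL1 f -> intg (fun x => f x ^+ 2 * w x).
Proof.
move=> [mf If [M fM]]; apply: eq_intg (intg_bounded mf fM If) => x.
by rewrite mulrA expr2.
Qed.

(** As |cos| <= 1, Cauchy-Schwarz in xi reduces to the diagonal forms at s = 0, which
    [hform_L2_diag] bounds. *)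
Lemma hform_L2 (f g : R -> R) : bL1 f -> bL1 g -> hform a eps s f g ^+ 2 <=
  (schur a * Int (fun x => f x ^+ 2 * w x)) * (schur a * Int (fun x => g x ^+ 2 * w x)).
Proof.
move=> bf bg.
have Q (f0 : R -> R) : bL1 f0 -> 0 <= hform a eps 0 f0 f0 <= schur a * Int (fun x => f0 x ^+ 2 * w x).
  move=> b0; apply/andP; split.
    apply: Int_ge0 => x; rewrite mul0r cos0 mulr1.
    by rewrite mulr_ge0 ?wt_ge0// mulr_ge0 ?gauss_ge0// -expr2 sqr_ge0.
  have I2 := bounded_L1_sqr b0.
  by case: b0 => m0 i0 _; exact: hform_L2_diag.
have /andP[Qf0 Qf] := Q f bf; have /andP[Qg0 Qg] := Q g bg.
apply: (@le_trans _ _ (hform a eps 0 f f * hform a eps 0 g g)); last exact: ler_pM.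
apply: cauchy_schwarz_discr => // k k0.
have i0 (f0 g0 : R -> R) (t : R) : bL1 f0 -> bL1 g0 ->
    intg (fun x => gauss eps x * cos (t * x ^+ 2) * (hk a f0 x * hk a g0 x) * w x).
  move=> b1 b2; have [A hA] := hk_prod_bnd b1 b2.
  exact: (intg_gint a0 t e0 (@trig_cos R).1 (@trig_cos R).2 (meas_hk_prod b1 b2) hA).
have i1 := i0 f f 0 bf bf; have i2 := i0 g g 0 bg bg.
rewrite /hform /gint -(IntZ (k ^+ 2) i1) -(IntD (intgZ _ i1) i2).
have k20 : 0 <= 2 * k by rewrite mulr_ge0// ltW.
rewrite -(ger0_norm k20) -normrM -(IntZ (2 * k) (i0 f g s bf bg)).
apply: le_norm_Int.
- exact: intg_meas (intgZ _ (i0 f g s bf bg)).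
- exact: intgD (intgZ _ i1) i2.
- move=> x; rewrite mul0r cos0 !normrM (ger0_norm (gauss_ge0 eps x)) (ger0_norm (wt_ge0 a x)).
  rewrite ger0_norm// (gtr0_norm k0).
  have h1 := gauss_ge0 eps x; have h2 := wt_ge0 a x; have h3 := cos_abs (s * x ^+ 2).
  have -> : k ^+ 2 * (gauss eps x * 1 * (hk a f x * hk a f x) * w x) +
      gauss eps x * 1 * (hk a g x * hk a g x) * w x =
      gauss eps x * w x * (k ^+ 2 * `|hk a f x| ^+ 2 + `|hk a g x| ^+ 2).
    by rewrite !real_normK ?num_real//; ring.
  move: (`|hk a f x|) (`|hk a g x|) (normr_ge0 (hk a f x)) (normr_ge0 (hk a g x)) => u v u0 v0.
  move: (`|cos _|) h3 (normr_ge0 (cos (s * x ^+ 2))) => c c1 c0.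
  rewrite [leLHS](_ : _ = gauss eps x * w x * (c * (2 * k * u * v))); last by ring.
  rewrite ler_wpM2l ?mulr_ge0//.
  apply: (@le_trans _ _ (2 * k * u * v)); first by rewrite ler_piMl// !mulr_ge0// ltW.
  rewrite -subr_ge0; have -> : k ^+ 2 * u ^+ 2 + v ^+ 2 - 2 * k * u * v = (k * u - v) ^+ 2 by ring.
  exact: sqr_ge0.
Qed.

End fixed.

(** Interpolation with L^1 constant D of order |s|^{-(1+a)/2} and an L^2 constant free of s and eps
    gives D^{2/p-1}. The added units ensure 1 <= S, 0 < D and 0 < C. *)
Lemma hform_dispersive (p : R) : 1 < p -> p < 2 -> exists2 C : R, 0 < C &
  forall (eps s u v : R) (f g : R -> R), 0 < eps -> s != 0 -> bL1 f -> bL1 g -> 0 < u -> 0 < v ->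
    Int (fun x => `|f x| `^ p * w x) <= u `^ p -> Int (fun x => `|g x| `^ p * w x) <= v `^ p ->
    `|hform a eps s f g| <= C * `|s| `^ (- ((1 + a) / 2 * (2 / p - 1))) * (u * v).
Proof.
move=> p1 p2.
have S1 : 1 <= schur a + 1 by rewrite lerDr schur_ge0.
pose c := Num.sqrt (gmass a 1 0) + 1.
have c0 : 0 < c by rewrite ltr_wpDl// sqrtr_ge0.
pose C := interp_const (schur a + 1) p * c `^ (2 / p - 1).
have C0 : 0 <= C by rewrite mulr_ge0 ?powR_ge0 ?interp_const_ge0.
exists (C + 1); first by rewrite ltr_wpDl.
move=> eps s u v f g e0 s0 bf bg u0 v0 fu gv.
have s0' : 0 < `|s| by rewrite normr_gt0.
pose D := c * `|s| `^ (- ((1 + a) / 2)).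
have D0 : 0 < D by rewrite mulr_gt0// powR_gt0.
have dD : disp a s <= D by rewrite /disp /D ler_wpM2r ?powR_ge0// lerDl.
have w0 := @wt_ge0 R a; have mw := meas_wt a.
apply: (@le_trans _ _ (interp_const (schur a + 1) p * D `^ (2 / p - 1) * (u * v))).
  apply: (@interpolation R w (hform a eps s) D (schur a + 1) p) => //.
  - by move=> *; exact: hformDl.
  - move=> f0 g0 g1 b0 b1 b2; rewrite hform_sym (hformDl s e0 b1 b2 b0).
    by rewrite (hform_sym eps s g0 f0) (hform_sym eps s g1 f0).
  - by move=> *; exact: hformZl.
  - by move=> k f0 g0 b0 b1; rewrite hform_sym (hformZl s e0 k b1 b0) (hform_sym eps s g0 f0).
  - move=> f0 g0 [_ i1 _] [_ i2 _]; rewrite (le_trans (hform_L1 a0 e0 s0 i1 i2))//.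
    by apply: ler_wpM2r; [exact: Int_ge0|apply: ler_wpM2r => //; exact: Int_ge0].
  - move=> f0 g0 b1 b2; rewrite (le_trans (hform_L2 s e0 b1 b2))//.
    have F0 (f1 : R -> R) : 0 <= Int (fun x => f1 x ^+ 2 * w x).
      by apply: Int_ge0 => x; rewrite mulr_ge0 ?sqr_ge0.
    by rewrite ler_pM ?mulr_ge0 ?schur_ge0// ler_wpM2r ?lerDl.
have -> : D `^ (2 / p - 1) = c `^ (2 / p - 1) * `|s| `^ (- ((1 + a) / 2 * (2 / p - 1))).
  by rewrite powRM ?powR_ge0 ?(ltW c0)// -powRrM mulNr.
rewrite (mulrA (interp_const _ _)) -/C.
apply: ler_wpM2r; first by rewrite mulr_ge0 ?ltW.
by apply: ler_wpM2r; [exact: powR_ge0|rewrite lerDl].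
Qed.

End Dispersive.

(** * The one-dimensional Hardy-Littlewood-Sobolev inequality on the diagonal *)

Section HLS.
Context {R : realType}.
Notation mu := (@lebesgue_measure R).
Variable lam : R.
Hypotheses (l0 : 0 < lam) (l1 : lam < 1).

Let p : R := 2 / (2 - lam).
Let lam2 : 0 < 2 - lam. Proof. by rewrite subr_gt0 (lt_trans l1)// ltr1n. Qed.
Let p1 : 1 < p. Proof. by rewrite /p ltr_pdivlMr// mul1r gtrBl. Qed.
Let p0 : 0 < p. Proof. exact: lt_trans p1. Qed.

Let restr (A : set R) (f : R -> R) : R -> R := f \_ A.

Let int_restr (A : set R) f :
  (\int[mu]_s (restr A f s)%:E = \int[mu]_(s in A) (f s)%:E)%E.
Proof.
by rewrite [RHS]integral_mkcond; apply: eq_integral => x _; rewrite restrict_EFin.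
Qed.

Let restr_ge0 (A : set R) f (s : R) : (A s -> 0 <= f s) -> 0 <= restr A f s.
Proof. by rewrite /restr patchE => h; case: ifPn => //; rewrite inE => /h. Qed.

Let restr_in (A : set R) f (s : R) : A s -> restr A f s = f s.
Proof. by move=> h; rewrite /restr patchE mem_set. Qed.

Let meas_restr (A : set R) f : measurable A -> measurable_fun A f ->
  measurable_fun setT (restr A f).
Proof. by move=> mA mf; apply/(measurable_restrictT _ mA). Qed.

Section fixed_t.
Variables (t r : R).
Hypothesis r0 : 0 < r.

Let A1 : set R := `]t, (t + r)[%classic.
Let A2 : set R := `](t - r), t[%classic.
(** Starting at distance r/2 lets the open half-lines contain the points with |t - s| = r; each far
    integral is then at most 2. *)
Let A3 : set R := `](t + r / 2), +oo[%classic.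
Let A4 : set R := `]-oo, (t - r / 2)[%classic.
Let f1 (s : R) : R := (s - t) `^ (- lam).
Let f2 (s : R) : R := (t - s) `^ (- lam).
Let f3 (s : R) : R := r * `|t - s| `^ (- 2).

Let mf1 : measurable_fun setT f1. Proof. by rewrite /f1; meas. Qed.
Let mf2 : measurable_fun setT f2. Proof. by rewrite /f2; meas. Qed.
Let mf3 : measurable_fun setT f3. Proof. by rewrite /f3; meas. Qed.

Let c1 : R := r `^ (1 - lam) / (1 - lam).

Let onel : 0 < 1 - lam. Proof. by rewrite subr_gt0. Qed.

Let pow_le (u : R) : 0 < u -> u < r -> 0 <= u `^ (1 - lam) / (1 - lam) <= c1.
Proof.
move=> u0 ur; rewrite divr_ge0 ?powR_ge0 ?(ltW onel)//=.
rewrite ler_pM2r ?invr_gt0// ge0_ler_powR ?nnegrE ?(ltW onel) ?(ltW u0) ?(ltW r0)//.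
exact: ltW.
Qed.

Let i1 : (\int[mu]_s (restr A1 f1 s)%:E <= c1%:E)%E.
Proof.
rewrite int_restr.
have d (x : R) : t < x < t + r -> is_derive x 1 (fun s => (s - t) `^ (1 - lam) / (1 - lam)) (f1 x).
  move=> /andP[tx _]; have xt0 : 0 < x - t by rewrite subr_gt0.
  have h := dercomp (g := fun s => s - t) (is_derive1_powR (1 - lam) xt0) (derB (derI x) (derC t x)).
  apply: (is_derive_ext (derM h (derC (1 - lam)^-1 x))) => //.
  rewrite subr0 !mulr1 mulr0 addr0 /f1 (_ : 1 - lam - 1 = - lam); last by ring.
  by field; rewrite gt_eqF.
apply: (@FTC_le_oo R f1 _ t (t + r) c1 _ d).
- by rewrite ltrDl.
- move=> x /andP[tx _]; have xt0 : 0 < x - t by rewrite subr_gt0.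
  exact: der_continuous (dercomp (g := fun s => s - t) (is_derive1_powR (- lam) xt0)
    (derB (derI x) (derC t x))).
- by move=> x _; exact: powR_ge0.
- move=> x y tx xy yr.
  have /andP[h _] : 0 <= (x - t) `^ (1 - lam) / (1 - lam) <= c1 by apply: pow_le; lra.
  have /andP[_ h'] : 0 <= (y - t) `^ (1 - lam) / (1 - lam) <= c1 by apply: pow_le; lra.
  by move: h h'; move: (_ / _) (_ / _) c1 => u v z; lra.
Qed.

Let i2 : (\int[mu]_s (restr A2 f2 s)%:E <= c1%:E)%E.
Proof.
rewrite int_restr.
have d (x : R) : t - r < x < t -> is_derive x 1 (fun s => - ((t - s) `^ (1 - lam) / (1 - lam))) (f2 x).
  move=> /andP[_ tx]; have xt0 : 0 < t - x by rewrite subr_gt0.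
  have h := dercomp (g := fun s => t - s) (is_derive1_powR (1 - lam) xt0) (derB (derC t x) (derI x)).
  apply: (is_derive_ext (derN (derM h (derC (1 - lam)^-1 x)))) => //.
  rewrite sub0r mulr0 addr0 /f2 (_ : 1 - lam - 1 = - lam); last by ring.
  by field; rewrite gt_eqF.
apply: (@FTC_le_oo R f2 _ (t - r) t c1 _ d).
- by rewrite gtrBl.
- move=> x /andP[_ tx]; have xt0 : 0 < t - x by rewrite subr_gt0.
  exact: der_continuous (dercomp (g := fun s => t - s) (is_derive1_powR (- lam) xt0)
    (derB (derC t x) (derI x))).
- by move=> x _; exact: powR_ge0.
- move=> x y tx xy yr.
  have /andP[_ h] : 0 <= (t - x) `^ (1 - lam) / (1 - lam) <= c1 by apply: pow_le; lra.
  have /andP[h' _] : 0 <= (t - y) `^ (1 - lam) / (1 - lam) <= c1 by apply: pow_le; lra.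
  by move: h h'; move: (_ / _) (_ / _) c1 => u v z; lra.
Qed.

Let r2 : 0 < r / 2. Proof. by rewrite divr_gt0. Qed.

Let inv_le (u : R) : r / 2 < u -> 0 <= r / u <= 2.
Proof.
move=> ru; have u0 : 0 < u by exact: lt_trans ru.
rewrite divr_ge0 ?(ltW r0) ?(ltW u0)//= ler_pdivrMr// mulrC -ler_pdivrMr//; exact: ltW.
Qed.

Let i3 : (\int[mu]_s (restr A3 f3 s)%:E <= 2%:E)%E.
Proof.
rewrite int_restr.
have d (x : R) : t + r / 2 < x -> is_derive x 1 (fun s => - (r * (s - t) `^ (- 1))) (f3 x).
  move=> tx; have xt0 : 0 < x - t by rewrite subr_gt0 (lt_trans _ tx)// ltrDl.
  have h := dercomp (g := fun s => s - t) (is_derive1_powR (- 1) xt0) (derB (derI x) (derC t x)).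
  apply: (is_derive_ext (derN (derZ r h))) => //.
  rewrite /f3 distrC (gtr0_norm xt0) (_ : -1 - 1 = - 2); last by ring.
  by rewrite subr0 mulr1; ring.
apply: (@FTC_le_oy R f3 _ _ d).
- move=> x tx; have xt0 : 0 < x - t by rewrite subr_gt0 (lt_trans _ tx)// ltrDl.
  have h : {for x, continuous (fun s => r * (s - t) `^ (- 2))}.
    exact: der_continuous (derZ r (dercomp (g := fun s => s - t) (is_derive1_powR (- 2) xt0)
      (derB (derI x) (derC t x)))).
  rewrite /prop_for /continuous_at /f3 distrC (gtr0_norm xt0).
  apply: cvg_trans h; apply: near_eq_cvg; near=> y.
  rewrite distrC gtr0_norm// subr_gt0; near: y; apply: lt_nbhsr.
  by rewrite -subr_gt0.
- by move=> x _; rewrite mulr_ge0 ?powR_ge0 ?(ltW r0).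
- move=> x y tx xy.
  have x0 : r / 2 < x - t by move: tx; rewrite -ltrBrDl.
  have y0 : r / 2 < y - t by apply: (lt_trans x0); rewrite ltrD2r.
  rewrite !powR_inv1 ?(ltW (lt_trans r2 _))//.
  have /andP[_ h] := inv_le x0; have /andP[h' _] := inv_le y0.
  by move: h h'; move: (_ / _) (_ / _) => u v; lra.
Unshelve. all: by end_near. Qed.

Let i4 : (\int[mu]_s (restr A4 f3 s)%:E <= 2%:E)%E.
Proof.
rewrite int_restr.
have d (x : R) : x < t - r / 2 -> is_derive x 1 (fun s => r * (t - s) `^ (- 1)) (f3 x).
  move=> tx; have xt0 : 0 < t - x by rewrite subr_gt0 (lt_trans tx)// gtrBl.
  have h := dercomp (g := fun s => t - s) (is_derive1_powR (- 1) xt0) (derB (derC t x) (derI x)).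
  apply: (is_derive_ext (derZ r h)) => //.
  rewrite /f3 (gtr0_norm xt0) (_ : -1 - 1 = - 2); last by ring.
  by rewrite sub0r; ring.
apply: (@FTC_le_Nyo R f3 _ _ _ d).
- move=> x tx; have xt0 : 0 < t - x by rewrite subr_gt0 (lt_trans tx)// gtrBl.
  have h : {for x, continuous (fun s => r * (t - s) `^ (- 2))}.
    exact: der_continuous (derZ r (dercomp (g := fun s => t - s) (is_derive1_powR (- 2) xt0)
      (derB (derC t x) (derI x)))).
  rewrite /prop_for /continuous_at /f3 (gtr0_norm xt0).
  apply: cvg_trans h; apply: near_eq_cvg; near=> y.
  rewrite gtr0_norm// subr_gt0; near: y; apply: lt_nbhsl.
  by rewrite -subr_gt0.
- by move=> x _; rewrite mulr_ge0 ?powR_ge0 ?(ltW r0).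
- move=> x y xy ty.
  have y0 : r / 2 < t - y by move: ty; rewrite ltrBrDl -ltrBrDr.
  have x0 : r / 2 < t - x by apply: (lt_trans y0); rewrite ltrD2l ltrN2.
  rewrite !powR_inv1 ?(ltW (lt_trans r2 _))//.
  have /andP[_ h] := inv_le y0; have /andP[h' _] := inv_le x0.
  by move: h h'; move: (_ / _) (_ / _) => u v; lra.
Unshelve. all: by end_near. Qed.

Lemma near_far_kernel : exists nf : (R -> R) * (R -> R),
  [/\ measurable_fun setT nf.1 /\ measurable_fun setT nf.2,
      (forall s, 0 <= nf.1 s) /\ (forall s, 0 <= nf.2 s),
      (\int[mu]_s (nf.1 s)%:E <= (2 * r `^ (1 - lam) / (1 - lam))%:E)%E,
      (\int[mu]_s (nf.2 s)%:E <= 4%:E)%E &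
      forall s, (`|t - s| < r -> `|t - s| `^ (- lam) <= nf.1 s) /\
                (r <= `|t - s| -> r * `|t - s| `^ (- 2) <= nf.2 s)].
Proof.
have m1 : measurable_fun setT (restr A1 f1) by apply: meas_restr; [exact: measurable_itv|exact: (measurable_funTS mf1)].
have m2 : measurable_fun setT (restr A2 f2) by apply: meas_restr; [exact: measurable_itv|exact: (measurable_funTS mf2)].
have m3 : measurable_fun setT (restr A3 f3) by apply: meas_restr; [exact: measurable_itv|exact: (measurable_funTS mf3)].
have m4 : measurable_fun setT (restr A4 f3) by apply: meas_restr; [exact: measurable_itv|exact: (measurable_funTS mf3)].
have g1 s : 0 <= restr A1 f1 s by apply: restr_ge0 => _; exact: powR_ge0.
have g2 s : 0 <= restr A2 f2 s by apply: restr_ge0 => _; exact: powR_ge0.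
have f3_ge0 s : 0 <= f3 s by rewrite mulr_ge0 ?powR_ge0 ?(ltW r0).
have g3 s : 0 <= restr A3 f3 s by exact: restr_ge0.
have g4 s : 0 <= restr A4 f3 s by exact: restr_ge0.
have iD (f g : R -> R) : measurable_fun setT f -> measurable_fun setT g ->
    (forall s, 0 <= f s) -> (forall s, 0 <= g s) ->
    (\int[mu]_s (f s + g s)%:E = \int[mu]_s (f s)%:E + \int[mu]_s (g s)%:E)%E.
  move=> mf mg f0 g0; under eq_integral do rewrite EFinD.
  rewrite ge0_integralD//; try by [move=> x _; rewrite lee_fin|exact/measurable_EFinP].
exists ((fun s => restr A1 f1 s + restr A2 f2 s), (fun s => restr A3 f3 s + restr A4 f3 s)).
split => /=.
- by split; exact: measurable_funD.
- by split => s; rewrite addr_ge0.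
- rewrite iD//; apply: (le_trans (leeD i1 i2)).
  by rewrite -EFinD lee_fin /c1 -mulrDl -mulr2n mulr_natl.
- rewrite iD//; apply: (le_trans (leeD i3 i4)).
  by rewrite -EFinD lee_fin -natrD.
- move=> s; split => h.
  + have [ts|ts|ts] := ltgtP t s.
    * have e : `|t - s| = s - t by rewrite distrC gtr0_norm ?subr_gt0.
      rewrite e -/(f1 s) -(@restr_in A1 f1 s) ?lerDl//.
      by rewrite /A1 /= in_itv/= ts/= -ltrBlDl -e.
    * have e : `|t - s| = t - s by rewrite gtr0_norm ?subr_gt0.
      rewrite e -/(f2 s) -(@restr_in A2 f2 s) ?lerDr//.
      by rewrite /A2 /= in_itv/= ts andbT ltrBlDl -ltrBlDr -e.
    (* At s = t the kernel is 0 to a nonzero power, which is 0 by convention. *)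
    * by rewrite ts subrr normr0 powR0 ?addr_ge0// oppr_eq0 gt_eqF.
  + rewrite -/(f3 s); have [ts|ts] := leP t s.
    * have e : `|t - s| = s - t by rewrite distrC ger0_norm ?subr_ge0.
      rewrite -(@restr_in A3 f3 s) ?lerDl//.
      rewrite /A3 /= in_itv/= andbT -ltrBrDl -e (lt_le_trans _ h)//.
      by rewrite gtr_pMr// invf_lt1// ltr1n.
    * have e : `|t - s| = t - s by rewrite gtr0_norm ?subr_gt0.
      rewrite -(@restr_in A4 f3 s) ?lerDr//.
      rewrite /A4 /= in_itv/= ltrBrDl -ltrBrDr -e (lt_le_trans _ h)//.
      by rewrite gtr_pMr// invf_lt1// ltr1n.
Qed.

End fixed_t.

Section upper.
Variable phi : R -> R.
Hypotheses (mphi : measurable_fun setT phi) (phi0 : forall t, 0 <= phi t).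
Hypothesis phi1 : (\int[mu]_t (phi t `^ p)%:E <= 1)%E.

(** By symmetry the region phi(s) <= phi(t) carries the integral up to a factor 2, and there phi(s)
    can be bounded by phi(t). *)
Let H (z : R * R) : R :=
  if phi z.2 <= phi z.1 then phi z.1 * phi z.2 * `|z.1 - z.2| `^ (- lam) else 0.

Let H_ge0 z : 0 <= H z.
Proof. by rewrite /H; case: ifP => // _; rewrite !mulr_ge0 ?powR_ge0. Qed.

Let mH : measurable_fun setT H.
Proof.
have m1 : measurable_fun setT (fun z : R * R => phi z.1) by exact: measurableT_comp.
have m2 : measurable_fun setT (fun z : R * R => phi z.2) by exact: measurableT_comp.
by rewrite /H; meas.
Qed.

Let onel : 0 < 1 - lam. Proof. by rewrite subr_gt0. Qed.

Let C1 : R := 2 / (1 - lam) + 5.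

Let C10 : 0 <= C1. Proof. by rewrite addr_ge0// divr_ge0// ltW. Qed.

(** With h = phi(t), split at distance r = h^{-p}. Near t, phi(s) <= h and h r^{1-lam} = h^{p-1}.
    Far from t, Young's inequality with conjugate exponents p and 2/lam is applied to phi(s) and
    r^{lam/2} |t-s|^{-lam}, whose power 2/lam is r |t-s|^{-2}. The near part contributes 2/(1-lam)
    and the far part 1 + 4. *)
Let inner t : (\int[mu]_s (H (t, s))%:E <= (C1 * phi t `^ p)%:E)%E.
Proof.
have [h0|hn] := eqVneq (phi t) 0.
  rewrite h0 powR0 ?mulr0 ?gt_eqF// (eq_integral (fun=> 0%E)) ?integral0// => s _.
  by rewrite /H /= h0; case: ifP => // _; rewrite !mul0r.
have h0 : 0 < phi t by rewrite lt_neqAle eq_sym hn phi0.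
set h := phi t in h0 *; pose r := h `^ (- p).
have r0 : 0 < r by exact: powR_gt0.
have [[nf ff] /= [[m1 m2] [n0 f0] I1 I2 nfP]] := near_far_kernel t r0.
have lamn : 2 - lam != 0 by rewrite gt_eqF.
have e1 : h * r `^ (1 - lam) = h `^ (p - 1).
  rewrite /r -powRrM -{1}[h]powRr1 ?(ltW h0)// -powRD ?(gt_eqF h0) ?implybT//.
  by congr (_ `^ _); rewrite /p; field.
have e2 : r `^ (- (lam / 2)) = h `^ (p - 1).
  by rewrite /r -powRrM; congr (_ `^ _); rewrite /p; field.
have e3 : h * h `^ (p - 1) = h `^ p.
  by rewrite -{1}[h]powRr1 ?(ltW h0)// -powRD ?(gt_eqF h0) ?implybT// addrC subrK.
have mph : measurable_fun setT (fun s => phi s `^ p) by meas.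
pose g s := h * (h * nf s + h `^ (p - 1) * (phi s `^ p + ff s)).
have mg : measurable_fun setT g by rewrite /g; meas.
have Hg s : H (t, s) <= g s.
  rewrite /H /=; case: ifP => hs; last first.
    by rewrite /g mulr_ge0 ?(ltW h0)// addr_ge0// mulr_ge0 ?(ltW h0) ?powR_ge0 ?addr_ge0 ?powR_ge0.
  rewrite -mulrA /g -/h ler_pM2l//; have [n1 f1] := nfP s.
  have [ts|ts] := ltP `|t - s| r.
    apply: (@le_trans _ _ (h * nf s)).
      by rewrite ler_pM ?powR_ge0// n1.
    by rewrite lerDl mulr_ge0 ?powR_ge0// addr_ge0 ?powR_ge0.
  apply: (@le_trans _ _ (h `^ (p - 1) * (phi s `^ p + ff s))); last first.
    by rewrite lerDr mulr_ge0// ltW.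
  have ts0 : 0 < `|t - s| by exact: lt_le_trans ts.
  pose y := r `^ (lam / 2) * `|t - s| `^ (- lam).
  have -> : phi s * `|t - s| `^ (- lam) = h `^ (p - 1) * (phi s * y).
    have e4 : h `^ (p - 1) * r `^ (lam / 2) = 1.
      by rewrite -e2 powRN mulVf// gt_eqF// powR_gt0.
    rewrite [RHS](_ : _ = phi s * `|t - s| `^ (- lam) * (h `^ (p - 1) * r `^ (lam / 2))).
      by rewrite e4 mulr1.
    by rewrite /y; ring.
  rewrite ler_wpM2l ?powR_ge0//.
  have y0 : 0 <= y by rewrite mulr_ge0 ?powR_ge0.
  have q0 : 0 < 2 / lam by rewrite divr_gt0.
  have conj : p^-1 + (2 / lam)^-1 = 1 by rewrite /p; field; rewrite gt_eqF.
  apply: le_trans (conjugate_powR (phi0 s) y0 p0 q0 conj) _.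
  have y2 : y `^ (2 / lam) <= ff s.
    apply: le_trans (f1 ts); rewrite /y powRM ?powR_ge0// -!powRrM.
    rewrite (_ : lam / 2 * (2 / lam) = 1); last by field; rewrite gt_eqF.
    rewrite (_ : - lam * (2 / lam) = - 2); last by field; rewrite gt_eqF.
    by rewrite mulr1.
  apply: lerD.
    by rewrite ler_piMr ?powR_ge0// invf_le1// ltW.
  apply: le_trans y2; rewrite ler_piMr ?powR_ge0// invf_le1//.
  by rewrite ler_pdivlMr// mul1r (le_trans (ltW l1))// ler1n.
have If1 := ge0_intgP m1 n0 I1; have If2 := ge0_intgP m2 f0 I2.
have Iph := ge0_intgP mph (fun s => powR_ge0 (phi s) p) phi1.
have Ig : intg g.
  by apply/intgZ/intgD; [exact: intgZ If1.1|apply/intgZ/intgD; [exact: Iph.1|exact: If2.1]].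
apply: (@le_trans _ _ (Int g)%:E).
  rewrite EFin_Int//; apply: ge0_eInt_le => //.
  by apply: (measurableT_comp mH); exact: pair1_measurable.
rewrite lee_fin /g IntZ; last first.
  by apply: intgD; [exact: intgZ If1.1|apply/intgZ/intgD; [exact: Iph.1|exact: If2.1]].
rewrite IntD; last 2 first.
- exact: intgZ If1.1.
- by apply/intgZ/intgD; [exact: Iph.1|exact: If2.1].
rewrite (IntZ _ If1.1) (IntZ _ (intgD Iph.1 If2.1)) (IntD Iph.1 If2.1).
rewrite -e3 mulrCA ler_pM2l//.
apply: (@le_trans _ _ (h * (2 * r `^ (1 - lam) / (1 - lam)) + h `^ (p - 1) * (1 + 4))).
  apply: lerD; first by rewrite ler_pM2l// If1.2.
  by rewrite ler_wpM2l ?powR_ge0// lerD ?Iph.2 ?If2.2.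
rewrite (_ : h * (2 * r `^ (1 - lam) / (1 - lam)) = 2 / (1 - lam) * (h * r `^ (1 - lam)));
  last by ring.
rewrite e1 /C1 [leRHS]mulrDl lerD2l mulrC ler_wpM2r ?powR_ge0//.
Qed.

Lemma hls_unit : (\int[mu]_t \int[mu]_s (phi t * phi s * `|t - s| `^ (- lam))%:E
  <= (2 * C1)%:E)%E.
Proof.
have mEH : measurable_fun setT (fun z : R * R => (H z)%:E) by exact/measurable_EFinP.
have EH0 z : (0 <= (H z)%:E)%E by rewrite lee_fin.
pose H2 (z : R * R) := H (z.2, z.1).
have mH2 : measurable_fun setT H2.
  by apply: (measurableT_comp mH); exact: measurable_fun_pair.
have mEH2 : measurable_fun setT (fun z : R * R => (H2 z)%:E) by exact/measurable_EFinP.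
have EH20 z : (0 <= (H2 z)%:E)%E by rewrite lee_fin; exact: H_ge0.
have HH : (\int[mu]_t \int[mu]_s (H (t, s))%:E <= C1%:E)%E.
  apply: (@le_trans _ _ (\int[mu]_t (C1 * phi t `^ p)%:E)%E).
    apply: ge0_le_integral => //.
    - by move=> t _; exact: integral_ge0.
    - exact: (measurable_fun_fubini_tonelli_F (m2 := mu) _ mEH EH0).
    - by apply/measurable_EFinP; meas.
  under eq_integral do rewrite EFinM.
  rewrite ge0_integralZl_EFin//; last 2 first.
  - by move=> t _; rewrite lee_fin powR_ge0.
  - by apply/measurable_EFinP; meas.
  rewrite -[leRHS]mule1; apply: lee_wpmul2l => //.
have HH2 : (\int[mu]_t \int[mu]_s (H2 (t, s))%:E <= C1%:E)%E.
  by rewrite (fubini_tonelli (m1 := mu) (m2 := mu) _ mEH2 EH20).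
pose G (z : R * R) := H z + H2 z.
have mEG : measurable_fun setT (fun z : R * R => (G z)%:E).
  by apply/measurable_EFinP; exact: measurable_funD.
have EG0 z : (0 <= (G z)%:E)%E by rewrite lee_fin; apply: addr_ge0; exact: H_ge0.
have m1 : measurable_fun setT (fun z : R * R => phi z.1) by exact: measurableT_comp.
have m2 : measurable_fun setT (fun z : R * R => phi z.2) by exact: measurableT_comp.
pose K (z : R * R) := phi z.1 * phi z.2 * `|z.1 - z.2| `^ (- lam).
have mEK : measurable_fun setT (fun z : R * R => (K z)%:E).
  by apply/measurable_EFinP; rewrite /K; meas.
have EK0 z : (0 <= (K z)%:E)%E by rewrite lee_fin !mulr_ge0 ?powR_ge0.
have KG z : K z <= G z.
  rewrite /K /G /H2 /H /=; case: (leP (phi z.2) (phi z.1)) => h.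
    by rewrite lerDl; case: ifP => // _; rewrite !mulr_ge0 ?powR_ge0.
  by rewrite (ltW h) add0r distrC (mulrC (phi z.1)).
apply: (@le_trans _ _ (\int[mu]_t \int[mu]_s (G (t, s))%:E)%E).
  rewrite -[leLHS](fubini_tonelli1 (m1 := mu) (m2 := mu) _ mEK EK0).
  rewrite -[leRHS](fubini_tonelli1 (m1 := mu) (m2 := mu) _ mEG EG0).
  by apply: ge0_le_integral => // z _; rewrite lee_fin.
rewrite -[leLHS](fubini_tonelli1 (m1 := mu) (m2 := mu) _ mEG EG0).
have {}HH : (\int[mu \x mu]_z (H z)%:E <= C1%:E)%E.
  rewrite (fubini_tonelli1 (m1 := mu) (m2 := mu) _ mEH EH0); exact: HH.
have {}HH2 : (\int[mu \x mu]_z (H2 z)%:E <= C1%:E)%E.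
  rewrite (fubini_tonelli1 (m1 := mu) (m2 := mu) _ mEH2 EH20); exact: HH2.
under eq_integral do rewrite /G EFinD.
rewrite ge0_integralD//; try by [exact: mEH|exact: mEH2|move=> z _; exact: EH0|move=> z _; exact: EH20].
by rewrite mulr_natl mulr2n EFinD; exact: leeD HH HH2.
Qed.

End upper.

Lemma hls : exists2 C : R, 0 < C & forall (phi : R -> R) (N : R),
  measurable_fun setT phi -> (forall t, 0 <= phi t) -> 0 < N ->
  (\int[mu]_t (phi t `^ p)%:E <= (N `^ p)%:E)%E ->
  (\int[mu]_t \int[mu]_s (phi t * phi s * `|t - s| `^ (- lam))%:E <= (C * N ^+ 2)%:E)%E.
Proof.
have onel : 0 < 1 - lam by rewrite subr_gt0.
exists (2 * (2 / (1 - lam) + 5)); first by rewrite mulr_gt0// addr_gt0// divr_gt0.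
move=> phi N mphi phi0 N0 hN.
pose ps t := N^-1 * phi t.
have mps : measurable_fun setT ps by rewrite /ps; meas.
have ps0 t : 0 <= ps t by rewrite mulr_ge0// invr_ge0 ltW.
have ps1 : (\int[mu]_t (ps t `^ p)%:E <= 1)%E.
  have -> : (\int[mu]_t (ps t `^ p)%:E = \int[mu]_t (((N `^ p)^-1)%:E * (phi t `^ p)%:E))%E.
    apply: eq_integral => t _; rewrite -EFinM /ps powRM ?invr_ge0 ?(ltW N0)//.
    by rewrite -{1}[N^-1]powR_inv1 ?(ltW N0)// powRAC powR_inv1 ?powR_ge0.
  rewrite ge0_integralZl_EFin ?invr_ge0 ?powR_ge0//; last 2 first.
  - by move=> t _; rewrite lee_fin powR_ge0.
  - by apply/measurable_EFinP; meas.
  apply: (@le_trans _ _ (((N `^ p)^-1)%:E * (N `^ p)%:E)%E).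
    by apply: lee_wpmul2l => //; rewrite lee_fin invr_ge0 powR_ge0.
  by rewrite -EFinM mulVf// gt_eqF// powR_gt0.
have := hls_unit mps ps0 ps1; set C := 2 * _ => h.
have m1 : measurable_fun setT (fun z : R * R => phi z.1) by exact: measurableT_comp.
have m2 : measurable_fun setT (fun z : R * R => phi z.2) by exact: measurableT_comp.
pose K (z : R * R) := phi z.1 * phi z.2 * `|z.1 - z.2| `^ (- lam).
pose Kp (z : R * R) := ps z.1 * ps z.2 * `|z.1 - z.2| `^ (- lam).
have mEKp : measurable_fun setT (fun z : R * R => (Kp z)%:E).
  by apply/measurable_EFinP; rewrite /Kp /ps; meas.
have EKp0 z : (0 <= (Kp z)%:E)%E.
  by rewrite lee_fin; apply: mulr_ge0; [apply: mulr_ge0; exact: ps0|exact: powR_ge0].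
have mEK : measurable_fun setT (fun z : R * R => (K z)%:E).
  by apply/measurable_EFinP; rewrite /K; meas.
have EK0 z : (0 <= (K z)%:E)%E by rewrite lee_fin !mulr_ge0 ?powR_ge0.
rewrite -[leLHS](fubini_tonelli1 (m1 := mu) (m2 := mu) _ mEK EK0).
have {}h : (\int[mu \x mu]_z (Kp z)%:E <= C%:E)%E.
  by rewrite (fubini_tonelli1 (m1 := mu) (m2 := mu) _ mEKp EKp0).
have -> : (\int[mu \x mu]_z (K z)%:E = \int[mu \x mu]_z ((N ^+ 2)%:E * (Kp z)%:E))%E.
  apply: eq_integral => z _; rewrite -EFinM; congr EFin; rewrite /K /Kp /ps.
  by field; rewrite gt_eqF.
rewrite ge0_integralZl_EFin//; try by [exact: mEKp|move=> z _; exact: EKp0|exact: sqr_ge0].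
by rewrite (mulrC C) (EFinM (N ^+ 2) C); apply: lee_wpmul2l => //; rewrite lee_fin sqr_ge0.
Qed.

End HLS.

(** * The T T* identity for functions of space and time *)

Section SpaceTime.
Context {R : realType}.
Notation mu := (@lebesgue_measure R).
Variables (a : R) (u : R * R -> R) (m1 m2 : R -> R) (M1 M2 : R).
Hypothesis a0 : 0 <= a.
Local Notation w := (wt a).
Hypothesis mu_ : measurable_fun setT u.
Hypothesis um : forall x t, `|u (x, t)| <= m1 x * m2 t.
Hypothesis Im1 : intg (fun x => m1 x * w x).
Hypotheses (m1M : forall x, 0 <= m1 x <= M1).
Hypotheses (Im2 : intg m2) (m2M : forall t, 0 <= m2 t <= M2).

Let m1_ge0 x : 0 <= m1 x. Proof. by case/andP: (m1M x). Qed.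
Let m2_ge0 t : 0 <= m2 t. Proof. by case/andP: (m2M t). Qed.

Definition slice (t x : R) : R := u (x, t).
Let V (t xi : R) : R := hk a (slice t) xi.
(** For T = cos and T = sin, the real and imaginary parts of the time integral of e^{i xi^2 t} times
    the Hankel transform of the slice at t. *)
Definition evol (T : R -> R) (xi : R) : R :=
  Int (fun t => T (xi ^+ 2 * t) * hk a (slice t) xi).

Let c1 := Int (fun x => m1 x * w x).

Lemma bounded_L1_slice t : bounded_L1 w (slice t).
Proof.
have ms : measurable_fun setT (slice t).
  exact: (measurableT_comp mu_ (pair2_measurable _)).
split => //; last first.
  exists (M1 * m2 t) => x; rewrite (le_trans (um x t))// ler_wpM2r//.
  by case/andP: (m1M x).
apply: (@intg_le _ _ (fun x => m2 t * (m1 x * w x))); last exact: intgZ.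
  by apply: measurable_funM => //; exact: meas_wt.
move=> x; rewrite normrM (ger0_norm (wt_ge0 a x)) mulrA ler_wpM2r ?wt_ge0//.
by rewrite mulrC; exact: um.
Qed.

Lemma hk_slice_le t xi : `|V t xi| <= c1 * m2 t.
Proof.
have [_ If _] := bounded_L1_slice t.
rewrite (le_trans (hk_le a0 xi If))// mulrC -IntZ//; apply: le_Int.
- exact: intg_norm.
- exact: intgZ.
move=> x; rewrite normrM (ger0_norm (wt_ge0 a x)) mulrA ler_wpM2r ?wt_ge0//.
by rewrite mulrC; exact: um.
Qed.

Lemma meas_hk_slice : measurable_fun setT (fun z : R * R => V z.1 z.2).
Proof.
have m11 : measurable_fun setT (fun z : (R * R) * R => z.1.1) by exact: measurableT_comp.
have m12 : measurable_fun setT (fun z : (R * R) * R => z.1.2) by exact: measurableT_comp.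
have m3 : measurable_fun setT (fun z : (R * R) * R => z.2) by exact: measurable_snd.
apply: (@meas_Int _ _ _ (fun z : (R * R) * R => u (z.2, z.1.1) * w z.2 * bj a (z.2 * z.1.2))
  (fun x => M2 * (m1 x * w x))).
- have m4 := measurableT_comp (meas_wt a) m3; have m5 := meas_bjM a0 m3 m12.
  have m6 := measurableT_comp mu_ (measurable_fun_pair m3 m11).
  by meas.
- exact: intgZ.
- move=> [t xi] x /=; rewrite !normrM (ger0_norm (wt_ge0 a x)).
  rewrite (@le_trans _ _ (`|u (x, t)| * w x))//.
    by rewrite ler_piMr ?bj_le1// mulr_ge0 ?wt_ge0.
  rewrite mulrA ler_wpM2r ?wt_ge0// (le_trans (um x t))// mulrC ler_wpM2r//.
  by case/andP: (m2M t).
Qed.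

Lemma intg_evol T xi : trig T -> intg (fun t => T (xi ^+ 2 * t) * V t xi).
Proof.
move=> [mT T1]; apply: (@intg_le _ _ (fun t => c1 * m2 t)); last exact: intgZ.
  apply: measurable_funM; first by apply: (measurableT_comp mT); meas.
  exact: (measurableT_comp meas_hk_slice (pair2_measurable _)).
move=> t; rewrite normrM (le_trans _ (hk_slice_le t xi))// ler_piMl//.
Qed.

Lemma evol_le T xi : trig T -> `|evol T xi| <= c1 * Int m2.
Proof.
move=> hT; rewrite -IntZ//; apply: le_norm_Int.
- exact: intg_meas (intg_evol xi hT).
- exact: intgZ.
- move=> t; rewrite normrM (le_trans _ (hk_slice_le t xi))// ler_piMl//.
  by case: hT.
Qed.

Lemma meas_evol T : trig T -> measurable_fun setT (evol T).
Proof.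
move=> [mT T1].
apply: (@meas_Int _ _ _ (fun z : R * R => T (z.1 ^+ 2 * z.2) * V z.2 z.1)
  (fun t => c1 * m2 t)).
- apply: measurable_funM; first by apply: (measurableT_comp mT); meas.
  exact: (measurableT_comp meas_hk_slice (measurable_fun_pair measurable_snd measurable_fst)).
- exact: intgZ.
- move=> xi t /=; rewrite normrM (le_trans _ (hk_slice_le t xi))// ler_piMl//.
Qed.

Section regularized.
Variable eps : R.
Hypothesis e0 : 0 < eps.
Let W xi := gauss eps xi * w xi.
Let IW : intg W. Proof. exact: intg_gauss_wt. Qed.
Let W_ge0 xi : 0 <= W xi. Proof. by rewrite mulr_ge0 ?gauss_ge0 ?wt_ge0. Qed.
Let H (t s : R) := hform a eps (t - s) (slice t) (slice s).
(** The real part of e^{-i xi^2 t} times the complex evolution integral. *)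
Let Q (t xi : R) := cos (xi ^+ 2 * t) * evol cos xi + sin (xi ^+ 2 * t) * evol sin xi.

Let mQ : measurable_fun setT (fun z : R * R => Q z.2 z.1).
Proof.
have m1_ := measurableT_comp (meas_evol trig_cos) (@measurable_fst _ _ R R).
have m2_ := measurableT_comp (meas_evol trig_sin) (@measurable_fst _ _ R R).
by rewrite /Q; meas.
Qed.

Let Q_le t xi : `|Q t xi| <= 2 * (c1 * Int m2).
Proof.
have h1 := evol_le xi trig_cos; have h2 := evol_le xi trig_sin.
rewrite (le_trans (ler_normD _ _))// !normrM.
rewrite mulr_natl mulr2n lerD// -[leRHS]mul1r ler_pM// ?cos_abs ?sin_abs//.
Qed.

Let QE t xi : Q t xi = Int (fun s => cos (xi ^+ 2 * (t - s)) * V s xi).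
Proof.
rewrite /Q /evol -!IntZ; [|exact: intg_evol trig_sin|exact: intg_evol trig_cos].
rewrite -IntD; last 2 first.
- exact: (intgZ _ (intg_evol _ trig_cos)).
- exact: (intgZ _ (intg_evol _ trig_sin)).
by apply: eq_Int => s; rewrite mulrBr cosB /V; ring.
Qed.

Let bndG t xi s : `|W xi * (cos (xi ^+ 2 * (t - s)) * V t xi * V s xi)| <=
  W xi * (c1 * m2 t * (c1 * m2 s)).
Proof.
rewrite normrM (ger0_norm (W_ge0 xi)) ler_wpM2l// !normrM ler_pM ?mulr_ge0//.
  by rewrite -[leRHS]mul1r ler_pM ?cos_abs// hk_slice_le.
exact: hk_slice_le.
Qed.

Let mG t : measurable_fun setT (fun z : R * R =>
  W z.1 * (cos (z.1 ^+ 2 * (t - z.2)) * V t z.1 * V z.2 z.1)).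
Proof.
have h1 := measurableT_comp (intg_meas IW) (@measurable_fst _ _ R R).
have h2 : measurable_fun setT (fun z : R * R => V t z.1).
  exact: (measurableT_comp (measurableT_comp meas_hk_slice (pair1_measurable t)) measurable_fst).
have h3 := (measurableT_comp meas_hk_slice (measurable_fun_pair (@measurable_snd _ _ R R) measurable_fst)).
by meas.
Qed.

Let Icos t xi : intg (fun s => cos (xi ^+ 2 * (t - s)) * V s xi).
Proof.
apply: (@intg_le _ _ (fun t => c1 * m2 t)); last exact: intgZ.
  have h3 := measurableT_comp meas_hk_slice (pair2_measurable xi).
  by apply: measurable_funM h3; meas.
by move=> s; rewrite normrM -[leRHS]mul1r ler_pM ?cos_abs// hk_slice_le.
Qed.

Let HE t : Int (H t) = Int (fun xi => W xi * (V t xi * Q t xi)).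
Proof.
have Ih : intg (fun s => (c1 * m2 t) * (c1 * m2 s)) by apply: intgZ; exact: intgZ.
transitivity (Int (fun xi => Int (fun s => W xi * (cos (xi ^+ 2 * (t - s)) * V t xi * V s xi)))).
  rewrite (Fubini_Int (mG t) IW Ih (bndG t)); apply: eq_Int => s.
  by apply: eq_Int => xi; rewrite /W (mulrC (t - s)) /V; ring.
apply: eq_Int => xi; rewrite QE -!IntZ//; last exact: (intgZ _ (Icos t xi)).
by apply: eq_Int => s; ring.
Qed.

Let bndE xi t : `|W xi * (V t xi * Q t xi)| <= W xi * ((2 * (c1 * Int m2)) * (c1 * m2 t)).
Proof.
rewrite normrM (ger0_norm (W_ge0 xi)) ler_wpM2l// mulrC normrM.
by rewrite ler_pM// ?hk_slice_le.
Qed.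

Let mE : measurable_fun setT (fun z : R * R => W z.1 * (V z.2 z.1 * Q z.2 z.1)).
Proof.
have h1 := measurableT_comp (intg_meas IW) (@measurable_fst _ _ R R).
have h3 := (measurableT_comp meas_hk_slice (measurable_fun_pair (@measurable_snd _ _ R R) measurable_fst)).
by meas.
Qed.

Lemma intg_hform t : intg (H t).
Proof.
have Ih : intg (fun s => (c1 * m2 t) * (c1 * m2 s)) by apply: intgZ; exact: intgZ.
apply: eq_intg (Fubini_int2 (mG t) IW Ih (bndG t)) => s.
by apply: eq_Int => xi; rewrite /W (mulrC (t - s)) /V; ring.
Qed.

Lemma intg_Int_hform : intg (fun t => Int (H t)).
Proof.
have Ih : intg (fun t => (2 * (c1 * Int m2)) * (c1 * m2 t)) by apply: intgZ; exact: intgZ.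
by apply: eq_intg (Fubini_int2 mE IW Ih bndE) => t; rewrite HE.
Qed.

Let sumE xi : evol cos xi ^+ 2 + evol sin xi ^+ 2 = Int (fun t => V t xi * Q t xi).
Proof.
rewrite !expr2 {1}/evol {2}/evol -(mulrC (evol cos xi)) -(mulrC (evol sin xi)) -!IntZ; last 2 first.
- exact: intg_evol trig_sin.
- exact: intg_evol trig_cos.
rewrite -IntD; last 2 first.
- exact: (intgZ _ (intg_evol _ trig_cos)).
- exact: (intgZ _ (intg_evol _ trig_sin)).
by apply: eq_Int => t; rewrite /Q /V; ring.
Qed.

(** The squared modulus of the evolution integral is the double time integral of cos(xi^2 (t-s)) V_t
    V_s. The Gaussian weight in xi and the majorant m2 in time allow the xi integral to be moved
    inside, where it becomes [hform]. *)
Lemma energy_identity :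
  Int (fun xi => W xi * (evol cos xi ^+ 2 + evol sin xi ^+ 2)) = Int (fun t => Int (H t)).
Proof.
have Ih : intg (fun t => (2 * (c1 * Int m2)) * (c1 * m2 t)) by apply: intgZ; exact: intgZ.
transitivity (Int (fun xi => Int (fun t => W xi * (V t xi * Q t xi)))).
  apply: eq_Int => xi; rewrite sumE IntZ//.
  apply: (@intg_le _ _ (fun t => (2 * (c1 * Int m2)) * (c1 * m2 t))) => //.
    have h3 := measurableT_comp meas_hk_slice (pair2_measurable xi).
    have h4 := measurableT_comp mQ (pair1_measurable xi).
    by apply: measurable_funM.
  by move=> t; rewrite mulrC normrM ler_pM// ?hk_slice_le.
rewrite (Fubini_Int mE IW Ih bndE); apply: eq_Int => t; exact/esym/HE.
Qed.

Lemma intg_energy : intg (fun xi => W xi * (evol cos xi ^+ 2 + evol sin xi ^+ 2)).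
Proof.
have Ih : intg (fun t => (2 * (c1 * Int m2)) * (c1 * m2 t)) by apply: intgZ; exact: intgZ.
have sq T xi : trig T -> evol T xi ^+ 2 <= (c1 * Int m2) ^+ 2.
  move=> hT; rewrite -(real_normK (num_real (evol T xi))) lerXn2r ?nnegrE ?evol_le//.
  exact: le_trans (evol_le xi hT).
apply: (@intg_le _ _ (fun xi => ((c1 * Int m2) ^+ 2 + (c1 * Int m2) ^+ 2) * W xi)).
- have := meas_evol trig_cos; have := meas_evol trig_sin; have := intg_meas IW.
  by move=> ? ? ?; meas.
- move=> xi; rewrite ger0_norm; last by rewrite mulr_ge0// addr_ge0 ?sqr_ge0.
  by rewrite mulrC ler_wpM2r// lerD// sq//; [exact: trig_cos|exact: trig_sin].
- exact: intgZ.
Qed.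

End regularized.
End SpaceTime.

(** * The dispersive estimate and Hardy-Littlewood-Sobolev combined *)

Section Estimate.
Context {R : realType}.
Notation mu := (@lebesgue_measure R).

(** Extends an estimate stated for positive norms to slices whose norm vanishes. *)
Lemma le_mul_pert (x K u v : R) : 0 <= K -> 0 <= u -> 0 <= v ->
  (forall d, 0 < d -> x <= K * ((u + d) * (v + d))) -> x <= K * (u * v).
Proof.
move=> K0 u0 v0 h; apply/ler_addgt0Pr => e e0.
pose d := Num.min 1 (e / (K * (u + v + 1) + 1)).
have D0 : 0 < K * (u + v + 1) + 1 by rewrite ltr_wpDl// mulr_ge0// !addr_ge0.
have d0 : 0 < d by rewrite lt_min ltr01 divr_gt0.
have d1 : d <= 1 by rewrite /d ge_min lexx.
have d2 : d * (K * (u + v + 1) + 1) <= e.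
  by rewrite -ler_pdivlMr// /d ge_min lexx orbT.
apply: le_trans (h d d0) _.
have : 0 <= K * d * (1 - d) by rewrite !mulr_ge0 ?subr_ge0// ltW.
move: d2 (ltW d0); clear; move: d => d; nra.
Qed.

Variables (a p : R).
Hypotheses (a0 : 0 <= a) (p1 : 1 < p) (p2 : p < 2).
Let lam := (1 + a) / 2 * (2 / p - 1).
Hypotheses (l0 : 0 < lam) (l1 : lam < 1).
Local Notation w := (wt a).

Lemma evol_estimate : exists2 C : R, 0 < C &
  forall (u : R * R -> R) (m1 m2 phi : R -> R) (M1 M2 N : R),
  measurable_fun setT u -> (forall x t, `|u (x, t)| <= m1 x * m2 t) ->
  intg (fun x => m1 x * w x) -> (forall x, 0 <= m1 x <= M1) ->
  intg m2 -> (forall t, 0 <= m2 t <= M2) ->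
  measurable_fun setT phi -> (forall t, 0 <= phi t) ->
  (forall t, Int (fun x => `|u (x, t)| `^ p * w x) <= phi t `^ p) ->
  0 < N -> (\int[mu]_t (phi t `^ (2 / (2 - lam)))%:E <= (N `^ (2 / (2 - lam)))%:E)%E ->
  (\int[mu]_xi ((evol a u cos xi ^+ 2 + evol a u sin xi ^+ 2) * w xi)%:E <= (C * N ^+ 2)%:E)%E.
Proof.
have [C0 C00 HC] := hform_dispersive a0 p1 p2.
have [C1 C10 HH] := hls l0 l1.
exists (C0 * C1); first exact: mulr_gt0.
move=> u m1 m2 phi M1 M2 N mu_ um Im1 m1M Im2 m2M mphi phi0 uphi N0 phiN.
have mc := meas_evol a0 mu_ um Im1 m1M Im2 m2M trig_cos.
have ms := meas_evol a0 mu_ um Im1 m1M Im2 m2M trig_sin.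
apply: gauss_limit.
- by have := meas_wt a => ?; meas.
- by move=> x; rewrite mulr_ge0 ?wt_ge0// addr_ge0 ?sqr_ge0.
move=> eps e0.
pose H t s := hform a eps (t - s) (slice u t) (slice u s).
have -> : (\int[mu]_x (gauss eps x * ((evol a u cos x ^+ 2 + evol a u sin x ^+ 2) * w x))%:E =
    (Int (fun t => Int (H t)))%:E)%E.
  rewrite -(energy_identity a0 mu_ um Im1 m1M Im2 m2M e0).
  rewrite (EFin_Int (intg_energy a0 mu_ um Im1 m1M Im2 m2M e0)).
  by apply: eq_integral => x _; congr EFin; ring.
have IH := intg_hform a0 mu_ um Im1 m1M Im2 m2M e0.
have IIH := intg_Int_hform a0 mu_ um Im1 m1M Im2 m2M e0.
pose K t s := C0 * (phi t * phi s * `|t - s| `^ (- lam)).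
have K0 t s : 0 <= K t s.
  by rewrite /K; apply: mulr_ge0; [exact: ltW|rewrite !mulr_ge0// powR_ge0].
have HK t s : s != t -> `|H t s| <= K t s.
  move=> st; have ts : t - s != 0 by rewrite subr_eq0 eq_sym.
  have -> : K t s = (C0 * `|t - s| `^ (- lam)) * (phi t * phi s) by rewrite /K; ring.
  apply: le_mul_pert => //; first by rewrite mulr_ge0 ?powR_ge0// ltW.
  have pos : 0 < p by exact: lt_trans p1.
  move=> d d0; apply: HC => //.
  - exact: (bounded_L1_slice mu_ um Im1 m1M m2M).
  - exact: (bounded_L1_slice mu_ um Im1 m1M m2M).
  - by rewrite ltr_wpDl.
  - by rewrite ltr_wpDl.
  - rewrite (le_trans (uphi t))// ge0_ler_powR ?nnegrE ?addr_ge0 ?lerDl ?(ltW d0) ?(ltW pos)//.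
  - rewrite (le_trans (uphi s))// ge0_ler_powR ?nnegrE ?addr_ge0 ?lerDl ?(ltW d0) ?(ltW pos)//.
have mK : measurable_fun setT (fun z : R * R => K z.1 z.2).
  have h1 := measurableT_comp mphi (@measurable_fst _ _ R R).
  have h2 := measurableT_comp mphi (@measurable_snd _ _ R R).
  by rewrite /K; meas.
have inner t : ((`|Int (H t)|)%:E <= \int[mu]_s (K t s)%:E)%E.
  apply: (@le_trans _ _ (\int[mu]_s (`|H t s|)%:E)%E).
    rewrite -EFin_Int; last by apply: intg_norm; exact: IH.
    by rewrite lee_fin; apply: le_norm_Int => //; [exact: intg_meas (IH t)|exact: intg_norm (IH t)].
  apply: ae_ge0_le_integral => //.
  - apply/measurable_EFinP; exact: intg_meas (intg_norm (IH t)).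
  - by move=> s _; rewrite lee_fin.
  - apply/measurable_EFinP; exact: (measurableT_comp mK (pair1_measurable t)).
  (* The dispersive bound excludes s = t, a null set. *)
  - exists [set t]; split => //; first exact: lebesgue_measure_set1.
    move=> s /= h; apply/eqP/negPn/negP => st; apply: h => _.
    by rewrite lee_fin HK.
apply: (@le_trans _ _ (\int[mu]_t \int[mu]_s (K t s)%:E)%E).
  rewrite EFin_Int//; apply: (@le_trans _ _ (\int[mu]_t (`|Int (H t)|)%:E)%E).
    apply: le_integral => //.
    - exact: intg_norm.
    - by move=> t _; rewrite lee_fin ler_norm.
  apply: ge0_le_integral => //.
  - apply/measurable_EFinP; exact: intg_meas (intg_norm IIH).
  - apply: (measurable_fun_fubini_tonelli_F (m2 := mu) (fun z : R * R => (K z.1 z.2)%:E)).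
      exact/measurable_EFinP.
    by move=> z; rewrite lee_fin.
pose L z : \bar R := (phi z.1 * phi z.2 * `|z.1 - z.2| `^ (- lam))%:E.
have L0 z : (0 <= L z)%E by rewrite lee_fin !mulr_ge0// powR_ge0.
have mL : measurable_fun setT L.
  have h1 := measurableT_comp mphi (@measurable_fst _ _ R R).
  have h2 := measurableT_comp mphi (@measurable_snd _ _ R R).
  by apply/measurable_EFinP; meas.
have -> : (\int[mu]_t \int[mu]_s (K t s)%:E = C0%:E * \int[mu]_t \int[mu]_s L (t, s))%E.
  have side : forall t : R, setT t -> (0 <= \int[mu]_s L (t, s))%E.
    by move=> t _; exact: integral_ge0.
  rewrite -(ge0_integralZl_EFin mu measurableT side _ (ltW C00)); last first.
    exact: (measurable_fun_fubini_tonelli_F (m2 := mu)).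
  apply: eq_integral => t _.
  rewrite -ge0_integralZl_EFin ?(ltW C00)//.
  exact: (measurableT_comp mL (pair1_measurable t)).
rewrite -mulrA (EFinM C0) lee_wpmul2l ?lee_fin ?(ltW C00)//.
exact: HH phi N mphi phi0 N0 phiN.
Qed.

End Estimate.

(** * The Gamma recurrence, and the given Bessel function and Hankel transform in normalised form *)

Section GammaBessel.
Context {R : realType}.
Notation mu := (@lebesgue_measure R).

Section recurrence.
Variable s : R.
Hypothesis s0 : 0 < s.
Let g (r u : R) := u `^ (r - 1) * expR (- u).
Let F (u : R) := u `^ s * expR (- u).
Let C := (2 * s) `^ s.

Let C_ge0 : 0 <= C. Proof. exact: powR_ge0. Qed.

(** Write u^s = (2s)^s (u/(2s))^s and bound the second factor by e^{u/2}. *)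
Let F_le (u : R) : 0 < u -> 0 <= F u <= C * expR (- (u / 2)).
Proof.
move=> u0; rewrite /F mulr_ge0 ?powR_ge0 ?expR_ge0//=.
have s20 : 0 < 2 * s by rewrite mulr_gt0.
have h := powR_le_exp (ltW s0) (divr_gt0 u0 s20).
have -> : u `^ s = C * (u / (2 * s)) `^ s.
  rewrite /C -powRM; [|exact: ltW|by rewrite ltW// divr_gt0].
  by congr (_ `^ _); field; rewrite gt_eqF.
rewrite -mulrA ler_wpM2l// (le_trans (ler_wpM2r (expR_ge0 _) h))//.
rewrite -expRD ler_expR le_eqVlt; apply/orP; left; apply/eqP.
by field; rewrite gt_eqF.
Qed.

Let dF (u : R) : 0 < u -> is_derive u 1 F (s * g s u - g (s + 1) u).
Proof.
move=> u0; apply: (is_derive_ext (derM (is_derive1_powR s u0) (derexp (derN (derI u))))) => //.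
by rewrite /g addrK; ring.
Qed.

Let cg (r u : R) : 0 < u -> {for u, continuous (g r)}.
Proof.
by move=> u0; exact: der_continuous (derM (is_derive1_powR (r - 1) u0) (derexp (derN (derI u)))).
Qed.

Let intg_exp_half : intg (half (fun u : R => C * expR (- (u / 2)))).
Proof.
have cf (x : R) : {for x, continuous (fun u : R => C * expR (- (u / 2)))}.
  exact: der_continuous (derZ C (derexp (derN (derM (derI x) (derC 2^-1 x))))).
have [] // := @ge0_intgP R (half (fun u : R => C * expR (- (u / 2)))) (2 * C).
- exact: half_cont_meas.
- by move=> x; rewrite /half; case: ifP; rewrite ?mulr_ge0 ?expR_ge0.
- rewrite -integral_half; apply: (@FTC_le_oy R _ (fun x => (- 2 * C) * expR (- (x / 2)))) => //.
  + move=> x _.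
    apply: (is_derive_ext (derZ (- 2 * C) (derexp (derN (derM (derI x) (derC 2^-1 x)))))) => //.
    by field.
  + by move=> x _; rewrite mulr_ge0 ?expR_ge0.
  + move=> x y x0 xy; have h1 := mulr_ge0 C_ge0 (expR_ge0 (- (y / 2))).
    have : expR (- (x / 2)) <= 1 by rewrite -expR0 ler_expR oppr_le0 divr_ge0// ltW.
    rewrite -subr_ge0 => /(mulr_ge0 C_ge0); move: h1.
    move: (expR _) (expR _) C => u v c; lra.
Qed.

Let intg_next : intg (half (g (s + 1))).
Proof.
apply: intg_le intg_exp_half; first by apply: half_cont_meas => x; exact: cg.
move=> x; rewrite /half; case: ifP => [x0|]; last by rewrite normr0.
have := F_le x0; rewrite /F /g addrK => /andP[h1 h2].
by rewrite ger0_norm.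
Qed.

Let intg_cur : intg (half (g s)).
Proof.
(* This f is the derivative of F - 2 C e^{-u/2}, a bounded function, and it dominates s times the
   Gamma integrand; integrability near 0 follows even for s < 1. *)
pose f (u : R) := s * g s u + (C * expR (- (u / 2)) - F u).
have fg (u : R) : 0 < u -> 0 <= s * g s u <= f u.
  move=> u0; have /andP[h1 h2] := F_le u0.
  rewrite lerDl subr_ge0 h2 andbT.
  by rewrite mulr_ge0 ?(ltW s0)// mulr_ge0 ?powR_ge0 ?expR_ge0.
have dP (u : R) : 0 < u -> is_derive u 1 (fun x => F x + (- 2 * C) * expR (- (x / 2))) (f u).
  move=> u0; have h := derD (dF u0) (derZ (- 2 * C) (derexp (derN (derM (derI u) (derC 2^-1 u))))).
  apply: (is_derive_ext h) => //; rewrite /f /F /g addrK; by field.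
have cf (u : R) : 0 < u -> {for u, continuous f}.
  move=> u0; have d1 := derM (is_derive1_powR (s - 1) u0) (derexp (derN (derI u))).
  have d2 := derZ C (derexp (derN (derM (derI u) (derC 2^-1 u)))).
  exact: (der_continuous (derD (derZ s d1) (derB d2 (dF u0)))).
have [] := @ge0_intgP R (half f) (C + 2 * C).
- exact: half_cont_meas.
- move=> x; rewrite /half; case: ifP => // /fg /andP[]; exact: le_trans.
- rewrite -integral_half; apply: (FTC_le_oy dP) => //.
  + by move=> x /fg /andP[]; exact: le_trans.
  + move=> x y x0 xy; have /andP[Fx0 _] := F_le x0.
    have /andP[_ Fy] := F_le (lt_trans x0 xy).
    have e1 (v : R) : 0 < v -> expR (- (v / 2)) <= 1.
      by move=> v0; rewrite -expR0 ler_expR oppr_le0 divr_ge0// ltW.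
    have h1 := ler_wpM2l C_ge0 (e1 _ x0).
    have h2 := ler_wpM2l C_ge0 (e1 _ (lt_trans x0 xy)).
    have h3 := mulr_ge0 C_ge0 (expR_ge0 (- (y / 2))).
    move: (F x) (F y) h1 h2 h3 Fx0 Fy; move: (expR _) (expR _) C => e e' c u v; lra.
move=> If _; apply: (@intg_le _ _ (fun x => s^-1 * half f x)); last exact: intgZ.
  by apply: half_cont_meas => x; exact: cg.
move=> x; rewrite /half; case: ifP => [x0|]; last by rewrite normr0 mulr0.
rewrite ger0_norm; last by rewrite mulr_ge0 ?powR_ge0 ?expR_ge0.
by rewrite ler_pdivlMl//; case/andP: (fg x x0).
Qed.

(** The function u^s e^{-u} vanishes at both ends, so its derivative has integral zero. *)
Lemma Gamma_rec : Gamma (s + 1) = s * Gamma s.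
Proof.
have h : Int (half (fun u => s * g s u - g (s + 1) u)) = 0 - 0.
  rewrite -Rintegral_half; apply: (FTC_oy (F := F)).
  - exact: dF.
  - move=> u u0; have d1 := derM (is_derive1_powR (s - 1) u0) (derexp (derN (derI u))).
    have d2 := derM (is_derive1_powR (s + 1 - 1) u0) (derexp (derN (derI u))).
    exact: (der_continuous (derB (derZ s d1) d2)).
  - apply/intg_half; apply: eq_intg (intgB (intgZ s intg_cur) intg_next) => u.
    by rewrite /half; case: ifP; rewrite ?mulr0 ?subr0.
  - have : F u @[u --> (0:R)^'+] --> 0 * expR (- 0 : R).
      apply: cvgM; first exact: powR_cvg0.
      by apply: cvg_at_right_filter; exact: (der_continuous (derexp (derN (derI (0 : R))))).
    by rewrite mul0r.
  - have lim0 : C * expR (- (u / 2)) @[u --> +oo] --> 0.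
      rewrite -[X in _ --> X](mulr0 C); apply: cvgM; first exact: cvg_cst.
      apply: (cvg_comp (fun u : R => u / 2) (fun x => expR (- x))); last exact: cvgr_expR.
      by apply: gt0_cvgMly.
    apply: (squeeze_cvgr _ (cvg_cst 0) lim0).
    near=> u; apply: F_le; near: u; exact: nbhs_pinfty_gt.
move: h; rewrite subr0 (eq_Int (g := fun u => s * half (g s) u - half (g (s + 1)) u)).
  rewrite IntB ?IntZ//; last exact: intgZ.
  by move/subr0_eq; rewrite /Gamma !Rintegral_half.
by move=> u; rewrite /half; case: ifP; rewrite ?mulr0 ?subr0.
Unshelve. all: by end_near.
Qed.
End recurrence.

Variable a : R.
Hypothesis a0 : 0 <= a.
Let nu := (a - 1) / 2.
Definition bessel_const : R := 2 `^ (- nu) / Gamma (nu + 1).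

Lemma Gamma_coef (k : nat) :
  (k`!%:R * Gamma (k%:R + nu + 1))^-1 = dcoef a k * 4 ^+ k / Gamma (nu + 1).
Proof.
elim: k => [|k IH]; first by rewrite fact0 mul1r add0r expr0 /= !mul1r.
have k0 : 0 < k%:R + nu + 1.
  by have : 0 <= k%:R :> R by []; rewrite /nu; move: a0; lra.
have -> : k.+1%:R + nu + 1 = (k%:R + nu + 1) + 1 by rewrite -natr1; ring.
rewrite Gamma_rec// factS natrM mulrACA invfM IH /= exprS -natr1.
have e : 2 * k%:R + 1 + a = 2 * (k%:R + nu + 1) by rewrite /nu; field.
rewrite e; move: (k%:R + nu + 1) k0 (Gamma (nu + 1))^-1 => y y0 G'.
by field; rewrite natr1 pnatr_eq0 gt_eqF.
Qed.

Lemma besselJE (z : R) : 0 < z -> besselJ nu z = z `^ nu * bessel_const * bj a z.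
Proof.
move=> z0; rewrite /besselJ /bj /psum.
have -> : (fun n => \sum_(0 <= k < n) ((-1) ^+ k / (k`!%:R * Gamma (k%:R + nu + 1)) *
    (z / 2) `^ (2 * k%:R + nu))) =
    (fun n => z `^ nu * bessel_const * pseries (jcoef a) (z ^+ 2) n).
  apply/funext => n; rewrite /pseries /series /= mulr_sumr; apply: eq_bigr => k _.
  rewrite Gamma_coef /jcoef /bessel_const.
  have -> : (z / 2) `^ (2 * k%:R + nu) = (z ^+ 2) ^+ k / 4 ^+ k * (z `^ nu * 2 `^ (- nu)).
    have z20 : 0 < z / 2 by rewrite divr_gt0.
    rewrite powRD ?(gt_eqF z20) ?implybT// -natrM powR_mulrn ?(ltW z20)//.
    rewrite exprM [_ ^+ 2]expr_div_n (_ : 2 ^+ 2 = 4 :> R) ?expr_div_n ?powRM ?(ltW z0) ?invr_ge0//; last by ring.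
    by rewrite -(powR_inv1 (ler0n R 2)) -powRrM mulN1r.
  have : (4 : R) ^+ k != 0 by rewrite expf_neq0.
  move: (4 ^+ k) (Gamma (nu + 1))^-1 (z `^ nu) (2 `^ (- nu)) ((z ^+ 2) ^+ k) ((-1 : R) ^+ k) =>
    u v x y q e u0.
  by field.
have h := entire_cvg (x := z ^+ 2) (jcoef_entire a0).
by apply: cvg_lim => //; apply: cvgMl_tmp h.
Qed.

(** The prefactor xi^{-nu} cancels the xi^nu of J_nu, and y^nu y^{nu+1} = y^a because 2 nu + 1 =
    a. *)
Lemma hankelE (phi : R -> R) (xi : R) : 0 < xi -> intg (fun x => phi x * wt a x) ->
  hankel nu phi xi = bessel_const * hk a phi xi.
Proof.
move=> xi0 Iphi; rewrite /hankel Rintegral_half.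
rewrite (eq_Int (g := fun y => (xi `^ nu * bessel_const) * (phi y * wt a y * bj a (y * xi)))).
  rewrite IntZ; last exact: intg_hk.
  rewrite mulrA mulrA powRN mulVf ?mul1r//.
  by rewrite gt_eqF// powR_gt0.
move=> y; rewrite /wt /half; case: ifP => [y0|]; last by rewrite !(mulr0, mul0r).
rewrite besselJE ?mulr_gt0// powRM ?ltW//.
have -> : y `^ a = y `^ nu * y `^ (nu + 1).
  by rewrite -powRD ?(gt_eqF y0) ?implybT//; congr (_ `^ _); rewrite /nu; field.
by rewrite (mulrC xi y); ring.
Qed.

End GammaBessel.

(** * Joint measurability of functions continuous on the open half-plane *)

Section HalfPlane.
Context {R : realType}.
Variable f : R * R -> R.
Hypothesis cf : forall x t, 0 < x -> {for (x, t), continuous f}.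

Definition halfplane (z : R * R) : R := if 0 < z.1 then f z else 0.

(** Rounding goes upwards on the grid of mesh 1/(n+1), so positive x stays positive; x <= 0 is sent
    to 0, where the extension vanishes. *)
Let idx (n : nat) (x : R) : nat := if 0 < x then (Num.truncn (n.+1%:R * x)).+1 else 0.

Let step n (z : R * R) : R := halfplane ((idx n z.1)%:R / n.+1%:R, z.2).

Let meas_section (c : R) : measurable_fun setT (fun t => halfplane (c, t)).
Proof.
rewrite /halfplane /=; have [c0|_] := ltP 0 c; last exact: measurable_cst.
apply: continuous_measurable_fun => t.
have h : (c, s) @[s --> t] --> (c, t) by exact: (cvg_pair (cvg_cst c) (@cvg_id _ (nbhs t))).
exact: (cvg_comp _ _ h (@cf c t c0)).
Qed.

Let meas_idx n k : measurable [set z : R * R | idx n z.1 = k].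
Proof.
have mb (b : R * R -> bool) : measurable_fun setT b -> measurable [set z | b z].
  by move=> /(_ measurableT [set true] I); rewrite setTI; congr measurable; apply/seteqP; split.
case: k => [|k].
  rewrite [X in measurable X](_ : _ = [set z : R * R | z.1 <= 0]).
    by apply: mb; meas.
  by apply/seteqP; split => z /=; rewrite /idx leNgt; case: ifP.
rewrite [X in measurable X](_ : _ =
  [set z : R * R | (0 < z.1) && ((k%:R <= n.+1%:R * z.1) && (n.+1%:R * z.1 < k.+1%:R))]).
  by apply: mb; meas.
apply/seteqP; split => z /=; rewrite /idx; case: ifP => //= z0.
  by move=> [<-]; rewrite truncn_itv// mulr_ge0// ltW.
by move/truncn_def => ->.
Qed.

Let meas_step n : measurable_fun setT (step n).
Proof.
rewrite [X in measurable_fun X](_ : _ = \bigcup_k [set z : R * R | idx n z.1 = k]); last first.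
  by apply/seteqP; split => // z _; exists (idx n z.1).
apply/measurable_fun_bigcup => // k.
apply: (@eq_measurable_fun _ _ _ _ _ (fun z : R * R => halfplane (k%:R / n.+1%:R, z.2))).
  by move=> z; rewrite inE /= /step => ->.
apply: measurable_funTS.
exact: (measurableT_comp (meas_section _) measurable_snd).
Qed.

(** The function is a pointwise limit of functions that, on countably many strips, depend on t alone
    and continuously or trivially so. This gives measurability for the product structure, as
    Fubini's theorem requires. *)
Lemma meas_halfplane : measurable_fun setT halfplane.
Proof.
apply: (measurable_fun_cvg (h := step)) => // -[x t] _.
have [x0|x0] := ltP 0 x; last first.
  rewrite /step /idx /halfplane /= ltNge x0/=.
  by under eq_fun do rewrite mul0r ltxx; exact: cvg_cst.
have yE n : x <= (idx n x)%:R / n.+1%:R <= x + n.+1%:R^-1.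
  rewrite /idx x0; have n0 : 0 < n.+1%:R :> R by [].
  have := truncn_itv (ltW (mulr_gt0 n0 x0)).
  rewrite ler_pdivlMr// ler_pdivrMr// mulrDl mulVf ?gt_eqF// (mulrC x) -!natr1.
  by move: (n%:R + 1) ((Num.truncn _)%:R) => u v /andP[h1 h2]; apply/andP; split; lra.
have cy : (idx n x)%:R / n.+1%:R @[n --> \oo] --> x.
  apply: (squeeze_cvgr _ (cvg_cst x)); first by apply: nearW => n; exact: yE.
  by rewrite -[X in _ --> X]addr0; apply: cvgD; [exact: cvg_cst|exact: cvg_harmonic].
have -> : (fun n => step n (x, t)) = (fun n => f ((idx n x)%:R / n.+1%:R, t)).
  apply/funext => n; rewrite /step /halfplane /=.
  by rewrite (lt_le_trans x0)//; case/andP: (yE n).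
have -> : halfplane (x, t) = f (x, t) by rewrite /halfplane /= x0.
have h : ((idx n x)%:R / n.+1%:R, t) @[n --> \oo] --> (x, t).
  exact: (cvg_pair cy (cvg_cst t)).
exact: (cvg_comp _ _ h (@cf x t x0)).
Qed.

End HalfPlane.

(** * Integrable majorants from the decay of the test class *)

Section Decay.
Context {R : realType}.
Notation mu := (@lebesgue_measure R).

Lemma intg_oneDsqr : intg (fun t : R => (1 + t ^+ 2)^-1).
Proof.
have c1 : continuous (fun t : R => (1 + t ^+ 2)^-1) by exact: continuous_oneDsqrV.
have p0 (t : R) : 0 <= (1 + t ^+ 2)^-1 by rewrite invr_ge0 addr_ge0 ?sqr_ge0.
have [] // := @ge0_intgP R (fun t : R => (1 + t ^+ 2)^-1) (2 * (pi / 2)).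
- exact: continuous_measurable_fun.
rewrite ge0_symfun_integralT//; last by move=> x /=; rewrite sqrrN.
by rewrite -set_itvcy (@integral0y_oneDsqr R) EFinM.
Qed.

Lemma intg_decay_wt (a : R) : 0 <= a -> exists2 n : nat, (0 < n)%N &
  intg (fun x => (1 + x ^+ 2) ^- n * wt a x).
Proof.
(* Then n - 1 > a and x <= 1 + x^2, so n - 1 factors absorb x^a and the remaining one is
   integrable. *)
move=> a0; pose n := (Num.truncn a).+2; exists n => //.
apply: intg_le intg_oneDsqr.
  have -> : (fun x => (1 + x ^+ 2) ^- n * wt a x) = (fun x => ((1 + x ^+ 2)^-1) ^+ n * wt a x).
    by apply/funext => x; rewrite exprVn.
  by have := meas_wt a; have := intg_meas intg_oneDsqr => ? ?; meas.
move=> x; have b1 : 1 <= 1 + x ^+ 2 by rewrite lerDl sqr_ge0.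
have b0 : 0 < 1 + x ^+ 2 by exact: lt_le_trans b1.
rewrite ger0_norm; last by rewrite mulr_ge0 ?wt_ge0// invr_ge0 exprn_ge0// ltW.
rewrite /wt /half; case: ifP => [x0|_]; last by rewrite mulr0 invr_ge0 ltW.
rewrite /n exprS invfM -mulrA ler_piMr ?invr_ge0 ?(ltW b0)// mulrC ler_pdivrMr ?exprn_gt0// mul1r.
rewrite -powR_mulrn ?(ltW b0)//; apply: (@le_trans _ _ ((1 + x ^+ 2) `^ a)).
  apply: ge0_ler_powR; rewrite ?nnegrE ?(ltW x0) ?(ltW b0)//.
  by have := sqr_ge0 (x - 2^-1); lra.
by rewrite ler_powR//; exact/ltW/truncnS_gt.
Qed.

Lemma Splus_decay (n : nat) (F : R -> R -> R * R) : Splus F ->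
  exists2 M : R, 0 <= M & forall x t, 0 < x ->
    cmod (F x t) <= M * (1 + x ^+ 2) ^- n * (1 + t ^+ 2)^-1.
Proof.
(* Order 2(n+1) gives the weight (1 + x^2 + t^2)^{n+1}, which is at least (1 + x^2)^n (1 + t^2). *)
move=> [_ /(_ (2 * n.+1)%N)[M hM]]; exists `|M| => // x t x0.
have := hM 0 0 isT x t x0; rewrite /= exprM sqr_sqrtr; last by rewrite !addr_ge0 ?sqr_ge0.
move=> h.
have X0 : 0 < 1 + x ^+ 2 by rewrite ltr_pwDl ?sqr_ge0.
have T0 : 0 < 1 + t ^+ 2 by rewrite ltr_pwDl ?sqr_ge0.
have D0 : 0 <= 1 + x ^+ 2 + t ^+ 2 by rewrite addr_ge0 ?sqr_ge0// ltW.
have P0 : 0 < (1 + x ^+ 2) ^+ n * (1 + t ^+ 2) by rewrite mulr_gt0// exprn_gt0.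
have cm0 : 0 <= cmod (F x t) by exact: sqrtr_ge0.
rewrite -mulrA -invfM ler_pdivlMr// mulrC (le_trans _ (le_trans h (ler_norm M)))//.
rewrite ler_wpM2r// [leRHS]exprSr ler_pM ?exprn_ge0 ?(ltW X0) ?(ltW T0)//.
  by rewrite lerXn2r ?nnegrE ?(ltW X0)// lerDl sqr_ge0.
by rewrite lerD2r lerDl sqr_ge0.
Qed.

End Decay.

(** * From real parts and imaginary parts to the restriction norm *)

Section Final.
Context {R : realType}.
Notation mu := (@lebesgue_measure R).

Lemma abs_le_cmod (z : R * R) : `|z.1| <= cmod z /\ `|z.2| <= cmod z.
Proof.
by split; rewrite -sqrtr_sqr /cmod ler_sqrt ?addr_ge0 ?sqr_ge0// ?lerDl ?lerDr sqr_ge0.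
Qed.

(** Extension by zero fixes the values on x <= 0, where the test class says nothing about F. *)
Definition re_part (F : R -> R -> R * R) := halfplane (fun z => (F z.1 z.2).1).
Definition im_part (F : R -> R -> R * R) := halfplane (fun z => (F z.1 z.2).2).
Definition modulus (F : R -> R -> R * R) := halfplane (fun z => cmod (F z.1 z.2)).

Section fixed_F.
Variables (a : R) (F : R -> R -> R * R).
Hypotheses (a0 : 0 <= a) (SF : Splus F).

Lemma meas_re_part : measurable_fun setT (re_part F).
Proof.
apply: meas_halfplane => x t x0; have [_ _ _ _ h] := SF.1 [::] x t x0.
exact: (cvg_comp _ _ h cvg_fst).
Qed.

Lemma meas_im_part : measurable_fun setT (im_part F).
Proof.
apply: meas_halfplane => x t x0; have [_ _ _ _ h] := SF.1 [::] x t x0.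
exact: (cvg_comp _ _ h cvg_snd).
Qed.

Lemma meas_modulus : measurable_fun setT (modulus F).
Proof.
have -> : modulus F = fun z => Num.sqrt (re_part F z ^+ 2 + im_part F z ^+ 2).
  apply/funext => z; rewrite /modulus /re_part /im_part /halfplane; case: ifP => // _.
  by rewrite expr0n /= addr0 sqrtr0.
have := meas_re_part; have := meas_im_part => m1 m2.
by apply: meas_cont; [exact: sqrt_continuous|meas].
Qed.

Lemma modulus_ge0 z : 0 <= modulus F z.
Proof. by rewrite /modulus /halfplane; case: ifP => // _; exact: sqrtr_ge0. Qed.

Lemma part_le_modulus z : `|re_part F z| <= modulus F z /\ `|im_part F z| <= modulus F z.
Proof.
by rewrite /re_part /im_part /modulus /halfplane; case: ifP => _; rewrite ?normr0//; exact: abs_le_cmod.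
Qed.

Lemma modulus_decay : exists (m1 m2 : R -> R) (M1 M2 : R),
  [/\ measurable_fun setT m1 /\ intg (fun x => m1 x * wt a x), forall x, 0 <= m1 x <= M1, intg m2,
    forall t, 0 <= m2 t <= M2 & forall x t, modulus F (x, t) <= m1 x * m2 t].
Proof.
have [n n0 In] := intg_decay_wt a0.
have [M M0 hM] := Splus_decay n SF.
exists (fun x => M * (1 + x ^+ 2) ^- n), (fun t => (1 + t ^+ 2)^-1), M, 1.
have b1 (x : R) : 1 <= 1 + x ^+ 2 by rewrite lerDl sqr_ge0.
have b0 (x : R) : 0 < 1 + x ^+ 2 by exact: lt_le_trans (b1 x).
have n1 (x : R) : 0 <= (1 + x ^+ 2) ^- n <= 1.
  by rewrite invr_ge0 exprn_ge0 ?(ltW (b0 x))// invf_le1 ?exprn_gt0// exprn_ege1.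
split.
- split; last by apply: eq_intg (intgZ M In) => x; rewrite mulrA.
  have -> : (fun x => M * (1 + x ^+ 2) ^- n) = (fun x => M * ((1 + x ^+ 2)^-1) ^+ n).
    by apply/funext => x; rewrite exprVn.
  by have := intg_meas (@intg_oneDsqr R) => ?; meas.
- by move=> x; have /andP[h1 h2] := n1 x; rewrite mulr_ge0// ler_piMr.
- exact: intg_oneDsqr.
- by move=> t; rewrite invr_ge0 (ltW (b0 t)) invf_le1 ?b0 ?b1.
- move=> x t; rewrite /modulus /halfplane /=; case: ifP => [|_]; first exact: hM.
  by rewrite !divr_ge0 ?exprn_ge0 ?(ltW (b0 _)).
Qed.

Definition slice_norm (p t : R) : R :=
  Int (fun x => modulus F (x, t) `^ p * wt a x) `^ p^-1.

Lemma intg_modulus_pow (p t : R) : 1 < p -> intg (fun x => modulus F (x, t) `^ p * wt a x).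
Proof.
move=> p1; have [m1 [m2 [M1 [M2 [[mm1 Im1] m1M Im2 m2M um]]]]] := modulus_decay.
have um' x s : `|modulus F (x, s)| <= m1 x * m2 s by rewrite ger0_norm ?modulus_ge0.
have [ms Is [B hB]] := bounded_L1_slice meas_modulus um' Im1 m1M m2M t.
apply: eq_intg (intg_pow (ltW p1) ms (meas_wt a) hB Is) => x.
by rewrite /slice ger0_norm ?modulus_ge0.
Qed.

Lemma meas_slice_norm (p : R) : 1 < p -> measurable_fun setT (slice_norm p).
Proof.
move=> p1; have [m1 [m2 [M1 [M2 [[mm1 Im1] m1M Im2 m2M um]]]]] := modulus_decay.
have M20 : 0 <= M2 by have /andP[h1 h2] := m2M 0; exact: le_trans h2.
have m1_ge0 x : 0 <= m1 x by case/andP: (m1M x).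
rewrite /slice_norm; apply: meas_powR.
apply: (@meas_Int _ _ _ (fun z : R * R => modulus F (z.2, z.1) `^ p * wt a z.2)
  (fun x => `|M2 * m1 x| `^ p * wt a x)).
- have h1 := measurableT_comp (meas_wt a) (@measurable_snd _ _ R R).
  have h2 := measurableT_comp meas_modulus (measurable_fun_pair (@measurable_snd _ _ R R) measurable_fst).
  by apply: measurable_funM => //; exact: meas_powR.
- apply: (@intg_pow _ _ (M2 * M1)) => //.
  + exact: ltW.
  + by meas.
  + exact: meas_wt.
  + by move=> x; rewrite ger0_norm ?mulr_ge0// ler_wpM2l//; case/andP: (m1M x).
  + by apply: eq_intg (intgZ M2 Im1) => x; rewrite mulrA.
- move=> t x /=; rewrite ger0_norm ?mulr_ge0 ?powR_ge0 ?wt_ge0// ler_wpM2r ?wt_ge0//.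
  have pos : 0 <= p by rewrite ltW// (lt_trans _ p1).
  rewrite ge0_ler_powR ?nnegrE ?modulus_ge0//.
  rewrite (le_trans (um x t))// ger0_norm ?mulr_ge0// mulrC ler_wpM2r//.
  by case/andP: (m2M t).
Qed.

Lemma hankel_slice (u : R * R -> R) (f : R -> R -> R) (xi t : R) : 0 < xi ->
  (forall x, 0 < x -> u (x, t) = f x t) -> intg (fun x => u (x, t) * wt a x) ->
  hankel ((a - 1) / 2) (fun x => f x t) xi = bessel_const a * hk a (slice u t) xi.
Proof.
move=> xi0 uf Iu; have e x : u (x, t) * wt a x = f x t * wt a x.
  by rewrite /wt /half; case: ifP => [/uf ->|]//; rewrite !mulr0.
rewrite hankelE//; last exact: eq_intg Iu.
by congr (_ * _); apply: eq_Int => x; rewrite -e.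
Qed.

Lemma part_bounds (u : R * R -> R) : (forall z, `|u z| <= modulus F z) ->
  exists (m1 m2 : R -> R) (M1 M2 : R),
  [/\ intg (fun x => m1 x * wt a x), forall x, 0 <= m1 x <= M1, intg m2,
    forall t, 0 <= m2 t <= M2 & forall x t, `|u (x, t)| <= m1 x * m2 t].
Proof.
have [m1 [m2 [M1 [M2 [[mm1 Im1] m1M Im2 m2M um]]]]] := modulus_decay.
by move=> uF; exists m1, m2, M1, M2; split => // x t; exact: le_trans (um x t).
Qed.

(** At tau = -xi^2/(2 pi) the phase is e^{i xi^2 t}; the two squares are those of the real and
    imaginary parts of e^{i xi^2 t} (re + i im), integrated in time. *)
Lemma fourier_hankel_sqr (xi : R) : 0 < xi ->
  cmod (fourier_hankel ((a - 1) / 2) F xi (- (xi ^+ 2) / (2 * pi))) ^+ 2 =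
  bessel_const a ^+ 2 *
    ((evol a (re_part F) cos xi - evol a (im_part F) sin xi) ^+ 2 +
     (evol a (im_part F) cos xi + evol a (re_part F) sin xi) ^+ 2).
Proof.
move=> xi0; set c := bessel_const a.
have [m1 [m2 [M1 [M2 [Im1 m1M Im2 m2M um]]]]] := part_bounds (fun z => (part_le_modulus z).1).
have [n1 [n2 [N1 [N2 [In1 n1M In2 n2M un]]]]] := part_bounds (fun z => (part_le_modulus z).2).
have th t : 2 * pi * (- xi ^+ 2 / (2 * pi)) * t = - (xi ^+ 2 * t).
  by have := pi_gt0 R; move: pi => y y0; field; rewrite gt_eqF.
have h1 t : hankel ((a - 1) / 2) (fun x => (F x t).1) xi = c * hk a (slice (re_part F) t) xi.
  apply: (hankel_slice (f := fun x t => (F x t).1)) => // [x x0|].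
    by rewrite /re_part /halfplane /= x0.
  by have [] := bounded_L1_slice meas_re_part um Im1 m1M m2M t.
have h2 t : hankel ((a - 1) / 2) (fun x => (F x t).2) xi = c * hk a (slice (im_part F) t) xi.
  apply: (hankel_slice (f := fun x t => (F x t).2)) => // [x x0|].
    by rewrite /im_part /halfplane /= x0.
  by have [] := bounded_L1_slice meas_im_part un In1 n1M n2M t.
have Ire T := intg_evol a0 meas_re_part um Im1 m1M Im2 m2M xi (T := T).
have Iim T := intg_evol a0 meas_im_part un In1 n1M In2 n2M xi (T := T).
rewrite /cmod sqr_sqrtr ?addr_ge0 ?sqr_ge0// /fourier_hankel /=.
have -> : \int[mu]_(t in [set: R]) (cos (2 * pi * (- xi ^+ 2 / (2 * pi)) * t) *
    hankel ((a - 1) / 2) (fun y => (F y t).1) xi + sin (2 * pi * (- xi ^+ 2 / (2 * pi)) * t) *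
    hankel ((a - 1) / 2) (fun y => (F y t).2) xi) =
    c * (evol a (re_part F) cos xi - evol a (im_part F) sin xi).
  rewrite /evol -IntB; [|exact/Ire/trig_cos|exact/Iim/trig_sin].
  rewrite -IntZ; last by apply: intgB; [exact/Ire/trig_cos|exact/Iim/trig_sin].
  by apply: eq_Int => t; rewrite th h1 h2 cosN sinN; ring.
have -> : \int[mu]_(t in [set: R]) (cos (2 * pi * (- xi ^+ 2 / (2 * pi)) * t) *
    hankel ((a - 1) / 2) (fun y => (F y t).2) xi - sin (2 * pi * (- xi ^+ 2 / (2 * pi)) * t) *
    hankel ((a - 1) / 2) (fun y => (F y t).1) xi) =
    c * (evol a (im_part F) cos xi + evol a (re_part F) sin xi).
  rewrite /evol -IntD; [|exact/Iim/trig_cos|exact/Ire/trig_sin].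
  rewrite -IntZ; last by apply: intgD; [exact/Iim/trig_cos|exact/Ire/trig_sin].
  by apply: eq_Int => t; rewrite th h1 h2 cosN sinN; ring.
by rewrite !exprMn mulrDr.
Qed.

Lemma slice_norm_mixed (p b t : R) : 1 < p ->
  ((\int[mu]_(x in Rpos) ((cmod (F x t)) `^ p * x `^ a)%:E) `^ (b / p) = (slice_norm p t `^ b)%:E)%E.
Proof.
move=> p1; rewrite /Rpos integral_half.
have -> : (\int[mu]_x (half (fun x => (cmod (F x t)) `^ p * x `^ a) x)%:E =
    (Int (fun x => modulus F (x, t) `^ p * wt a x))%:E)%E.
  rewrite EFin_Int; last exact: intg_modulus_pow.
  apply: eq_integral => x _; congr EFin.
  by rewrite /half /modulus /halfplane /wt /half /=; case: ifP => //; rewrite mulr0.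
by rewrite poweR_EFin /slice_norm -powRrM (mulrC p^-1).
Qed.

End fixed_F.

Lemma sum_sqr_le (u v y z : R) :
  (u - z) ^+ 2 + (y + v) ^+ 2 <= 2 * (u ^+ 2 + v ^+ 2 + (y ^+ 2 + z ^+ 2)).
Proof. by have := sqr_ge0 (u + z); have := sqr_ge0 (y - v); lra. Qed.

(** [evol_estimate] is applied to the real and to the imaginary part, both controlled by the slice
    norms of the modulus. The factor 4 is 2 from [sum_sqr_le] times 2 for the two parts, and the
    added unit keeps K positive. *)
Lemma restr_norm_bound (a p : R) : 0 <= a -> 1 < p -> p < 2 ->
  let lam := (1 + a) / 2 * (2 / p - 1) in 0 < lam -> lam < 1 ->
  exists2 K : R, 0 < K & forall (F : R -> R -> R * R) (N : R), Splus F -> 0 < N ->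
    (\int[mu]_t (slice_norm a F p t `^ (2 / (2 - lam)))%:E <= (N `^ (2 / (2 - lam)))%:E)%E ->
    (restr_norm a F <= (K * N)%:E)%E.
Proof.
move=> a0 p1 p2 lam l0 l1; have [C C0 HC] := evol_estimate a0 p1 p2 l0 l1.
pose c := bessel_const a.
exists (Num.sqrt (4 * c ^+ 2 * C) + 1); first by rewrite ltr_wpDl ?sqrtr_ge0.
move=> F N SF N0 hN; rewrite /restr_norm /Rpos integral_half.
have [m1 [m2 [M1 [M2 [Im1 m1M Im2 m2M um]]]]] := part_bounds a0 SF (fun z => (part_le_modulus F z).1).
have [n1 [n2 [N1 [N2 [In1 n1M In2 n2M un]]]]] := part_bounds a0 SF (fun z => (part_le_modulus F z).2).
have mre := meas_re_part SF; have mim := meas_im_part SF.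
have pos : 0 < p by exact: lt_trans p1.
have sn t : slice_norm a F p t `^ p = Int (fun x => modulus F (x, t) `^ p * wt a x).
  rewrite /slice_norm -powRrM mulVf ?gt_eqF// powRr1// Int_ge0// => x.
  by rewrite mulr_ge0 ?powR_ge0 ?wt_ge0.
have snle (u : R * R -> R) t : measurable_fun setT u -> (forall z, `|u z| <= modulus F z) ->
    Int (fun x => `|u (x, t)| `^ p * wt a x) <= slice_norm a F p t `^ p.
  move=> mu_ uF; rewrite sn.
  have le x : `|u (x, t)| `^ p * wt a x <= modulus F (x, t) `^ p * wt a x.
    by rewrite ler_wpM2r ?wt_ge0// ge0_ler_powR ?nnegrE ?modulus_ge0// ltW.
  have Im := intg_modulus_pow a0 SF t p1.
  apply: le_Int => //; apply: intg_le Im => [|x].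
    have := measurableT_comp mu_ (pair2_measurable t) => /= h; have := meas_wt a => ?.
    by meas.
  by rewrite ger0_norm ?le// mulr_ge0 ?powR_ge0 ?wt_ge0.
have sn0 t : 0 <= slice_norm a F p t by exact: powR_ge0.
have ms := meas_slice_norm a0 SF p1.
have E1 := HC _ _ _ _ _ _ _ mre um Im1 m1M Im2 m2M ms sn0
  (fun t => snle _ t mre (fun z => (part_le_modulus F z).1)) N0 hN.
have E2 := HC _ _ _ _ _ _ _ mim un In1 n1M In2 n2M ms sn0
  (fun t => snle _ t mim (fun z => (part_le_modulus F z).2)) N0 hN.
have mrc := meas_evol a0 mre um Im1 m1M Im2 m2M (@trig_cos R).
have mrs := meas_evol a0 mre um Im1 m1M Im2 m2M (@trig_sin R).
have mic := meas_evol a0 mim un In1 n1M In2 n2M (@trig_cos R).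
have mis := meas_evol a0 mim un In1 n1M In2 n2M (@trig_sin R).
have mw := @meas_wt R a.
pose A1 xi := (evol a (re_part F) cos xi ^+ 2 + evol a (re_part F) sin xi ^+ 2) * wt a xi.
pose A2 xi := (evol a (im_part F) cos xi ^+ 2 + evol a (im_part F) sin xi ^+ 2) * wt a xi.
have A10 xi : 0 <= A1 xi by rewrite mulr_ge0 ?wt_ge0// addr_ge0 ?sqr_ge0.
have A20 xi : 0 <= A2 xi by rewrite mulr_ge0 ?wt_ge0// addr_ge0 ?sqr_ge0.
have mA1 : measurable_fun setT A1.
  exact: (measurable_funM (measurable_funD (meas_X 2 mrc) (meas_X 2 mrs)) mw).
have mA2 : measurable_fun setT A2.
  exact: (measurable_funM (measurable_funD (meas_X 2 mic) (meas_X 2 mis)) mw).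
have [I1 B1] := ge0_intgP mA1 A10 E1.
have [I2 B2] := ge0_intgP mA2 A20 E2.
set I := (\int[mu]_x _)%E.
have IE : (I <= (4 * c ^+ 2 * C * N ^+ 2)%:E)%E.
  have -> : I = (\int[mu]_xi (c ^+ 2 *
    ((evol a (re_part F) cos xi - evol a (im_part F) sin xi) ^+ 2 +
     (evol a (im_part F) cos xi + evol a (re_part F) sin xi) ^+ 2) * wt a xi)%:E)%E.
    apply: eq_integral => xi _; congr EFin; rewrite /half /wt /half.
    by case: ifP => [xi0|_]; [rewrite fourier_hankel_sqr|rewrite mulr0].
  apply: (@le_trans _ _ (\int[mu]_xi (2 * c ^+ 2 * (A1 xi + A2 xi))%:E)%E).
    apply: ge0_eInt_le.
    - apply: measurable_funM mw; apply: (measurable_funM (measurable_cst _)).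
      exact: (measurable_funD (meas_X 2 (measurable_funB mrc mis)) (meas_X 2 (measurable_funD mic mrs))).
    - exact: (measurable_funM (measurable_cst _) (measurable_funD mA1 mA2)).
    - by move=> x; rewrite mulr_ge0 ?wt_ge0// mulr_ge0 ?addr_ge0 ?sqr_ge0.
    - move=> x; rewrite /A1 /A2; move: (wt_ge0 a x) (sqr_ge0 c).
      move: (evol a (re_part F) cos x) (evol a (re_part F) sin x) (evol a (im_part F) cos x)
        (evol a (im_part F) sin x) (wt a x) (c ^+ 2) => u v y z o d o0 d0; rewrite -mulrDl.
      have -> : 2 * d * ((u ^+ 2 + v ^+ 2 + (y ^+ 2 + z ^+ 2)) * o) =
        d * (2 * (u ^+ 2 + v ^+ 2 + (y ^+ 2 + z ^+ 2))) * o by ring.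
      rewrite ler_wpM2r// ler_wpM2l//.
      exact: sum_sqr_le.
  rewrite -EFin_Int; last by apply: intgZ; exact: intgD.
  rewrite IntZ; last exact: intgD.
  rewrite IntD// lee_fin.
  have -> : 4 * c ^+ 2 * C * N ^+ 2 = 2 * c ^+ 2 * (C * N ^+ 2 + C * N ^+ 2).
    by move: (c ^+ 2) (N ^+ 2) => x y; ring.
  apply: ler_wpM2l; last exact: (lerD B1 B2).
  by apply: mulr_ge0; [exact: ler0n|exact: sqr_ge0].
clear E1 E2 mA1 mA2 B1 B2 I1 I2 A10 A20 A1 A2 mw mrc mrs mic mis ms hN.
have I0 : (0 <= I)%E.
  apply: integral_ge0 => x _; rewrite lee_fin /half; case: ifP => // _.
  by rewrite mulr_ge0 ?powR_ge0 ?sqr_ge0.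
have cC : 0 <= 4 * c ^+ 2 * C.
  by rewrite mulr_ge0 ?(ltW C0)// mulr_ge0 ?sqr_ge0.
apply: (@le_trans _ _ ((4 * c ^+ 2 * C * N ^+ 2)%:E `^ 2^-1)%E).
  apply: gt0_ler_poweR IE => //; rewrite in_itv/= ?leey ?andbT// lee_fin.
  by rewrite mulr_ge0 ?sqr_ge0.
rewrite poweR12_sqrt ?lee_fin; last by rewrite mulr_ge0 ?sqr_ge0.
rewrite sqrtrM// sqrtr_sqr gtr0_norm//.
by rewrite (mulrDl (Num.sqrt _)) lerDl mul1r ltW.
Qed.

End Final.

(** * Arithmetic of admissible exponents *)

Section Exponents.
Context {R : realType}.
Notation mu := (@lebesgue_measure R).

(** Take N = X^{1/b} + e/K, which is positive even if X = 0, and let e tend to 0; for infinite X the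
    right-hand side is infinite. *)
Lemma lee_scaled_root (K b : R) (X Y : \bar R) : 0 < K -> 0 < b -> (0 <= X)%E ->
  (forall N, 0 < N -> (X <= (N `^ b)%:E)%E -> (Y <= (K * N)%:E)%E) ->
  (Y <= K%:E * X `^ b^-1)%E.
Proof.
move=> K0 b0; case: X => [x||//] X0 h; last first.
  by rewrite poweRyr ?invr_eq0 ?gt_eqF// gt0_muley ?lte_fin// leey.
rewrite poweR_EFin -EFinM; apply/lee_addgt0Pr => e e0.
rewrite lee_fin in X0.
have d0 : 0 < e / K by exact: divr_gt0.
have := h (x `^ b^-1 + e / K); rewrite ltr_wpDl ?powR_ge0// => /(_ isT).
rewrite mulrDr (mulrC _ (e / K)) divfK ?gt_eqF// EFinD; apply.
rewrite lee_fin -{1}(powRr1 X0) -(mulVf (lt0r_neq0 b0)) powRrM.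
by rewrite ge0_ler_powR ?nnegrE ?addr_ge0 ?powR_ge0 ?lerDl ?(ltW b0) ?(ltW d0).
Qed.

Lemma conjexp_itv (r : R) : 2 < r -> 1 < conjexp r /\ conjexp r < 2.
Proof.
move=> r2; have r1 : 0 < r - 1 by lra.
by rewrite /conjexp ltr_pdivlMr// ltr_pdivrMr//; split; lra.
Qed.

(** The scaling relation says lam = 2/q, so 2/(2 - lam) is q'. The bound lam < 1 comes from r <
    2(a+1)/(a-1) when a > 1, and from lam < (a+1)/2 <= 1 otherwise. *)
Lemma admissible_exponents (a q r : R) : 0 <= a -> admissible a q r ->
  let lam := (1 + a) / 2 * (2 / conjexp r - 1) in
  [/\ 0 < lam, lam < 1 & conjexp q = 2 / (2 - lam)].
Proof.
move=> a0 [r2 ra qr] lam; have r0 : 0 < r by lra.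
have a1 : 0 < a + 1 by lra.
have lamE : lam = 2 / q.
  rewrite qr /lam /conjexp invf_div; field; rewrite gt_eqF//=.
have r_inv : r^-1 < 2^-1 by rewrite ltf_pV2 ?posrE.
have lam0 : 0 < lam by rewrite lamE qr mulr_gt0// subr_gt0.
have lam1 : lam < 1.
  rewrite lamE qr -ltr_pdivlMl// mulr1.
  have [a_le1|a_gt1] := leP a 1.
    have : 2^-1 <= (a + 1)^-1 by rewrite lef_pV2 ?posrE//; lra.
    have : 0 < r^-1 by rewrite invr_gt0.
    lra.
  have a10 : 0 < a - 1 by lra.
  have : (a - 1) / (2 * (a + 1)) < r^-1.
    by rewrite -invf_div ltf_pV2 ?posrE ?divr_gt0 ?mulr_gt0//; exact: ra.
  have -> : (a - 1) / (2 * (a + 1)) = 2^-1 - (a + 1)^-1 by field; rewrite gt_eqF.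
  lra.
have q0 : q != 0 by apply: contraTneq lam0 => q0; rewrite lamE q0 invr0 mulr0 ltxx.
split=> //; rewrite lamE /conjexp.
have q1 : q - 1 != 0.
  apply: contraTneq lam1 => /subr0_eq q1; rewrite lamE q1; lra.
have q2 : 2 * q - 2 != 0 by rewrite -[X in _ - X]mulr1 -mulrBr mulf_neq0.
by field; rewrite q0 q1 q2.
Qed.

Lemma admissible_diag (a : R) : 0 <= a ->
  admissible a (2 * (a + 3) / (a + 1)) (2 * (a + 3) / (a + 1)) /\
  conjexp (2 * (a + 3) / (a + 1)) = 2 * (a + 3) / (a + 5).
Proof.
move=> a0; have a1 : 0 < a + 1 by lra.
have a3 : 0 < a + 3 by lra.
have a5 : 0 < a + 5 by lra.
split; last first.
  rewrite /conjexp; field; rewrite !gt_eqF//=; lra.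
split.
- rewrite ltr_pdivlMr//; lra.
- move=> a_gt1; have a10 : 0 < a - 1 by lra.
  rewrite ltr_pdivlMr// mulrAC ltr_pdivrMr//; nra.
- by field; rewrite !gt_eqF.
Qed.

End Exponents.

Unset Implicit Arguments.

Theorem theoremT (R : realType) :
  (forall a q r : R, 0 <= a -> admissible a q r ->
    exists C : R, 0 < C /\
      forall F : R -> R -> R * R, Splus F ->
        (restr_norm a F <= C%:E * mixed_norm a (conjexp q) (conjexp r) F)%E)
  /\
  (forall a : R, 0 <= a ->
    exists C : R, 0 < C /\
      forall F : R -> R -> R * R, Splus F ->
        (restr_norm a F <=
           C%:E * (\int[lebesgue_measure]_(t in [set: R])
                     \int[lebesgue_measure]_(x in Rpos)
                       ((cmod (F x t)) `^ (2 * (a + 3) / (a + 5)) * x `^ a)%:E)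
                  `^ ((a + 5) / (2 * (a + 3))))%E).
Proof.
have strichartz : forall a q r : R, 0 <= a -> admissible a q r ->
    exists C : R, 0 < C /\
      forall F : R -> R -> R * R, Splus F ->
        (restr_norm a F <= C%:E * mixed_norm a (conjexp q) (conjexp r) F)%E.
  move=> a q r a0 adm; have [l0 l1 ->] := admissible_exponents a0 adm.
  have [p1 p2] : 1 < conjexp r /\ conjexp r < 2 by case: adm => /conjexp_itv.
  have [K K0 HK] := restr_norm_bound a0 p1 p2 l0 l1.
  exists K; split => // F SF; rewrite /mixed_norm.
  under eq_integral do rewrite (slice_norm_mixed a0 SF _ _ p1).
  apply: lee_scaled_root => //.
  - by rewrite divr_gt0// subr_gt0 (lt_trans l1)// ltr1n.
  - by apply: integral_ge0 => t _; rewrite lee_fin powR_ge0.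
  - by move=> N N0 hN; exact: HK.
split => // a a0; have [adm e] := admissible_diag a0.
have [C [C0 HC]] := strichartz _ _ _ a0 adm.
(* On the diagonal q' = r', so the inner exponent q'/r' is 1 and the mixed norm collapses to a
   single power of the double integral. *)
exists C; split => // F SF; have := HC F SF; rewrite /mixed_norm e divff; last first.
  by rewrite gt_eqF// divr_gt0// ?mulr_gt0//; lra.
rewrite invf_div; have -> // : (\int[lebesgue_measure]_t (\int[lebesgue_measure]_(x in Rpos)
    ((cmod (F x t)) `^ (2 * (a + 3) / (a + 5)) * x `^ a)%:E) `^ 1 =
  \int[lebesgue_measure]_t \int[lebesgue_measure]_(x in Rpos)
    ((cmod (F x t)) `^ (2 * (a + 3) / (a + 5)) * x `^ a)%:E)%E.
apply: eq_integral => t _; rewrite poweRe1//; apply: integral_ge0 => x _.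
by rewrite lee_fin mulr_ge0 ?powR_ge0.
Qed.
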